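(* For complex-valued $q,M_0\in L_2(0,\pi)$ put $M(x)=(\pi-x)^{-1}M_0(x)$, $\mathbf f=\{q,M_0\}$, and let $\lambda_k$ ($k\ge1$) be the eigenvalues of the Dirichlet problem $$-y''(x)+q(x)y(x)+\int_0^x M(x-t)y(t)\,dt=\lambda y(x)\ \ (0<x<\pi),\qquad y(0)=y(\pi)=0,$$ and $\rho_k=\lambda_k^{1/2}$ with $-\pi/2<\arg\rho_k\le\pi/2$. There exist absolute constants $c_1,c_2>0$ such that for all $k\ge1$, all $r>0$ and all $\mathbf f\in L_2\oplus L_2$ lying in the ball of radius $r$ (i.e. $\|\mathbf f\|\le r$), $$|\rho_k-k|\le C\|\mathbf f\|\,k^{-1},\qquad C=\max(c_2r,\,c_1).$$ In particular, for all $\mathbf f$ in the ball $\|\mathbf f\|\le r_0=c_1/c_2$ this estimate holds for all $k\ge 1$ with $C=c_1$. For $c_1$ one can take any number $>1/\sqrt\pi$, but the constant $c_2$ depends on $c_1$ and increases as $c_1$ decreases.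
   Context: $L_2=L_2(0,\pi)$; the norm on pairs is $\|\mathbf f\|=\|q\|_{L_2}+2\|M_0\|_{L_2}$. ''Absolute'' means independent of $k$, $\mathbf f$ and $r$. Conventions on eigenvalues: let $S(x,\rho)$ be the solution of the equation with $\lambda=\rho^2$ and $S(0,\rho)=0$, $S'(0,\rho)=1$. The numbers $\rho_k$ are the zeros of the even entire function $\rho\mapsto S(\pi,\rho)$ subject to $-\pi/2<\arg\rho_k\le\pi/2$; eigenvalues $\lambda_k=\rho_k^2$ are counted with algebraic multiplicity (multiplicity of $\lambda_k$ as a zero of $\lambda\mapsto S(\pi,\sqrt\lambda)$) and numbered $k=1,2,\dots$ in order of increasing modulus. *)

(* Defs.v *)
From HB Require Import structures.
From mathcomp Require Export all_boot all_order all_algebra.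
From mathcomp Require Export all_classical all_reals all_analysis.
From mathcomp Require Export complex.
Export numFieldNormedType.Exports.
Export Order.TTheory GRing.Theory Num.Theory.

#[export] Set Implicit Arguments.
#[export] Unset Strict Implicit.
#[export] Unset Printing Implicit Defensive.

Local Open Scope classical_set_scope.
Local Open Scope ring_scope.
Local Open Scope complex_scope.

Notation cmod := (@ComplexField.Normc.normc _).

Section Defs.
Variable R : realType.
Implicit Types (q f y : R -> R[i]) (lam z : R[i]).

Local Notation mu := (@lebesgue_measure R).

Definition cintegrable (A : set R) f : Prop :=
  mu.-integrable A (fun x => (complex.Re (f x))%:E) /\
  mu.-integrable A (fun x => (complex.Im (f x))%:E).

Definition cintegral (A : set R) f : R[i] :=
  (\int[mu]_(x in A) complex.Re (f x)) +i* (\int[mu]_(x in A) complex.Im (f x)).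

Definition L2 f : Prop :=
  [/\ measurable_fun `]0, pi[ (fun x => complex.Re (f x)),
      measurable_fun `]0, pi[ (fun x => complex.Im (f x)) &
      mu.-integrable `]0, pi[ (fun x => (cmod (f x) ^+ 2)%:E)].

Definition L2norm f : R :=
  Num.sqrt (\int[mu]_(x in `]0, pi[) cmod (f x) ^+ 2).

Definition pair_norm q (M0 : R -> R[i]) : R := L2norm q + 2 * L2norm M0.

(* y is absolutely continuous on [0, pi], i.e. an indefinite Lebesgue integral,
   with derivative y' a.e. *)
Definition ac_deriv y (y' : R -> R[i]) : Prop :=
  cintegrable `]0, pi[ y' /\
  forall x, x \in `[0, pi] -> y x = y 0 + cintegral `]0, x[ y'.

Definition M_of (M0 : R -> R[i]) (x : R) : R[i] := ((pi - x)^-1)%:C * M0 x.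

(* Caratheodory solutions: y and y' are absolutely continuous on [0, pi] and
   the equation holds almost everywhere. Since y' is itself absolutely
   continuous, y' x is the classical derivative of y at every point of [0, pi]
   (one-sided at the endpoints); the values of y outside [0, pi] are
   irrelevant. *)
Definition is_solution q (M0 : R -> R[i]) lam y (y' : R -> R[i]) : Prop :=
  ac_deriv y y' /\
  exists2 y'' : R -> R[i], ac_deriv y' y'' &
    {ae mu, forall x, x \in `]0, pi[ ->
      - y'' x + q x * y x + cintegral `]0, x[ (fun t => M_of M0 (x - t) * y t)
      = lam * y x}.

Definition is_S q (M0 : R -> R[i]) (S : R -> R[i] -> R[i]) : Prop :=
  forall rho : R[i], exists S' : R -> R[i],
    [/\ is_solution q M0 (rho ^+ 2) (S ^~ rho) S', S 0 rho = 0 & S' 0 = 1].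

Definition dirichlet_eigenvalue q (M0 : R -> R[i]) lam : Prop :=
  exists y y' : R -> R[i],
    [/\ is_solution q M0 lam y y', y 0 = 0, y pi = 0 &
        exists2 x, x \in `[0, pi] & y x != 0].

(* z is a zero of order exactly m of the holomorphic function D
   (m = 0 when D z != 0). *)
Definition zero_order (D : R[i] -> R[i]) z (m : nat) : Prop :=
  exists g : R[i]^o -> R[i]^o,
    [/\ \forall w \near (z : R[i]^o), derivable g w 1,
        g z != 0 &
        \forall w \near (z : R[i]^o), D w = (w - z) ^+ m * g w].

(* lam 1, lam 2, ... lists the Dirichlet eigenvalues by nondecreasing modulus,
   each as many times as its algebraic multiplicity, i.e. its multiplicity as a
   zero of z |-> S(pi, sqrt z). As S(pi, .) is even, the branch of the square
   root does not matter. The value lam 0 is unused. *)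
Definition numbered_eigenvalues q (M0 : R -> R[i]) (lam : nat -> R[i]) : Prop :=
  exists2 S : R -> R[i] -> R[i], is_S q M0 S &
    [/\ forall k, (0 < k)%N -> dirichlet_eigenvalue q M0 (lam k),
        forall z, dirichlet_eigenvalue q M0 z ->
          exists2 m, zero_order (fun w => S pi (sqrtC w)) z m &
            ([set k | (0 < k)%N /\ lam k = z] #= `I_m)%card &
        forall j k, (0 < j <= k)%N -> cmod (lam j) <= cmod (lam k)].

(* rho ^+ 2 = lam with - pi / 2 < arg rho <= pi / 2; this selects rho = 0 when
   lam = 0. *)
Definition principal_root lam (rho : R[i]) : Prop :=
  rho ^+ 2 = lam /\
  exists2 t : R, - (pi / 2) < t <= pi / 2 &
    rho = (cmod rho)%:C * (cos t +i* sin t).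

End Defs.

(* Main.v *)
(* Write N for the norm of the pair and S for the solution with S(0) = 0 and
   S'(0) = 1. Variation of constants and a weighted sup norm give
   |2i rho S(pi, rho) - 2i sin(pi rho)| <= 2 exp(pi |Im rho|) t / (1 - t) with
   t = sqrt(pi) N / |rho| < 1. Hence on the circles |rho| = n + 1/2 with
   n + 1/2 >= A N the function w |-> S(pi, sqrt w) is dominated by
   sin(pi sqrt w) / sqrt w, and both have n zeros inside. The comparison of zeros
   is Rouche's theorem, obtained for polynomials by averaging p'/p over roots of
   unity and transferred to the two functions by uniform polynomial
   approximation. So |rho_k| lies in [k - 1/2, k + 1/2[ for k - 1/2 >= A N, and
   expanding the sine at k yields |rho_k - k| <= (1/sqrt(pi) + B N) N / k with an
   absolute B; for smaller k the bound is trivial because k = O(N). Any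
   c1 > 1/sqrt(pi) then absorbs the first order term. *)
Require Import Defs.
From mathcomp Require Import ring lra measurable_realfun.

Local Open Scope classical_set_scope.
Local Open Scope ring_scope.
Local Open Scope complex_scope.

(** Holomorphy of w |-> S(pi, sqrt w) is never established. Multiplicities enter only through the
    expansion D w = g (w - a)^m + o(|w - a|^m), and zero counts only through polynomials close to D
    on a disc; such polynomials exist because divided differences in the spectral parameter solve
    the same Volterra equation. The obstacle on the side of the operator is that M = M0 / (pi - x)
    need not be integrable up to pi. Only the integrals of |M| over (0, t) are used: as a function
    of t they are integrable on (0, pi), with total at most the L1 norm of M0. The perturbation is
    thus measured by one number, [total_weight], which Cauchy-Schwarz on (0, pi) bounds by sqrt(pi)
    N. The threshold 1/sqrt(pi) comes from there: to first order, pi |rho_k - k| is at most sqrt(pi)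
    N / k. *)

Section Cmod.
Variable R : realType.
Implicit Types z w : R[i].

Lemma cmodM z w : cmod (z * w) = cmod z * cmod w.
Proof. exact: ComplexField.Normc.normcM. Qed.
Lemma cmodV z : cmod z^-1 = (cmod z)^-1.
Proof. exact: ComplexField.Normc.normcV. Qed.
Lemma cmod0 : cmod (0 : R[i]) = 0. Proof. exact: ComplexField.Normc.normc0. Qed.
Lemma cmod1 : cmod (1 : R[i]) = 1. Proof. exact: ComplexField.Normc.normc1. Qed.
Lemma cmodN z : cmod (- z) = cmod z. Proof. exact: normcN. Qed.
Lemma cmodD z w : cmod (z + w) <= cmod z + cmod w. Proof. exact: le_normcD. Qed.
Lemma cmodC z w : cmod (z - w) = cmod (w - z).
Proof. by rewrite -cmodN opprB. Qed.
Lemma cmodB z w : cmod (z - w) <= cmod z + cmod w.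
Proof. by rewrite -(cmodN w) cmodD. Qed.
Lemma cmod_ge0 z : 0 <= cmod z. Proof. by case: z => a b; exact: sqrtr_ge0. Qed.
Lemma cmod_eq0 z : (cmod z == 0) = (z == 0).
Proof.
apply/eqP/eqP => [/ComplexField.Normc.eq0_normc//|->]; exact: cmod0.
Qed.
Lemma cmod_gt0 z : (0 < cmod z) = (z != 0).
Proof. by rewrite lt_def cmod_ge0 andbT cmod_eq0. Qed.
Lemma cmodX z n : cmod (z ^+ n) = cmod z ^+ n.
Proof. by elim: n => [|n IH]; rewrite ?expr0 ?cmod1// !exprS cmodM IH. Qed.
Lemma cmod_real (x : R) : cmod x%:C = `|x|.
Proof. by rewrite /= expr0n addr0 sqrtr_sqr. Qed.
Lemma cmod_nat n : cmod (n%:R : R[i]) = n%:R.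
Proof. by rewrite -(rmorph_nat (real_complex R)) cmod_real normr_nat. Qed.
Lemma cmod_norm z : `|z| = (cmod z)%:C. Proof. by case: z. Qed.
Lemma cmod_lerB z w : cmod z - cmod w <= cmod (z - w).
Proof. by have := cmodD (z - w) w; rewrite subrK; lra. Qed.
Lemma cmod_lerD z w : cmod z - cmod w <= cmod (z + w).
Proof. by have := cmodB (z + w) w; rewrite addrK; lra. Qed.
Lemma cmod_dist z w : `|cmod z - cmod w| <= cmod (z - w).
Proof.
rewrite ler_norml cmod_lerB andbT; have := cmod_lerB w z.
by rewrite cmodC; lra.
Qed.
Lemma cmod_sum (I : Type) (r : seq I) (F : I -> R[i]) :
  cmod (\sum_(i <- r) F i) <= \sum_(i <- r) cmod (F i).
Proof.
elim: r => [|i r IH]; first by rewrite !big_nil cmod0.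
by rewrite !big_cons (le_trans (cmodD _ _))// lerD2l.
Qed.
Lemma sqr_cmod z : cmod z ^+ 2 = complex.Re z ^+ 2 + complex.Im z ^+ 2.
Proof. by case: z => a b /=; rewrite sqr_sqrtr// addr_ge0// sqr_ge0. Qed.
Lemma Re_le_cmod z : `|complex.Re z| <= cmod z.
Proof.
rewrite -(@ler_pXn2r _ 2)// ?nnegrE ?cmod_ge0// sqr_cmod real_normK ?num_real//.
by rewrite lerDl sqr_ge0.
Qed.
Lemma Im_le_cmod z : `|complex.Im z| <= cmod z.
Proof.
rewrite -(@ler_pXn2r _ 2)// ?nnegrE ?cmod_ge0// sqr_cmod real_normK ?num_real//.
by rewrite lerDr sqr_ge0.
Qed.
Lemma cmod_le_ReIm z : cmod z <= `|complex.Re z| + `|complex.Im z|.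
Proof.
have -> : z = (complex.Re z)%:C + 'i * (complex.Im z)%:C by exact: complexE.
rewrite (le_trans (cmodD _ _))// cmodM !cmod_real.
rewrite [cmod 'i]/= expr0n expr1n add0r sqrtr1 mul1r.
by case: z => a b /=; rewrite !(mul0r, mul1r, mulr0, addr0, add0r, subr0).
Qed.
End Cmod.

(** * Roots of polynomials in discs *)

Section PolyRouche.
Variable R : realType.
Local Notation C := R[i].
Implicit Types (p : {poly C}) (z a b : C) (s q : R) (K : nat).

Definition croots p : seq C := sval (closed_field_poly_normal p).

Lemma crootsE p : p = lead_coef p *: \prod_(z <- croots p) ('X - z%:P).
Proof. exact: (svalP (closed_field_poly_normal p)). Qed.

Lemma mem_croots p z : p != 0 -> (z \in croots p) = root p z.
Proof.
move=> p0; rewrite [in RHS](crootsE p) rootZ ?lead_coef_eq0//.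
by rewrite root_prod_XsubC.
Qed.


Definition nroots p a (s : R) : nat :=
  count (fun r => cmod (r - a) < s) (croots p).

Lemma logder_prod (rs : seq C) z : z \notin rs ->
  (\prod_(r <- rs) ('X - r%:P))^`().[z] / (\prod_(r <- rs) ('X - r%:P)).[z]
  = \sum_(r <- rs) (z - r)^-1.
Proof.
elim: rs => [|r rs IH]; first by rewrite !big_nil derivC hornerC mul0r.
rewrite in_cons negb_or => /andP[zr zrs]; rewrite !big_cons derivM derivXsubC.
rewrite mul1r !hornerE mulrDl -(IH zrs).
set P := \prod_(_ <- _) _.
have P0 : P.[z] != 0 by rewrite -rootE root_prod_XsubC.
by rewrite invfM mulrCA divff// mulr1 [X in _ + X]mulrACA divff ?mul1r// subr_eq0.
Qed.

Lemma logder p z : ~~ root p z ->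
  p^`().[z] / p.[z] = \sum_(r <- croots p) (z - r)^-1.
Proof.
move=> rz; have p0 : p != 0 by apply: contra rz => /eqP ->; exact: root0.
rewrite -logder_prod ?mem_croots//; set P := \prod_(_ <- _) _.
rewrite [in LHS](crootsE p) -/P derivZ !hornerZ invfM mulrACA divff ?mul1r//.
by rewrite lead_coef_eq0.
Qed.

(** The K equally spaced points of the circle |z| = s. Taking them as the roots of X^K - s^K makes
    [logder] available for sums over them. *)
Definition nodes (s : R) K : seq C := croots ('X^K - (s%:C ^+ K)%:P).

Lemma nodes_neq0 s K : (0 < K)%N -> 'X^K - (s%:C ^+ K)%:P != 0 :> {poly C}.
Proof. by move=> K0; rewrite -size_poly_eq0 size_XnsubC. Qed.

Lemma nodesX s K z : (0 < K)%N -> z \in nodes s K -> z ^+ K = s%:C ^+ K.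
Proof.
move=> K0; rewrite mem_croots ?nodes_neq0// rootE !hornerE subr_eq0.
by move/eqP.
Qed.

Lemma cmod_nodes s K z : (0 < K)%N -> 0 < s -> z \in nodes s K -> cmod z = s.
Proof.
move=> K0 s0 /(nodesX K0) /(congr1 cmod); rewrite !cmodX cmod_real gtr0_norm//.
by move/eqP; rewrite eqrXn2 ?cmod_ge0 ?ltW// => /eqP.
Qed.

Lemma size_nodes s K : (0 < K)%N -> size (nodes s K) = K.
Proof.
move=> K0; have /(congr1 (size : {poly C} -> nat)) := crootsE ('X^K - (s%:C ^+ K)%:P).
rewrite size_scale ?lead_coef_eq0 ?nodes_neq0// size_prod_XsubC size_XnsubC//.
by case.
Qed.

(** Since z / (z - b) = 1 - b / (b - z), the sum reduces to the logarithmic derivative of X^K - s^K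
    at b. *)
Lemma nodes_sum s K b : (0 < K)%N -> 0 < s -> cmod b != s ->
  \sum_(z <- nodes s K) z / (z - b) = K%:R * (s%:C ^+ K / (s%:C ^+ K - b ^+ K)).
Proof.
move=> K0 s0 bs.
have zb z : z \in nodes s K -> z - b != 0.
  move=> zs; rewrite subr_eq0; apply: contra bs => /eqP <-.
  by rewrite (cmod_nodes K0 s0 zs).
have bsK : b ^+ K - s%:C ^+ K != 0.
  rewrite subr_eq0; apply: contra bs => /eqP/(congr1 cmod).
  by rewrite !cmodX cmod_real gtr0_norm// => /eqP; rewrite eqrXn2 ?cmod_ge0 ?ltW.
transitivity (\sum_(z <- nodes s K) (1 - b * (b - z)^-1)).
  apply: eq_big_seq => z zs; have := zb z zs => h.
  by rewrite -[b - z]opprB invrN mulrN opprK -{1}(subrK b z) mulrDl divff.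
rewrite sumrB -mulr_sumr -(@logder ('X^K - (s%:C ^+ K)%:P)); last first.
  by rewrite rootE !hornerE.
rewrite big_const_seq count_predT size_nodes// iter_addr_0.
have -> : ('X^K - (s%:C ^+ K)%:P)^`().[b] = b ^+ K.-1 *+ K.
  by rewrite derivB derivXn derivC subr0 hornerMn hornerXn.
have -> : ('X^K - (s%:C ^+ K)%:P).[b] = b ^+ K - s%:C ^+ K.
  by rewrite hornerD hornerN hornerXn hornerC.
have -> : b * (b ^+ K.-1 *+ K / (b ^+ K - s%:C ^+ K)) =
   K%:R * (b ^+ K / (b ^+ K - s%:C ^+ K)).
  by rewrite -mulr_natl mulrA mulrCA -exprS prednK// -mulrA.
have sbK : s%:C ^+ K - b ^+ K != 0 by rewrite -opprB oppr_eq0.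
by field; apply/andP.
Qed.

(* Each root b of p (relative to the centre a) contributes 1 / (1 - (b/s)^K),
   which tends to 1 inside the circle of radius s and to 0 outside: this is a
   discrete argument principle. *)
Definition avg p a s K : C :=
  K%:R^-1 * \sum_(z <- nodes s K) z * (p^`().[a + z] / p.[a + z]).

Lemma avgE p a s K : (0 < K)%N -> 0 < s -> p != 0 ->
  (forall r, r \in croots p -> cmod (r - a) != s) ->
  avg p a s K = \sum_(r <- croots p) s%:C ^+ K / (s%:C ^+ K - (r - a) ^+ K).
Proof.
move=> K0 s0 p0 h.
have KC : K%:R != 0 :> C by rewrite pnatr_eq0 -lt0n.
transitivity (K%:R^-1 * \sum_(z <- nodes s K) \sum_(r <- croots p) z / (z - (r - a))).
  congr (_ * _); apply: eq_big_seq => z zs; rewrite logder.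
    rewrite mulr_sumr; apply: eq_bigr => r _; congr (_ / _).
    by ring.
  rewrite -mem_croots//; apply/negP => /h.
  by rewrite addrC addKr (cmod_nodes K0 s0 zs) eqxx.
rewrite exchange_big /= mulr_sumr; apply: eq_big_seq => r rs.
by rewrite nodes_sum ?h// mulKf.
Qed.

(** With b = r - a, the term of a root inside the circle differs from 1 by b^K / (s^K - b^K); the
    term of a root outside is small itself. The ratio q keeps all roots off the circle and bounds
    either error by q^K / (1 - q^K). *)
Lemma avg_near p a s q K : (0 < K)%N -> 0 < s -> 0 < q < 1 -> p != 0 ->
  (forall r, r \in croots p -> cmod (r - a) <= q * s \/ s <= q * cmod (r - a)) ->
  cmod (avg p a s K - (nroots p a s)%:R) <=
    (size (croots p))%:R * (q ^+ K / (1 - q ^+ K)).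
Proof.
move=> K0 s0 /andP[q0 q1] p0 h.
have qK : 0 < 1 - q ^+ K by rewrite subr_gt0 exprn_ilt1 ?ltW// -lt0n.
have qK0 : 0 < q ^+ K by rewrite exprn_gt0.
have sK0 : 0 < s ^+ K by rewrite exprn_gt0.
have hs r : r \in croots p -> cmod (r - a) != s.
  by move=> /h[] h1; apply/eqP => h2; move: h1; rewrite h2; nra.
rewrite avgE//.
have -> : (nroots p a s)%:R = \sum_(r <- croots p) (cmod (r - a) < s)%R%:R :> C.
  by rewrite /nroots -sum1_count big_mkcond /= natr_sum; apply: eq_bigr => r _; case: ifP.
rewrite -sumrB (le_trans (cmod_sum _ _))//.
have -> : (size (croots p))%:R * (q ^+ K / (1 - q ^+ K)) =
  \sum_(r <- croots p) (q ^+ K / (1 - q ^+ K)).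
  by rewrite big_const_seq count_predT iter_addr_0 mulr_natl.
rewrite big_seq [leRHS]big_seq; apply: ler_sum => r rs.
set b := r - a.
have sbE : s%:C ^+ K - b ^+ K != 0.
  rewrite subr_eq0; apply: contra (hs _ rs) => /eqP/(congr1 cmod).
  by rewrite !cmodX cmod_real gtr0_norm// => /eqP; rewrite eqrXn2 ?cmod_ge0 ?ltW// eq_sym.
have sX : cmod (s%:C ^+ K) = s ^+ K by rewrite cmodX cmod_real gtr0_norm.
case: (h r rs) => hr; rewrite -/b in hr.
  have -> : cmod b < s by nra.
  have -> : s%:C ^+ K / (s%:C ^+ K - b ^+ K) - true%:R = b ^+ K / (s%:C ^+ K - b ^+ K).
    by rewrite /=; field.
  have bK : cmod b ^+ K <= q ^+ K * s ^+ K.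
    by rewrite -exprMn lerXn2r ?nnegrE ?cmod_ge0// mulr_ge0 ?ltW.
  rewrite cmodM cmodV cmodX ler_pdivrMr ?cmod_gt0//.
  have := cmod_lerB (s%:C ^+ K) (b ^+ K); rewrite sX cmodX => hB.
  rewrite mulrAC ler_pdivlMr//; nra.
have -> : (cmod b < s) = false by apply/negbTE; rewrite -leNgt; nra.
have bK : s ^+ K <= q ^+ K * cmod b ^+ K.
  rewrite -exprMn; apply: lerXn2r => //; rewrite nnegrE; first exact: ltW.
  by rewrite mulr_ge0 ?cmod_ge0// ltW.
rewrite subr0 cmodM cmodV sX ler_pdivrMr ?cmod_gt0// mulrAC ler_pdivlMr//.
have := cmod_lerB (b ^+ K) (s%:C ^+ K); rewrite cmodC sX cmodX => hB.
nra.
Qed.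

End PolyRouche.

(** * Rouche's theorem for polynomials *)

Section Rouche.
Variable R : realType.
Local Notation C := R[i].
Implicit Types (p T U P : {poly C}) (z a b : C) (s q c t u : R) (K : nat).

Lemma exprn_small q (e : R) : 0 <= q < 1 -> 0 < e -> exists2 K, (0 < K)%N & q ^+ K <= e.
Proof.
move=> /andP[q0 q1] e0.
have /cvg_expr/cvgr0Pnorm_le/(_ e e0)[N _ /(_ N.+1)] : `|q| < 1 by rewrite ger0_norm.
move=> /(_ (leqnSn N)) /=; rewrite normrX ger0_norm// => h.
by exists N.+1.
Qed.

Lemma poly_lip p a (r : R) : 0 <= r -> exists2 L, 0 <= L &
  forall z w, cmod (z - a) <= r -> cmod (w - a) <= r ->
    cmod (p.[z] - p.[w]) <= L * cmod (z - w).
Proof.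
move=> r0; elim/poly_ind: p => [|p k [L L0 IH]].
  by exists 0 => // z w _ _; rewrite !horner0 subrr cmod0 mul0r.
exists (L * (r + cmod a) + cmod p.[a] + L * r).
  by rewrite !addr_ge0 ?mulr_ge0 ?addr_ge0 ?cmod_ge0.
move=> z w za wa; rewrite !hornerMXaddC.
have -> : p.[z] * z + k - (p.[w] * w + k) = (p.[z] - p.[w]) * z + p.[w] * (z - w) by ring.
rewrite (le_trans (cmodD _ _))// !cmodM.
have h1 := IH _ _ za wa.
have h2 : cmod z <= r + cmod a by have := cmod_lerB z a; lra.
have h3 : cmod p.[w] <= cmod p.[a] + L * r.
  have := IH w a wa; rewrite subrr cmod0 => /(_ r0) h.
  by have := cmod_lerB p.[w] p.[a]; have := ler_wpM2l L0 wa; lra.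
have := cmod_ge0 (z - w); have := cmod_ge0 z; have := cmod_ge0 p.[w].
have := cmod_ge0 (p.[z] - p.[w]).
move=> g1 g2 g3 g4.
have h4 : cmod (p.[z] - p.[w]) * cmod z <= L * cmod (z - w) * (r + cmod a).
  by apply: ler_pM.
have h5 : cmod p.[w] * cmod (z - w) <= (cmod p.[a] + L * r) * cmod (z - w).
  by rewrite ler_wpM2r.
lra.
Qed.

Lemma size_croots p : p != 0 -> size (croots p) = (size p).-1.
Proof.
move=> p0; rewrite [in RHS](crootsE p) size_scale ?lead_coef_eq0//.
by rewrite size_prod_XsubC.
Qed.

(* On the segment T + t U the samples [avg] are Lipschitz in t while the root
   counts are integers, so the counts cannot jump. *)
Section Homotopy.
Variables (T U : {poly C}) (a : C) (s c : R).
Hypotheses (s0 : 0 < s) (c0 : 0 < c).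
Hypothesis TU : forall z, cmod (z - a) = s -> cmod U.[z] + c <= cmod T.[z].

Let P (t : R) : {poly C} := T + t%:C *: U.

Let Pz t z : (P t).[z] = T.[z] + t%:C * U.[z].
Proof. by rewrite hornerD hornerZ. Qed.

Let P_lower t z : 0 <= t <= 1 -> cmod (z - a) = s -> c <= cmod (P t).[z].
Proof.
have s_gt0 := s0; have c_gt0 := c0.
move=> /andP[t0 t1] /TU h; rewrite Pz.
have := cmod_lerD T.[z] (t%:C * U.[z]); rewrite cmodM cmod_real ger0_norm//.
have := cmod_ge0 U.[z]; nra.
Qed.

Let P_neq0 t : 0 <= t <= 1 -> P t != 0.
Proof.
move=> t01; apply/eqP => P0.
have := @P_lower t (a + s%:C) t01; rewrite addrC addKr cmod_real gtr0_norm//.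
by move=> /(_ erefl); rewrite P0 horner0 cmod0 leNgt c0.
Qed.

(** The polynomials P t are at least c in modulus on the circle and share a Lipschitz constant near
    it, so no root comes closer to the circle than c / L1. A root is compared with its radial
    projection z onto the circle. *)
Let P_gap : exists2 q, 0 < q < 1 & forall t r, 0 <= t <= 1 -> r \in croots (P t) ->
  cmod (r - a) <= q * s \/ s <= q * cmod (r - a).
Proof.
have s_gt0 := s0; have c_gt0 := c0.
have s20 : 0 <= 2 * s by lra.
have [L L0 HL] := poly_lip T a s20; have [L' L'0 HL'] := poly_lip U a s20.
(* The summand c / s makes L1 positive and gives d = c / L1 <= s. *)
pose L1 := L + L' + c / s.
have cs : 0 < c / s by rewrite divr_gt0.
have L10 : 0 < L1 by rewrite /L1; lra.
have L1c : c <= L1 * s.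
  by rewrite -ler_pdivrMr// /L1; lra.
pose d := c / L1; have d0 : 0 < d by rewrite divr_gt0.
have ds : d <= s by rewrite ler_pdivrMr// mulrC.
have sd : 0 < s + d by lra.
(* This q satisfies both s - d <= q s and s <= q (s + d), one for each side of the circle. *)
exists (s / (s + d)).
  by rewrite divr_gt0//= ltr_pdivrMr// mul1r; lra.
move=> t r t01 rt; have [b bE] : exists b, b = r - a by exists (r - a).
rewrite -bE.
have q1 : s - d <= s / (s + d) * s by rewrite mulrAC ler_pdivlMr//; nra.
have q2 x : s + d <= x -> s <= s / (s + d) * x.
  by move=> h; rewrite mulrAC ler_pdivlMr//; nra.
have [b2|b2] := leP (cmod b) (2 * s); last by right; apply: q2; lra.
have [->|b0] := eqVneq b 0.
  by left; rewrite cmod0 mulr_ge0 ?ltW// divr_gt0.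
have B0 : 0 < cmod b by rewrite cmod_gt0.
pose z := a + b * (s / cmod b)%:C.
have za : cmod (z - a) = s.
  rewrite /z addrC addKr cmodM cmod_real ger0_norm ?divr_ge0 ?ltW//.
  by rewrite mulrCA divff ?mulr1// gt_eqF.
have zr : cmod (z - r) = `|s - cmod b|.
  have -> : z - r = b * ((s - cmod b) / cmod b)%:C.
    have bC : (cmod b)%:C != 0 by rewrite (inj_eq (@complexI _)) gt_eqF.
    rewrite mulrBl divff ?gt_eqF// rmorphB rmorph1 /z.
    by rewrite -[r in LHS](subrK a) -bE; ring.
  by rewrite cmodM cmod_real normrM normfV (gtr0_norm B0) mulrCA divff ?mulr1// gt_eqF.
have b2' : cmod (b) <= 2 * s -> cmod (r - a) <= 2 * s by rewrite bE.
have Pr : (P t).[r] = 0.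
  by move: rt; rewrite mem_croots ?P_neq0// => /rootP.
have h1 := P_lower t01 za.
have h2 : cmod (P t).[z] <= L1 * `|s - cmod b|.
  rewrite -[(P t).[z]]subr0 -Pr !Pz.
  have -> : T.[z] + t%:C * U.[z] - (T.[r] + t%:C * U.[r]) =
    (T.[z] - T.[r]) + t%:C * (U.[z] - U.[r]) by ring.
  rewrite (le_trans (cmodD _ _))// cmodM cmod_real.
  have z2 : cmod (z - a) <= 2 * s by rewrite za; lra.
  have := HL _ _ z2 (b2' b2); have := HL' _ _ z2 (b2' b2); rewrite zr => g1 g2.
  case/andP: t01 => t0 t1; rewrite ger0_norm//.
  have := cmod_ge0 (U.[z] - U.[r]); have := normr_ge0 (s - cmod b) => g3 g4.
  have : c / s * `|s - cmod b| >= 0 by rewrite mulr_ge0// ltW.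
  rewrite /L1; nra.
have h3 : d <= `|s - cmod b| by rewrite ler_pdivrMr// mulrC; lra.
have [h|h] := leP (cmod b) s.
  by left; move: h3; rewrite ger0_norm ?subr_ge0//; lra.
right; apply: q2; move: h3; rewrite ltr0_norm ?subr_lt0//; lra.
Qed.

(** The difference of the logarithmic derivatives of P t and P u is (t - u) W / (P t * P u), where W
    = U' T - T' U does not depend on t or u and the denominator is at least c^2 on the circle. *)
Let P_avg_lip K : (0 < K)%N -> exists2 B, 0 <= B & forall t u,
  0 <= t <= 1 -> 0 <= u <= 1 ->
  cmod (avg (P t) a s K - avg (P u) a s K) <= B * `|t - u|.
Proof.
have s_gt0 := s0; have c_gt0 := c0.
move=> K0.
pose W z := U^`().[z] * T.[z] - T^`().[z] * U.[z].
pose B := K%:R^-1 * \sum_(z <- nodes s K) s * (cmod (W (a + z)) / c ^+ 2).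
have B0 : 0 <= B.
  rewrite mulr_ge0 ?invr_ge0 ?ler0n// sumr_ge0// => z _.
  by rewrite mulr_ge0 ?divr_ge0 ?cmod_ge0 ?exprn_ge0// ltW.
exists B => // t u t01 u01.
rewrite /avg -mulrBr -sumrB cmodM cmodV cmod_nat /B -mulrA.
rewrite ler_wpM2l ?invr_ge0 ?ler0n// (le_trans (cmod_sum _ _))// mulr_suml.
rewrite big_seq [leRHS]big_seq; apply: ler_sum => z zs.
have za : cmod (a + z - a) = s by rewrite addrC addKr (cmod_nodes K0 s0 zs).
have Pt0 := P_lower t01 za; have Pu0 := P_lower u01 za.
have Ptn : (P t).[a + z] != 0 by rewrite -cmod_gt0; lra.
have Pun : (P u).[a + z] != 0 by rewrite -cmod_gt0; lra.
have -> : z * ((P t)^`().[a + z] / (P t).[a + z]) -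
    z * ((P u)^`().[a + z] / (P u).[a + z]) =
   z * (W (a + z) / ((P t).[a + z] * (P u).[a + z])) * (t - u)%:C.
  have dP v : (P v)^`().[a + z] = T^`().[a + z] + v%:C * U^`().[a + z].
    by rewrite derivD derivZ hornerD hornerZ.
  move: Ptn Pun; rewrite !dP !Pz /W rmorphB => Ptn Pun.
  by field; apply/andP.
rewrite 3!cmodM cmodV cmodM cmod_real (cmod_nodes K0 s0 zs).
apply: ler_wpM2r => //; apply: ler_wpM2l; first exact: ltW.
apply: ler_wpM2l; first exact: cmod_ge0.
rewrite lef_pV2 ?posrE ?exprn_gt0//; last by rewrite mulr_gt0; lra.
by rewrite expr2 ler_pM// ltW.
Qed.

Lemma rouche_homotopy : nroots (T + U) a s = nroots T a s.
Proof.
have s_gt0 := s0; have c_gt0 := c0.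
have [q q01 gap] := P_gap.
pose d := maxn (size T) (size U).
have Psize t : 0 <= t <= 1 -> (size (croots (P t)) <= d)%N.
  move=> t01; rewrite size_croots ?P_neq0//.
  rewrite (leq_trans (leq_pred _))// (leq_trans (size_polyD _ _))// /d.
  by rewrite geq_max leq_maxl (leq_trans (size_scale_leq _ _))// leq_maxr.
(* All P t have at most d roots, so one K with q^K below this value brings every sample within 1/4
   of its root count. *)
have e0 : 0 < ((d%:R + 1) * 8)^-1 :> R.
  by rewrite invr_gt0 mulr_gt0 ?ltr_wpDl ?ler0n.
have q01' : 0 <= q < 1 by case/andP: q01 => /ltW -> ->.
have [K K0 qK] := exprn_small q01' e0.
have [B B0 HB] := P_avg_lip K0.
have near t : 0 <= t <= 1 -> cmod (avg (P t) a s K - (nroots (P t) a s)%:R) <= 4^-1.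
  move=> t01; apply: le_trans (avg_near K0 s0 q01 (P_neq0 t01) (gap t ^~ t01)) _.
  have qK0 : 0 <= q ^+ K by rewrite exprn_ge0//; case/andP: q01'.
  have d0 : 0 <= d%:R :> R by exact: ler0n.
  have D : (size (croots (P t)))%:R <= d%:R :> R by rewrite ler_nat Psize.
  have qKd : q ^+ K * (d%:R + 1) <= 8^-1.
    by rewrite -ler_pdivlMr; [rewrite -invfM mulrC|lra].
  have : q ^+ K <= 8^-1 by nra.
  move=> q8; rewrite mulrA ler_pdivrMr; last by lra.
  have : (size (croots (P t)))%:R * q ^+ K <= d%:R * q ^+ K by rewrite ler_wpM2r.
  lra.
(* Three errors of at most 1/4 each keep the difference of two integers below 1. *)
have step t u : 0 <= t <= 1 -> 0 <= u <= 1 -> B * `|t - u| <= 4^-1 ->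
    nroots (P t) a s = nroots (P u) a s.
  move=> t01 u01 Btu; have := near _ u01; have := near _ t01; have := HB _ _ t01 u01.
  set x := avg _ _ _ _; set y := avg _ _ _ _; set m := nroots _ _ _; set n := nroots _ _ _.
  move=> h1 h2 h3.
  have h4 : cmod (m%:R - n%:R : C) < 1.
    have -> : m%:R - n%:R = (x - y) - (x - m%:R) + (y - n%:R) :> C by ring.
    have := cmodD ((x - y) - (x - m%:R)) (y - n%:R).
    have := cmodB (x - y) (x - m%:R).
    lra.
  have : `|m%:R - n%:R| < 1 :> R.
    by rewrite -cmod_real rmorphB !rmorph_nat.
  rewrite ltr_norml => /andP[h5 h6]; case: (ltngtP m n) => // mn.
    have : (m.+1)%:R <= n%:R :> R by rewrite ler_nat.
    by rewrite -natr1 => h; exfalso; lra.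
  have : (n.+1)%:R <= m%:R :> R by rewrite ler_nat.
  by rewrite -natr1 => h; exfalso; lra.
pose m := (Num.truncn (4 * B)).+1.
have mB : 4 * B < m%:R by exact: truncnS_gt.
have m0 : 0 < m%:R :> R by rewrite ltr0n.
have frac i : (i <= m)%N -> 0 <= (i%:R / m%:R : R) <= 1.
  by move=> im; rewrite divr_ge0 ?ler0n//= ler_pdivrMr// mul1r ler_nat.
have chain i : (i <= m)%N -> nroots (P (i%:R / m%:R)) a s = nroots (P 0) a s.
  elim: i => [|i IH] im; first by rewrite mul0r.
  rewrite -IH 1?ltnW//; apply: step; rewrite ?frac// 1?ltnW//.
  rewrite -mulrBl -natrB// subSnn mul1r gtr0_norm ?invr_gt0//.
  by rewrite ler_pdivrMr//; lra.
have := chain m (leqnn m); rewrite divff ?gt_eqF// /P.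
by rewrite rmorph1 scale1r rmorph0 scale0r addr0.
Qed.

End Homotopy.

Lemma rouche T P a s c : 0 < s -> 0 < c ->
  (forall z, cmod (z - a) = s -> cmod (P.[z] - T.[z]) + c <= cmod T.[z]) ->
  nroots P a s = nroots T a s.
Proof.
move=> s0 c0 h; rewrite -[P](subrK T) addrC.
by apply: (rouche_homotopy s0 c0) => z /h; rewrite hornerD hornerN.
Qed.

Lemma nroots_XsubCX (k : C) a m s : k != 0 -> 0 < s ->
  nroots (k *: ('X - a%:P) ^+ m) a s = m.
Proof.
move=> k0 s0; set p := _ *: _.
have p0 : p != 0 by rewrite scaler_eq0 negb_or k0 expf_neq0 ?polyXsubC_eq0.
have : all (pred1 a) (croots p).
  apply/allP => r; rewrite mem_croots// /p rootZ// /root horner_exp !hornerE.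
  by rewrite expf_eq0 => /andP[_]; rewrite subr_eq0.
move=> /all_pred1P E; rewrite /nroots E count_nseq subrr cmod0 s0 mul1n.
rewrite size_croots// size_scale// size_exp_XsubC//.
Qed.

End Rouche.

(** * Zeros of limits of polynomials *)

Section Hurwitz.
Variable R : realType.
Local Notation C := R[i].
Implicit Types (p : {poly C}) (z w a b : C) (s q c e L : R) (D : C -> C).

Definition poly_close p D L e := forall w, cmod w <= L -> cmod (p.[w] - D w) <= e.

Definition poly_approx D L := forall e, 0 < e -> exists p, poly_close p D L e.

(* The only trace of holomorphy that is needed at a zero of order m. *)
Definition order_at D a m := exists2 g, g != 0 & forall e, 0 < e ->
  exists2 d, 0 < d & forall w, cmod (w - a) < d ->
    cmod (D w - g * (w - a) ^+ m) <= e * cmod (w - a) ^+ m.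

Lemma croots_root p r : r \in croots p -> p.[r] = 0.
Proof.
have [->|p0] := eqVneq p 0; first by rewrite horner0.
by rewrite mem_croots// => /rootP.
Qed.

(** On a small circle about a, the polynomial p is compared with g (X - a)^m. Both |p - D| and |D -
    g (z - a)^m| are at most |g| s^m / 4, which leaves a gap of half of |g| s^m. The radius s stays
    free below s0 because a common one for all zeros is picked later. *)
Lemma nroots_order_at D a m L : order_at D a m -> cmod a < L ->
  exists2 s0, 0 < s0 & forall s, 0 < s <= s0 -> cmod a + s <= L /\
    exists2 e, 0 < e & forall p, poly_close p D L e -> nroots p a s = m.
Proof.
move=> [g g0 ord] aL; have G0 : 0 < cmod g by rewrite cmod_gt0.
have /ord[d d0 hd] : 0 < cmod g / 4 by lra.
exists (Num.min (d / 2) (L - cmod a)).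
  by rewrite lt_min; apply/andP; split; lra.
move=> s /andP[s0]; rewrite le_min => /andP[sd sL]; split; first by lra.
have sm : 0 < s ^+ m by rewrite exprn_gt0.
have gs : 0 < cmod g * s ^+ m by rewrite mulr_gt0.
exists (cmod g * s ^+ m / 4); first by lra.
move=> p hp; rewrite -(nroots_XsubCX a m g0 s0).
have c0 : 0 < cmod g * s ^+ m / 2 by lra.
apply: (rouche s0 c0) => z zs.
have zL : cmod z <= L by have := cmodD (z - a) a; rewrite subrK; lra.
rewrite hornerZ horner_exp !hornerE cmodM cmodX zs.
have := hd z; rewrite zs => /(_ ltac:(lra)) h1; have h2 := hp z zL.
have -> : p.[z] - g * (z - a) ^+ m = (p.[z] - D z) + (D z - g * (z - a) ^+ m).
  by ring.
have := cmodD (p.[z] - D z) (D z - g * (z - a) ^+ m); lra.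
Qed.

Lemma poly_approx_unif D L e : poly_approx D L -> 0 <= L -> 0 < e ->
  exists2 d, 0 < d & forall z w, cmod z <= L -> cmod w <= L ->
    cmod (z - w) <= d -> cmod (D z - D w) <= e.
Proof.
move=> aD L0 e0; have [|p hp] := aD (e / 4); first by lra.
have [l l0 hl] := poly_lip p 0 L0.
exists (e / (4 * (l + 1))); first by rewrite divr_gt0//; lra.
move=> z w zL wL zw.
have := hl z w; rewrite !subr0 => /(_ zL wL) h.
have -> : D z - D w = (D z - p.[z]) + ((p.[z] - p.[w]) + (p.[w] - D w)) by ring.
have := cmodD (D z - p.[z]) ((p.[z] - p.[w]) + (p.[w] - D w)).
have := cmodD (p.[z] - p.[w]) (p.[w] - D w).
have := hp _ zL; have := hp _ wL; rewrite (cmodC (D z)).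
have : l * cmod (z - w) <= e / 4.
  apply: le_trans (ler_wpM2l l0 zw) _.
  rewrite mulrA ler_pdivrMr; last by lra.
  by nra.
lra.
Qed.

(** The plane as [R * R], where closed boxes are compact by [compact_setX]. *)
Let toC (x : R * R) : C := x.1 +i* x.2.

Let toC_cvg (x : R * R) a : (fun y => cmod (toC y - a)) @ x --> cmod (toC x - a).
Proof.
apply/cvgrPdist_le => e e0; have e2 : 0 < e / 2 by lra.
have c1 : y.1 @[y --> x] --> x.1 by exact: cvg_fst.
have c2 : y.2 @[y --> x] --> x.2 by exact: cvg_snd.
near=> y.
have h1 : `|x.1 - y.1| <= e / 2 by near: y; exact: (cvgr_dist_le _ _ c1 _ e2).
have h2 : `|x.2 - y.2| <= e / 2 by near: y; exact: (cvgr_dist_le _ _ c2 _ e2).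
rewrite (le_trans (cmod_dist _ _))//.
have -> : toC x - a - (toC y - a) = (x.1 - y.1) +i* (x.2 - y.2).
  by rewrite opprB addrA subrK /toC; simpc.
rewrite (le_trans (cmod_le_ReIm _))//=; lra.
Unshelve. all: by end_near. Qed.

(** The modulus of D is continuous, by [poly_approx_unif], and attains its minimum on the compact
    disc with the open s-discs about A removed; there D does not vanish. *)
Lemma poly_approx_lower D L (A : seq C) s : poly_approx D L -> 0 <= L ->
  (forall w, cmod w <= L -> (forall a, a \in A -> s <= cmod (w - a)) -> D w != 0) ->
  exists2 c, 0 < c & forall w, cmod w <= L ->
    (forall a, a \in A -> s <= cmod (w - a)) -> c <= cmod (D w).
Proof.
move=> aD L0 nz.
pose K := [set x : R * R | cmod (toC x) <= L /\ forall a, a \in A -> s <= cmod (toC x - a)].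
have toCK w : toC (complex.Re w, complex.Im w) = w by case: w.
have [[x0 Kx0]|K0] := pselect (K !=set0); last first.
  exists 1 => // w wL wA; exfalso; apply: K0; exists (complex.Re w, complex.Im w).
  by split; rewrite toCK.
have cK : compact K.
  apply: (@subclosed_compact _ _ (`[- L, L] `*` `[- L, L])); last 2 first.
  - by apply: compact_setX; exact: segment_compact.
  - move=> x [xL _]; split => /=; rewrite in_itv/= -ler_norml.
      by apply: le_trans (Re_le_cmod (toC x)) xL.
    by apply: le_trans (Im_le_cmod (toC x)) xL.
  have -> : K = ((fun x => cmod (toC x - 0)) @^-1` [set t | t <= L]) `&`
     \bigcap_(a in [set` A]) ((fun x => cmod (toC x - a)) @^-1` [set t | s <= t]).
    by apply/seteqP; split => x [h1 h2]; split => //; move: h1;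
      rewrite /preimage /mkset subr0.
  apply: closedI; last apply: closed_bigI => a _; apply: preimage_closed => //.
  - by move=> x _; exact: toC_cvg.
  - by move=> x _; exact: toC_cvg.
have fK : {within K, continuous (fun x => cmod (D (toC x)))}.
  apply/subspace_continuousP => x [xL _]; apply/cvgrPdist_le => e e0.
  have [d d0 hd] := poly_approx_unif aD L0 e0.
  have h0 : cmod (toC y - toC x) @[y --> x] --> 0.
    by rewrite -[X in _ --> X]cmod0 -[X in cmod X](subrr (toC x)); exact: toC_cvg.
  rewrite near_withinE; near=> y => -[yL _].
  rewrite (le_trans (cmod_dist _ _))//; apply: hd => //.
  rewrite cmodC; apply: le_trans (ler_norm _) _; rewrite -normrN -sub0r.
  by near: y; exact: (cvgr_dist_le _ _ h0 _ d0).
have [c cK1 cmin] := compact_EVT_min (ex_intro _ x0 Kx0) cK fK.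
move: cK1; rewrite inE => -[cL cA].
exists (cmod (D (toC c))); first by rewrite cmod_gt0 nz.
move=> w wL wA; rewrite -(toCK w); apply: cmin; rewrite inE.
by split; rewrite toCK.
Unshelve. all: by end_near. Qed.

(** Used to choose in turn a separation of the zeros, a radius for the small circles and a precision
    for the polynomials. *)
Lemma seq_common_radius (T : eqType) (A : seq T) (P : T -> R -> Prop) :
  (forall (x : T) (d d' : R), 0 < d' <= d -> P x d -> P x d') ->
  (forall x : T, x \in A -> exists2 d, 0 < d & P x d) ->
  exists2 d, 0 < d & forall x : T, x \in A -> P x d.
Proof.
move=> mono; elim: A => [|a A IH] h; first by exists 1.
have [d d0 hd] := IH (fun (x : T) xA => h x (@mem_behead _ (a :: A) x xA)).
have [d1 d10 hd1] := h a (mem_head a A).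
have m0 : 0 < Num.min d d1 by rewrite lt_min d0.
exists (Num.min d d1) => // b; rewrite in_cons => /predU1P[->|bA].
  by apply: mono hd1; rewrite m0 ge_min lexx orbT.
by apply: mono (hd _ bA); rewrite m0 ge_min lexx.
Qed.

Lemma count_separated (A : seq C) s r : uniq A ->
  (forall a b, a \in A -> b \in A -> a != b -> 2 * s <= cmod (a - b)) ->
  (count (fun a => (cmod (r - a) < s)%R) A <= 1)%N.
Proof.
elim: A => //= a A IH /andP[aA uA] sep.
have [ra|ra] := boolP (_ < s); last first.
  by apply: IH => // b b' bA b'A; apply: sep; rewrite in_cons ?bA ?b'A orbT.
rewrite (@eq_in_count _ _ pred0) ?count_pred0// => b bA /=.
apply/negbTE; rewrite -leNgt.
have := sep a b; rewrite !in_cons eqxx bA orbT => /(_ isT isT) h.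
have : a != b by apply: contra aA => /eqP ->.
move=> /h; have := cmodB (r - b) (r - a).
have -> : r - b - (r - a) = a - b by ring.
by lra.
Qed.

Lemma separating_radius (A : seq C) : uniq A -> exists2 s, 0 < s &
  forall a b, a \in A -> b \in A -> a != b -> 2 * s <= cmod (a - b).
Proof.
move=> uA.
have [||s s0 hs] := @seq_common_radius _ [seq (a, b) | a <- A, b <- A]
  (fun ab s => ab.1 != ab.2 -> 2 * s <= cmod (ab.1 - ab.2)).
- by move=> [a b] d d' /andP[_ dd'] h /= /h /=; lra.
- move=> [a b] _ /=; have [->|ab] := eqVneq a b; first by exists 1.
  exists (cmod (a - b) / 2); last by move=> _; lra.
  by rewrite divr_gt0// cmod_gt0 subr_eq0.
by exists s => // a b aA bA ab; apply: (hs (a, b)) => //; apply/allpairsP; exists (a, b).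
Qed.

(** Double counting of pairs of a root and a centre near it: by separation a root lies in at most
    one s-disc, and every such disc lies inside the large one. Equality holds once each root in the
    large disc is near some centre. *)
Lemma nroots_clusters p (A : seq C) (m : C -> nat) s L : uniq A ->
  (forall a b, a \in A -> b \in A -> a != b -> 2 * s <= cmod (a - b)) ->
  (forall a, a \in A -> cmod a + s <= L /\ nroots p a s = m a) ->
  (\sum_(a <- A) m a <= nroots p 0%R L)%N /\
  ((forall r, r \in croots p -> cmod r < L -> exists2 a, a \in A & cmod (r - a) < s) ->
    nroots p 0%R L = (\sum_(a <- A) m a)%N).
Proof.
move=> uA sep hA.
have E : (\sum_(a <- A) m a =
    \sum_(r <- croots p) count (fun a => (cmod (r - a) < s)%R) A)%N.
  transitivity (\sum_(a <- A) \sum_(r <- croots p) (cmod (r - a) < s)%R)%N.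
    apply: eq_big_seq => a /hA[_ <-].
    by rewrite /nroots -sum1_count big_mkcond; apply: eq_bigr => r _; case: ifP.
  rewrite exchange_big; apply: eq_bigr => r _.
  by rewrite -sum1_count [RHS]big_mkcond; apply: eq_bigr => a _; case: ifP.
have F : nroots p 0%R L = (\sum_(r <- croots p) (cmod r < L)%R)%N.
  rewrite /nroots -sum1_count big_mkcond; apply: eq_bigr => r _.
  by rewrite subr0; case: ifP.
have le r : (count (fun a => (cmod (r - a) < s)%R) A <= (cmod r < L)%R)%N.
  have := count_separated r uA sep.
  case: (boolP (has (fun a => cmod (r - a) < s) A)) => [/hasP[a aA ra]|]; last first.
    by rewrite has_count -leqNgt leqn0 => /eqP ->.
  suff -> : cmod r < L by [].
  have [aL _] := hA a aA; have := cmodD (r - a) a; rewrite subrK; lra.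
rewrite E F; split; first by apply: leq_sum => r _; exact: le.
move=> cov; apply: eq_big_seq => r rp; apply/eqP; rewrite eqn_leq le andbT.
have [rL|//] := boolP (_ < L); have [a aA ra] := cov r rp rL.
by rewrite -has_count; apply/hasP; exists a.
Qed.

(** If A contains all zeros of D in the closed disc, D is bounded below off the small discs, so a
    close polynomial has no root there. The inequality for incomplete A is kept as well: it later
    bounds the number of listed eigenvalues from above. *)
Lemma nroots_orders D L (A : seq C) (m : C -> nat) : 0 <= L -> poly_approx D L -> uniq A ->
  (forall a, a \in A -> cmod a < L /\ order_at D a (m a)) ->
  exists2 e, 0 < e & forall p, poly_close p D L e ->
  (\sum_(a <- A) m a <= nroots p 0%R L)%N /\
  ((forall w, cmod w <= L -> D w = 0 -> w \in A) ->
    nroots p 0%R L = (\sum_(a <- A) m a)%N).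
Proof.
move=> L0 aD uA hA.
have [s1 s10 sep1] := separating_radius uA.
have [||s2 s20 hs2] := @seq_common_radius _ A (fun a s0 =>
    forall s, 0 < s <= s0 -> cmod a + s <= L /\
    exists2 e, 0 < e & forall p, poly_close p D L e -> nroots p a s = m a).
- by move=> a d d' /andP[_ dd'] h s /andP[s0 sd]; apply: h; rewrite s0 (le_trans sd).
- by move=> a /hA[aL oa]; exact: nroots_order_at.
pose s := Num.min s1 s2.
have s0 : 0 < s by rewrite lt_min s10.
have sep a b : a \in A -> b \in A -> a != b -> 2 * s <= cmod (a - b).
  move=> aA bA ab; apply: le_trans (sep1 a b aA bA ab).
  by rewrite ler_wpM2l// ge_min lexx.
have ss2 : 0 < s <= s2 by rewrite s0 ge_min lexx orbT.
have [||e1 e10 he1] := @seq_common_radius _ A (fun a e =>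
    forall p, poly_close p D L e -> nroots p a s = m a).
- move=> a d d' /andP[_ dd'] h p hp; apply: h => w wL.
  exact: le_trans (hp w wL) dd'.
- by move=> a aA; have [_ ] := hs2 a aA s ss2.
have sub a : a \in A -> cmod a + s <= L by move=> aA; have [] := hs2 a aA s ss2.
(* The precision e has to be fixed before p, hence the case distinction on completeness of A comes
   first. *)
have [full|nfull] := pselect (forall w, cmod w <= L -> D w = 0 -> w \in A).
  have [|c c0 hc] := @poly_approx_lower D L A s aD L0.
    move=> w wL wA; apply/eqP => /(full _ wL)/wA; rewrite subrr cmod0.
    by rewrite leNgt s0.
  exists (Num.min e1 (c / 2)); first by rewrite lt_min e10 divr_gt0.
  move=> p hp.
  have [|h1 h2] := @nroots_clusters p A m s L uA sep.
    move=> a aA; split; first exact: sub.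
    by apply: he1 => // w wL; apply: le_trans (hp w wL) _; rewrite ge_min lexx.
  split=> // _; apply: h2 => r rp rL.
  have [/hasP[a aA ra]|/hasPn nr] := boolP (has (fun a => cmod (r - a) < s) A).
    by exists a.
  have := hp r (ltW rL); rewrite (croots_root rp) sub0r cmodN.
  have h3 : c <= cmod (D r).
    by apply: hc; [exact: ltW|move=> a /nr; rewrite -leNgt].
  by rewrite le_min => /andP[_ h4]; exfalso; lra.
exists e1 => // p hp; have [|h1 h2] := @nroots_clusters p A m s L uA sep.
  by move=> a aA; split; [exact: sub|exact: he1].
by split.
Qed.

Lemma orders_rouche D D0 L c (A A0 : seq C) (m m0 : C -> nat) :
  0 <= L -> 0 < c -> poly_approx D L -> poly_approx D0 L ->
  (forall w, cmod w = L -> cmod (D w - D0 w) + c <= cmod (D0 w)) ->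
  uniq A -> (forall a, a \in A -> cmod a < L /\ order_at D a (m a)) ->
  uniq A0 -> (forall a, a \in A0 -> cmod a < L /\ order_at D0 a (m0 a)) ->
  (forall w, cmod w <= L -> D0 w = 0 -> w \in A0) ->
  (\sum_(a <- A) m a <= \sum_(a <- A0) m0 a)%N /\
  ((forall w, cmod w <= L -> D w = 0 -> w \in A) ->
    (\sum_(a <- A) m a = \sum_(a <- A0) m0 a)%N).
Proof.
move=> L0 c0 aD aD0 DD uA hA uA0 hA0 full0.
have [e e0 he] := nroots_orders L0 aD uA hA.
have [e' e'0 he'] := nroots_orders L0 aD0 uA0 hA0.
(* Precision c / 8 for both polynomials still leaves a gap of c / 2 on the circle. *)
have m1 : 0 < Num.min e (c / 8) by rewrite lt_min e0 divr_gt0.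
have m2 : 0 < Num.min e' (c / 8) by rewrite lt_min e'0 divr_gt0.
have [p hp] := aD _ m1; have [p0 hp0] := aD0 _ m2.
have [|h1 h2] := he p.
  by move=> w wL; apply: le_trans (hp w wL) _; rewrite ge_min lexx.
have [|_ /(_ full0) h3] := he' p0.
  by move=> w wL; apply: le_trans (hp0 w wL) _; rewrite ge_min lexx.
suff E : nroots p 0%R L = nroots p0 0%R L by rewrite -h3 -E; split => // /h2.
have [L1|L1] := eqVneq L 0.
  rewrite /nroots L1 (@eq_count _ _ pred0) ?(@eq_count _ _ pred0 _ (croots p0)) ?count_pred0//.
  - by move=> r /=; rewrite ltNge cmod_ge0.
  - by move=> r /=; rewrite ltNge cmod_ge0.
have Lp : 0 < L by rewrite lt_def L1.
have c2 : 0 < c / 2 by lra.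
apply: (rouche Lp c2) => z; rewrite subr0 => zL.
have := DD z zL; have := hp z; have := hp0 z; rewrite zL lexx.
move=> /(_ isT) + /(_ isT); rewrite !le_min => /andP[_ g1] /andP[_ g2] g3.
have -> : p.[z] - p0.[z] = (p.[z] - D z) + ((D z - D0 z) + (D0 z - p0.[z])) by ring.
have := cmodD (p.[z] - D z) ((D z - D0 z) + (D0 z - p0.[z])).
have := cmodD (D z - D0 z) (D0 z - p0.[z]).
have := cmod_lerB (D0 z) p0.[z]; rewrite (cmodC (D0 z) p0.[z]).
lra.
Qed.

End Hurwitz.

(** * Complex Lebesgue integrals *)

Section ComplexIntegral.
Variable R : realType.
Local Notation C := R[i].
Local Notation mu := (@lebesgue_measure R).
Implicit Types (f g h : R -> C) (A : set R) (k : C).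

Definition cmeas A f := measurable_fun A (fun x => complex.Re (f x)) /\
  measurable_fun A (fun x => complex.Im (f x)).

Lemma ReD z w : complex.Re (z + w) = complex.Re z + complex.Re w :> R.
Proof. by case: z w => [a b] [c d]. Qed.
Lemma ImD z w : complex.Im (z + w) = complex.Im z + complex.Im w :> R.
Proof. by case: z w => [a b] [c d]. Qed.
Lemma ReN z : complex.Re (- z) = - complex.Re z :> R. Proof. by case: z. Qed.
Lemma ImN z : complex.Im (- z) = - complex.Im z :> R. Proof. by case: z. Qed.
Lemma ReM z w : complex.Re (z * w) =
  complex.Re z * complex.Re w - complex.Im z * complex.Im w :> R.
Proof. by case: z w => [a b] [c d]. Qed.
Lemma ImM z w : complex.Im (z * w) =
  complex.Re z * complex.Im w + complex.Im z * complex.Re w :> R.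
Proof. by case: z w => [a b] [c d]. Qed.

Lemma complexP (z w : C) : complex.Re z = complex.Re w -> complex.Im z = complex.Im w -> z = w.
Proof. by case: z w => [a b] [c d] /= -> ->. Qed.

Lemma cmeasD A f g : cmeas A f -> cmeas A g -> cmeas A (fun x => f x + g x).
Proof.
move=> [f1 f2] [g1 g2]; split.
  by under eq_fun do rewrite ReD; exact: measurable_funD.
by under eq_fun do rewrite ImD; exact: measurable_funD.
Qed.

Lemma cmeasM A f g : cmeas A f -> cmeas A g -> cmeas A (fun x => f x * g x).
Proof.
move=> [f1 f2] [g1 g2]; split.
  under eq_fun do rewrite ReM.
  by apply: measurable_funB; exact: measurable_funM.
under eq_fun do rewrite ImM.
by apply: measurable_funD; exact: measurable_funM.
Qed.

Lemma cmeas_cst A k : cmeas A (fun=> k).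
Proof. by split; exact: measurable_cst. Qed.

Lemma cmeas_real A (f : R -> R) : measurable_fun A f -> cmeas A (fun x => (f x)%:C).
Proof. by move=> mf; split => //=; exact: measurable_cst. Qed.

Lemma cmeas_cmod A f : cmeas A f -> measurable_fun A (fun x => cmod (f x)).
Proof.
move=> [f1 f2].
have -> : (fun x => cmod (f x)) =
    (@Num.sqrt R) \o (fun x => complex.Re (f x) ^+ 2 + complex.Im (f x) ^+ 2).
  by apply/funext => x /=; case: (f x).
apply: measurableT_comp; first exact: (continuous_measurable_fun (@sqrt_continuous R)).
by apply: measurable_funD; exact: measurable_funX.
Qed.

Lemma cmeasS A A' f : measurable A -> A' `<=` A -> cmeas A f -> cmeas A' f.
Proof. by move=> mA AA [f1 f2]; split; exact: measurable_funS f1 || exact: measurable_funS f2. Qed.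

Lemma cintegrable_meas A f : cintegrable A f -> cmeas A f.
Proof.
by move=> [f1 f2]; split; apply/measurable_EFinP;
  [exact: measurable_int f1|exact: measurable_int f2].
Qed.

Lemma le_integrable_real A (f g : R -> R) : measurable A -> measurable_fun A f ->
  (forall x, A x -> `|f x| <= g x) -> mu.-integrable A (EFin \o g) ->
  mu.-integrable A (EFin \o f).
Proof.
move=> mA mf fg; apply: le_integrable => //; first exact/measurable_EFinP.
by move=> x Ax /=; rewrite lee_fin (le_trans (fg x Ax))// ler_norm.
Qed.

Lemma integrableD_real A (f g : R -> R) : measurable A ->
  mu.-integrable A (EFin \o f) -> mu.-integrable A (EFin \o g) ->
  mu.-integrable A (EFin \o (fun x => f x + g x)).
Proof.
move=> mA fi gi; have := @integrableD _ _ _ mu A mA (EFin \o f) (EFin \o g) fi gi.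
by apply: eq_integrable => // x _.
Qed.

Lemma integrableZ_real A (k : R) (f : R -> R) : measurable A ->
  mu.-integrable A (EFin \o f) -> mu.-integrable A (EFin \o (fun x => k * f x)).
Proof.
move=> mA fi; have := @integrableZl _ _ _ mu A mA k (EFin \o f) fi.
by apply: eq_integrable => // x _.
Qed.

Lemma cintegrable_le A f (g : R -> R) : measurable A -> cmeas A f ->
  (forall x, A x -> cmod (f x) <= g x) -> mu.-integrable A (EFin \o g) ->
  cintegrable A f.
Proof.
move=> mA [f1 f2] fg ig; split; apply: le_integrable_real ig => // x Ax.
  exact: le_trans (Re_le_cmod _) (fg x Ax).
exact: le_trans (Im_le_cmod _) (fg x Ax).
Qed.

Lemma cintegrable_cmod A f : measurable A -> cintegrable A f ->
  mu.-integrable A (EFin \o (fun x => cmod (f x))).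
Proof.
move=> mA fi; have mf := cintegrable_meas fi; case: fi => f1 f2.
have i1 := @integrable_norm _ _ _ mu A (fun x => complex.Re (f x)) f1.
have i2 := @integrable_norm _ _ _ mu A (fun x => complex.Im (f x)) f2.
have := @integrableD_real A (fun x => `|complex.Re (f x)|) (fun x => `|complex.Im (f x)|) mA i1 i2.
apply: le_integrable_real => //; first exact: cmeas_cmod.
by move=> x _; rewrite ger0_norm ?cmod_ge0//; exact: cmod_le_ReIm.
Qed.

Lemma cintegrableS A A' f : measurable A -> measurable A' -> A' `<=` A ->
  cintegrable A f -> cintegrable A' f.
Proof. by move=> mA mA' AA [f1 f2]; split; [exact: integrableS f1|exact: integrableS f2]. Qed.

Lemma cintegrableD A f g : measurable A -> cintegrable A f -> cintegrable A g ->
  cintegrable A (fun x => f x + g x).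
Proof.
move=> mA fi gi.
have := integrableD_real mA (cintegrable_cmod mA fi) (cintegrable_cmod mA gi).
apply: cintegrable_le => //; first by apply: cmeasD; exact: cintegrable_meas.
by move=> x _; exact: cmodD.
Qed.

Lemma cintegrableMb A f g (B : R) : measurable A -> cmeas A g ->
  (forall x, A x -> cmod (g x) <= B) -> cintegrable A f ->
  cintegrable A (fun x => g x * f x).
Proof.
move=> mA mg gB fi.
have := integrableZ_real B mA (cintegrable_cmod mA fi).
apply: cintegrable_le => //; first by apply: cmeasM => //; exact: cintegrable_meas.
by move=> x Ax; rewrite cmodM ler_wpM2r ?cmod_ge0// gB.
Qed.

Lemma cintegrableZ A k f : measurable A -> cintegrable A f ->
  cintegrable A (fun x => k * f x).
Proof. by move=> mA; apply: (cintegrableMb (B := cmod k)) => //; exact: cmeas_cst. Qed.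

Lemma cintegrableN A f : measurable A -> cintegrable A f ->
  cintegrable A (fun x => - f x).
Proof.
move=> mA /(cintegrableZ (-1) mA); rewrite (_ : (fun x => -1 * f x) = (fun x => - f x))//.
by apply/funext => x; rewrite mulN1r.
Qed.

Lemma cintegrableB A f g : measurable A -> cintegrable A f -> cintegrable A g ->
  cintegrable A (fun x => f x - g x).
Proof. by move=> mA fi gi; apply: cintegrableD => //; exact: cintegrableN. Qed.

Lemma cintegralD A f g : measurable A -> cintegrable A f -> cintegrable A g ->
  cintegral A (fun x => f x + g x) = cintegral A f + cintegral A g.
Proof.
move=> mA [f1 f2] [g1 g2]; apply: complexP; rewrite ?ReD ?ImD /=.
  by under eq_Rintegral do rewrite ReD; exact: RintegralD.
by under eq_Rintegral do rewrite ImD; exact: RintegralD.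
Qed.

Lemma cintegralZ A k f : measurable A -> cintegrable A f ->
  cintegral A (fun x => k * f x) = k * cintegral A f.
Proof.
move=> mA [f1 f2]; have z l (u : R -> R) := @integrableZ_real A l u mA.
apply: complexP; rewrite ?ReM ?ImM /=.
  under eq_Rintegral do rewrite ReM.
  by rewrite RintegralB// ?RintegralZl//; exact: z.
under eq_Rintegral do rewrite ImM.
by rewrite RintegralD// ?RintegralZl//; exact: z.
Qed.

Lemma cintegralN A f : measurable A -> cintegrable A f ->
  cintegral A (fun x => - f x) = - cintegral A f.
Proof.
by move=> mA fi; rewrite -mulN1r -cintegralZ//; congr cintegral; apply/funext => x; rewrite mulN1r.
Qed.

Lemma cintegralB A f g : measurable A -> cintegrable A f -> cintegrable A g ->
  cintegral A (fun x => f x - g x) = cintegral A f - cintegral A g.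
Proof.
by move=> mA fi gi; rewrite cintegralD ?cintegralN//; exact: cintegrableN.
Qed.

Lemma eq_cintegral A f g : (forall x, A x -> f x = g x) -> cintegral A f = cintegral A g.
Proof.
by move=> fg; congr (_ +i* _); apply: eq_Rintegral => x; rewrite inE => /fg ->.
Qed.

Lemma eq_cintegrable A f g : measurable A -> (forall x, A x -> f x = g x) ->
  cintegrable A f -> cintegrable A g.
Proof.
move=> mA fg [f1 f2]; split; [apply: eq_integrable f1|apply: eq_integrable f2] => // x;
  by rewrite inE => /fg ->.
Qed.

Lemma ae_imp (P Q : R -> Prop) : (forall x, P x -> Q x) ->
  {ae mu, forall x, P x} -> {ae mu, forall x, Q x}.
Proof. exact: (@filterS _ _ (ae_filter_ringOfSetsType mu) P Q). Qed.

Lemma ae_imp2 (P Q S : R -> Prop) : (forall x, P x -> Q x -> S x) ->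
  {ae mu, forall x, P x} -> {ae mu, forall x, Q x} -> {ae mu, forall x, S x}.
Proof. exact: (@filterS2 _ _ (ae_filter_ringOfSetsType mu) P Q S). Qed.

(** Multiplying f by the unimodular u that turns the integral into its modulus reduces the claim to
    real parts. *)
Lemma cmod_cintegral A f : measurable A -> cintegrable A f ->
  cmod (cintegral A f) <= \int[mu]_(x in A) cmod (f x).
Proof.
move=> mA fi; set I := cintegral A f.
have [->|I0] := eqVneq I 0.
  by rewrite cmod0 Rintegral_ge0// => x _; exact: cmod_ge0.
have cI : 0 < cmod I by rewrite cmod_gt0.
pose u := (cmod I)%:C / I.
have u1 : cmod u = 1 by rewrite cmodM cmodV cmod_real ger0_norm ?ltW// divff// gt_eqF.
have : (cmod I)%:C = cintegral A (fun x => u * f x).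
  by rewrite cintegralZ// -/I /u mulfVK.
move=> /(congr1 (@complex.Re _)) /= ->.
have [uf1 uf2] := cintegrableZ u mA fi.
apply: le_Rintegral => //; first exact: cintegrable_cmod.
move=> x _; apply: le_trans (ler_norm _) _; apply: le_trans (Re_le_cmod _) _.
by rewrite cmodM u1 mul1r.
Qed.

Lemma cmod_cintegral_le A f (g : R -> R) : measurable A -> cintegrable A f ->
  mu.-integrable A (EFin \o g) -> (forall x, A x -> cmod (f x) <= g x) ->
  cmod (cintegral A f) <= \int[mu]_(x in A) g x.
Proof.
move=> mA fi gi fg; apply: le_trans (cmod_cintegral mA fi) _.
by apply: le_Rintegral => //; exact: cintegrable_cmod.
Qed.

Lemma cmod_cintegral_ae A f (g : R -> R) : measurable A -> cintegrable A f ->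
  mu.-integrable A (EFin \o g) -> (forall x, A x -> 0 <= g x) ->
  {ae mu, forall x, A x -> cmod (f x) <= g x} ->
  cmod (cintegral A f) <= \int[mu]_(x in A) g x.
Proof.
move=> mA fi gi g0 fg; apply: le_trans (cmod_cintegral mA fi) _.
have ci := cintegrable_cmod mA fi.
rewrite /Rintegral fine_le//; [exact: integrable_fin_num|exact: integrable_fin_num|].
apply: ae_ge0_le_integral => //.
- by move=> x _; rewrite lee_fin cmod_ge0.
- exact: measurable_int ci.
- exact: measurable_int gi.
Qed.

Local Notation I a b := (`]a%R, b%R[%classic : set R).

Lemma itv_oo_sub (a b c d : R) : c <= a -> b <= d -> I a b `<=` I c d.
Proof. by move=> ca bd x /=; rewrite !in_itv/= => /andP[h1 h2]; apply/andP; split; lra. Qed.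

Lemma cintegrable_sub a b c d f : c <= a -> b <= d -> cintegrable (I c d) f ->
  cintegrable (I a b) f.
Proof. by move=> ca bd; apply: cintegrableS => //; exact: itv_oo_sub. Qed.

Lemma Rintegral_split (a b c : R) (f : R -> R) : a <= b <= c ->
  mu.-integrable (I a c) (EFin \o f) ->
  \int[mu]_(x in I a c) f x = \int[mu]_(x in I a b) f x + \int[mu]_(x in I b c) f x.
Proof.
move=> /andP[]; rewrite le_eqVlt => /predU1P[<-|ab].
  by rewrite set_itvoo0 Rintegral_set0 add0r.
rewrite le_eqVlt => /predU1P[<-|bc].
  by rewrite [in X in _ + X]set_itvoo0 Rintegral_set0 addr0.
move=> fi; have fi1 : mu.-integrable (I a b) (EFin \o f).
  by apply: integrableS fi => //; exact: itv_oo_sub (lexx _) (ltW bc).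
have := @Rintegral_itvB _ f (BRight a) (BLeft c) b fi.
rewrite !bnd_simp => /(_ (ltW ab) bc).
rewrite -Rintegral_itv_bndo_bndc// => <-; ring.
Qed.

Lemma cintegral_split (a b c : R) f : a <= b <= c -> cintegrable (I a c) f ->
  cintegral (I a c) f = cintegral (I a b) f + cintegral (I b c) f.
Proof.
by move=> abc [f1 f2]; apply: complexP; rewrite ?ReD ?ImD /=; exact: Rintegral_split.
Qed.

Lemma cintegral_nil (a : R) f : cintegral (I a a) f = 0.
Proof. by rewrite /cintegral set_itvoo0 !Rintegral_set0. Qed.

Lemma integrable_itv_cst (a b k : R) : mu.-integrable (I a b) (EFin \o (fun=> k)).
Proof.
apply: measurable_bounded_integrable => //.
  by rewrite /= lebesgue_measure_itv/=; case: ifP => // _; rewrite ltry.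
exact: bounded_cst.
Qed.

Lemma Rintegral_itv_cst (a b k : R) : a <= b -> \int[mu]_(x in I a b) k = k * (b - a).
Proof.
move=> ab; rewrite Rintegral_cst//= lebesgue_measure_itv/= lte_fin.
move: ab; rewrite le_eqVlt => /predU1P[->|ab]; first by rewrite ltxx subrr.
by rewrite ab.
Qed.

Lemma le_Rintegral_itv (a b c d : R) (g : R -> R) : c <= a -> b <= d ->
  (forall x, I c d x -> 0 <= g x) -> mu.-integrable (I c d) (EFin \o g) ->
  \int[mu]_(x in I a b) g x <= \int[mu]_(x in I c d) g x.
Proof.
move=> ca bd g0 gi; have gi' : mu.-integrable (I a b) (EFin \o g).
  by apply: integrableS gi => //; exact: itv_oo_sub.
rewrite /Rintegral fine_le//; [exact: integrable_fin_num|exact: integrable_fin_num|].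
apply: ge0_subset_integral => //; last exact: itv_oo_sub.
  exact: measurable_int gi.
Qed.

End ComplexIntegral.

(** * Integration by parts for indefinite integrals *)

Section ProductRule.
Variable R : realType.
Local Notation C := R[i].
Local Notation mu := (@lebesgue_measure R).
Local Notation I a b := (`]a%R, b%R[%classic : set R).
Implicit Types (X a b t x : R).

(* Applied to the difference of the two sides of the integration by parts
   formula, this replaces Fubini's theorem for absolutely continuous functions. *)
Lemma increments_const (H : R -> C) (T : R -> R) (X K : R) : 0 <= X ->
  (forall a b, 0 <= a -> a <= b -> b <= X ->
    cmod (H b - H a) <= K * (b - a) * (T b - T a)) ->
  H X = H 0.
Proof.
move=> X0 h; apply/eqP; rewrite -subr_eq0 -cmod_eq0; apply/eqP.
pose M := K * X * (T X - T 0).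
(* Cutting [0, X] into n equal pieces gains a factor 1 / n, since the increments of T telescope
   while each piece has length X / n. *)
have bound n : (0 < n)%N -> cmod (H X - H 0) * n%:R <= M.
  move=> n0; have nR : 0 < n%:R :> R by rewrite ltr0n.
  have [d dE] : exists d, X = n%:R * d by exists (X / n%:R); rewrite mulrC divfK ?gt_eqF.
  have d0 : 0 <= d by rewrite -(pmulr_rge0 _ nR) -dE.
  have step i : (i <= n)%N -> cmod (H (i%:R * d) - H 0) <= K * d * (T (i%:R * d) - T 0).
    elim: i => [|i IH] im; first by rewrite !mul0r !subrr cmod0 mulr0.
    have hi := IH (ltnW im).
    have := h (i%:R * d) (i.+1%:R * d); rewrite {1}dE !ler_wpM2r ?ler_nat//.
    rewrite mulr_ge0 ?ler0n// => /(_ isT isT isT).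
    rewrite -mulrBl -natrB// subSnn mul1r => hs.
    have := cmodD (H (i.+1%:R * d) - H (i%:R * d)) (H (i%:R * d) - H 0).
    rewrite addrA subrK; lra.
  have := step n (leqnn n); rewrite -dE => hn.
  apply: le_trans (ler_wpM2r (ltW nR) hn) _; rewrite /M.
  by rewrite mulrAC -[K * d * _]mulrA [d * _]mulrC -dE.
have [//|H0] := eqVneq (cmod (H X - H 0)) 0.
have c0 : 0 < cmod (H X - H 0) by rewrite lt_def H0 cmod_ge0.
have := truncnS_gt (M / cmod (H X - H 0)).
set n := (_).+1; rewrite ltr_pdivrMr// mulrC => hn.
by have := bound n isT; rewrite leNgt hn.
Qed.

Definition primitive X (u U : R -> C) := cintegrable (I 0 X) u /\
  forall x, 0 <= x <= X -> U x = U 0 + cintegral (I 0 x) u.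

Lemma primitive_incr X u U a b : primitive X u U -> 0 <= a -> a <= b -> b <= X ->
  U b - U a = cintegral (I a b) u.
Proof.
move=> [ui hU] a0 ab bX.
have -> : U b = U 0 + cintegral (I 0 b) u by rewrite hU// (le_trans a0).
have -> : U a = U 0 + cintegral (I 0 a) u by rewrite hU// a0 (le_trans ab).
rewrite (@cintegral_split _ 0 a b) ?a0//; first by ring.
exact: cintegrable_sub ui.
Qed.

(** U is, up to a constant, the difference of two nondecreasing functions, the integrals of u + |u|
    and of |u|. Cutting at [Num.min x X] makes them monotone on the whole line to the extent that
    monotonicity yields measurability. *)
Lemma Rprimitive_measurable X (u U : R -> R) : mu.-integrable (I 0 X) (EFin \o u) ->
  (forall x, 0 <= x <= X -> U x = U 0 + \int[mu]_(t in I 0 x) u t) ->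
  measurable_fun (I 0 X) U.
Proof.
move=> ui hU.
have vi : mu.-integrable (I 0 X) (EFin \o (fun x => `|u x|)) by exact: (integrable_norm ui).
pose V x := \int[mu]_(t in I 0 (Num.min x X)) `|u t|.
pose W x := \int[mu]_(t in I 0 (Num.min x X)) (u t + `|u t|).
have wi : mu.-integrable (I 0 X) (EFin \o (fun x => u x + `|u x|)).
  exact: integrableD_real.
have ndV (v : R -> R) : mu.-integrable (I 0 X) (EFin \o v) -> (forall t, 0 <= v t) ->
    measurable_fun (I 0 X) (fun x => \int[mu]_(t in I 0 (Num.min x X)) v t).
  move=> iv v0; apply: nondecreasing_measurable => // x y xy.
  apply: le_Rintegral_itv => //.
    by rewrite le_min !ge_min xy lexx orbT.
  by apply: integrableS iv => //; apply: itv_oo_sub => //; rewrite ge_min lexx orbT.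
have mV : measurable_fun (I 0 X) V by exact: ndV.
have mW : measurable_fun (I 0 X) W.
  by apply: ndV => // t; have := ler_norm (- u t); rewrite normrN; lra.
apply: (eq_measurable_fun (fun x => U 0 + (W x - V x))); last first.
  by apply: measurable_funD => //; exact: measurable_funB.
move=> x; rewrite inE/= in_itv/= => /andP[x0 xX].
have -> : U x = U 0 + \int[mu]_(t in I 0 x) u t by rewrite hU// !ltW.
rewrite /W /V min_l ?ltW//; congr (_ + _).
have sub (f : R -> R) : mu.-integrable (I 0 X) (EFin \o f) -> mu.-integrable (I 0 x) (EFin \o f).
  by apply: integrableS => //; apply: itv_oo_sub => //; exact: ltW.
by rewrite RintegralD ?addrK//; exact: sub.
Qed.

Lemma primitive_cmeas X u U : primitive X u U -> cmeas (I 0 X) U.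
Proof.
move=> [[u1 u2] hU]; split.
  by apply: (Rprimitive_measurable u1) => x /hU ->; rewrite ReD.
by apply: (Rprimitive_measurable u2) => x /hU ->; rewrite ImD.
Qed.

Lemma primitive_bounded X u U x : primitive X u U -> 0 <= x <= X ->
  cmod (U x) <= cmod (U 0) + \int[mu]_(t in I 0 X) cmod (u t).
Proof.
move=> [ui hU] x0X; rewrite hU// (le_trans (cmodD _ _))// lerD2l.
case/andP: x0X => x0 xX.
have uix := cintegrable_sub (lexx 0) xX ui.
apply: le_trans (cmod_cintegral _ uix) _ => //.
apply: le_Rintegral_itv => //; first by move=> ? _; exact: cmod_ge0.
exact: cintegrable_cmod.
Qed.

(** Boundedness of p makes P Lipschitz, while increments of U are controlled by those of T, the
    integral of |u|. On [a, b] the defect H changes by the integral of u (P b - P) plus that of (U a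
    - U) p, and each is at most B (b - a) (T b - T a), as [increments_const] requires. *)
Lemma primitive_mul X u U p P (B : R) : 0 <= X ->
  primitive X u U -> primitive X p P -> (forall x, I 0 X x -> cmod (p x) <= B) ->
  primitive X (fun x => u x * P x + U x * p x) (fun x => U x * P x).
Proof.
move=> X0 hu hp pB.
have [ui hU] := hu; have [pi' hP] := hp.
have B0 x : I 0 X x -> 0 <= B by move=> /pB; apply: le_trans; exact: cmod_ge0.
have mU := primitive_cmeas hu; have mP := primitive_cmeas hp.
have itvX x : I 0 X x -> 0 <= x <= X by rewrite /= in_itv/= => /andP[/ltW -> /ltW ->].
have bU x : I 0 X x -> cmod (U x) <= cmod (U 0) + \int[mu]_(t in I 0 X) cmod (u t).
  by move=> /itvX; exact: primitive_bounded.
have bP x : I 0 X x -> cmod (P x) <= cmod (P 0) + \int[mu]_(t in I 0 X) cmod (p t).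
  by move=> /itvX; exact: primitive_bounded.
have i1 : cintegrable (I 0 X) (fun x => u x * P x).
  have := cintegrableMb (measurable_itv _) mP bP ui.
  by apply: eq_cintegrable => // x _; rewrite mulrC.
have i2 : cintegrable (I 0 X) (fun x => U x * p x).
  exact: cintegrableMb mU bU pi'.
split; first exact: cintegrableD.
move=> x /andP[x0 xX].
pose H y := U y * P y - cintegral (I 0 y) (fun t => u t * P t + U t * p t).
suff : H x = H 0 by rewrite /H cintegral_nil subr0 => <-; rewrite subrK.
pose T y := \int[mu]_(t in I 0 y) cmod (u t).
apply: (@increments_const H T x (2 * B)) => // a b a0 ab bx.
have bX := le_trans bx xX.
have sub (f : R -> C) : cintegrable (I 0 X) f -> cintegrable (I a b) f.
  exact: cintegrable_sub.
have sub0 (f : R -> C) : cintegrable (I 0 X) f -> cintegrable (I 0 b) f.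
  exact: cintegrable_sub.
have [ab'|ab'] := eqVneq a b; first by rewrite ab' !subrr cmod0 mulr0.
have {}ab' : a < b by rewrite lt_def eq_sym ab'.
have Bge : 0 <= B.
  by apply: (B0 ((a + b) / 2)); rewrite /= in_itv/=; apply/andP; split; lra.
have TE : T b - T a = \int[mu]_(t in I a b) cmod (u t).
  rewrite /T (@Rintegral_split _ 0 a b) ?a0//; first ring.
  exact: cintegrable_cmod (sub0 _ ui).
have TE0 : 0 <= T b - T a by rewrite TE Rintegral_ge0// => t _; exact: cmod_ge0.
have Uinc t s : a <= t -> t <= s -> s <= b -> cmod (U s - U t) <= T b - T a.
  move=> at_ ts sb; rewrite (primitive_incr hu (le_trans a0 at_) ts (le_trans sb bX)).
  apply: le_trans (cmod_cintegral _ _) _ => //.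
    by apply: cintegrable_sub ui; [exact: le_trans at_|exact: le_trans bX].
  rewrite TE; apply: le_Rintegral_itv => //; first by move=> ? _; exact: cmod_ge0.
  exact: cintegrable_cmod (sub _ ui).
have Pinc t s : a <= t -> t <= s -> s <= b -> cmod (P s - P t) <= B * (b - a).
  move=> at_ ts sb; rewrite (primitive_incr hp (le_trans a0 at_) ts (le_trans sb bX)).
  have ip : cintegrable (I t s) p.
    by apply: cintegrable_sub pi'; [exact: le_trans at_|exact: le_trans bX].
  apply: le_trans (cmod_cintegral_le (g := fun=> B) _ ip (integrable_itv_cst _ _ _) _) _ => //.
    move=> y; rewrite /= in_itv/= => /andP[ty ys]; apply: pB.
    by rewrite /= in_itv/=; apply/andP; split; lra.
  by rewrite Rintegral_itv_cst// ler_wpM2l//; lra.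
have j1 := sub _ i1; have j2 := sub _ i2.
have u' := sub _ ui; have p' := sub _ pi'.
have HE : H b - H a = cintegral (I a b) (fun t => u t * (P b - P t)) +
   cintegral (I a b) (fun t => (U a - U t) * p t).
  have E1 : cintegral (I a b) (fun t => u t * (P b - P t)) =
      (U b - U a) * P b - cintegral (I a b) (fun t => u t * P t).
    rewrite (primitive_incr hu)// mulrC -cintegralZ// -cintegralB//.
      by apply: eq_cintegral => t _; ring.
    exact: cintegrableZ.
  have E2 : cintegral (I a b) (fun t => (U a - U t) * p t) =
      U a * (P b - P a) - cintegral (I a b) (fun t => U t * p t).
    rewrite (primitive_incr hp)// -cintegralZ// -cintegralB//.
      by apply: eq_cintegral => t _; ring.
    exact: cintegrableZ.
  rewrite E1 E2 /H (@cintegral_split _ 0 a b) ?a0//; last exact: cintegrableD (sub0 _ i1) (sub0 _ i2).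
  by rewrite (cintegralD _ j1 j2)//; ring.
have k1 : cintegrable (I a b) (fun t => u t * (P b - P t)).
  have := cintegrableB (measurable_itv _) (cintegrableZ (P b) (measurable_itv _) u') j1.
  by apply: eq_cintegrable => // t _; ring.
have k2 : cintegrable (I a b) (fun t => (U a - U t) * p t).
  have := cintegrableB (measurable_itv _) (cintegrableZ (U a) (measurable_itv _) p') j2.
  by apply: eq_cintegrable => // t _; ring.
have b1 : cmod (cintegral (I a b) (fun t => u t * (P b - P t))) <= B * (b - a) * (T b - T a).
  have ci := cintegrable_cmod (measurable_itv _) u'.
  rewrite TE -RintegralZl//; apply: cmod_cintegral_le => //.
    exact: integrableZ_real.
  move=> t; rewrite /= in_itv/= => /andP[/ltW t1 /ltW t2].
  by rewrite cmodM mulrC ler_wpM2r ?cmod_ge0// Pinc.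
have b2 : cmod (cintegral (I a b) (fun t => (U a - U t) * p t)) <= B * (b - a) * (T b - T a).
  rewrite mulrAC -Rintegral_itv_cst ?(ltW ab')//; apply: cmod_cintegral_le => //.
    exact: integrable_itv_cst.
  move=> t tab; have pt : cmod (p t) <= B by apply: pB; exact: itv_oo_sub tab.
  move: tab; rewrite /= in_itv/= => /andP[/ltW t1 /ltW t2].
  rewrite cmodM mulrC ler_pM ?cmod_ge0//.
  by rewrite cmodC Uinc.
by rewrite HE (le_trans (cmodD _ _))//; lra.
Qed.

End ProductRule.

(** * Complex exponential *)

Section ComplexExp.
Variable R : realType.
Local Notation C := R[i].
Local Notation mu := (@lebesgue_measure R).
Local Notation I a b := (`]a%R, b%R[%classic : set R).
Implicit Types (X a b t x : R) (z w k : C).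

Definition cexp z : C := (expR (complex.Re z))%:C * (cos (complex.Im z) +i* sin (complex.Im z)).

Lemma Re_cexp z : complex.Re (cexp z) = expR (complex.Re z) * cos (complex.Im z).
Proof. by rewrite ReM /= mul0r subr0. Qed.

Lemma Im_cexp z : complex.Im (cexp z) = expR (complex.Re z) * sin (complex.Im z).
Proof. by rewrite ImM /= mul0r addr0. Qed.

Lemma cexpD z w : cexp (z + w) = cexp z * cexp w.
Proof.
apply: complexP.
  by rewrite Re_cexp ReM !Re_cexp !Im_cexp ReD ImD expRD cosD; ring.
by rewrite Im_cexp ImM !Re_cexp !Im_cexp ReD ImD expRD sinD; ring.
Qed.

Lemma cexp0 : cexp 0 = 1.
Proof. by apply: complexP; rewrite ?Re_cexp ?Im_cexp /= expR0 ?cos0 ?sin0 mul1r. Qed.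

Lemma cexpN_mul z : cexp (- z) * cexp z = 1.
Proof. by rewrite -cexpD addNr cexp0. Qed.

Lemma cmod_cexp z : cmod (cexp z) = expR (complex.Re z).
Proof.
rewrite cmodM cmod_real ger0_norm ?expR_ge0// /= cos2Dsin2 sqrtr1 mulr1//.
Qed.

Lemma Rintegral_FTC (F f : R -> R) a b : a <= b ->
  (forall x, is_derive x 1 F (f x)) -> continuous f ->
  mu.-integrable (I a b) (EFin \o f) /\ \int[mu]_(x in I a b) f x = F b - F a.
Proof.
move=> ab dF cf; have fi : mu.-integrable `[a, b] (EFin \o f).
  apply: continuous_compact_integrable; first exact: segment_compact.
  exact: continuous_subspaceT.
have fo : mu.-integrable (I a b) (EFin \o f).
  by apply: integrableS fi => //; exact: subset_itv_oo_cc.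
split => //; move: ab; rewrite le_eqVlt => /predU1P[->|ab].
  by rewrite set_itvoo0 Rintegral_set0 subrr.
have cF : continuous F.
  by move=> x; apply: differentiable_continuous; apply/derivable1_diffP.
rewrite /Rintegral -(@integral_itv_bndoo _ _ _ _ true false); last first.
  by apply/measurable_EFinP; apply: measurable_funTS; exact: continuous_measurable_fun.
rewrite (@continuous_FTC2 _ _ F)//=.
- exact: continuous_subspaceT.
- split; first by move=> x _; exact: (ex_derive (is_derive := dF x)).
  + exact/cvg_at_right_filter/cF.
  + exact/cvg_at_left_filter/cF.
- by move=> x _; rewrite derive1E; exact: derive_val.
Qed.

Lemma primitive_of_derive X (F f : R -> C) :
  (forall x, is_derive x 1 (fun x => complex.Re (F x)) (complex.Re (f x))) ->
  (forall x, is_derive x 1 (fun x => complex.Im (F x)) (complex.Im (f x))) ->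
  continuous (fun x => complex.Re (f x)) -> continuous (fun x => complex.Im (f x)) ->
  0 <= X -> primitive X f F.
Proof.
move=> dR dI cR cI X0; split.
  by split; [case: (Rintegral_FTC X0 dR cR)|case: (Rintegral_FTC X0 dI cI)].
move=> x /andP[x0 _]; have [_ e1] := Rintegral_FTC x0 dR cR.
have [_ e2] := Rintegral_FTC x0 dI cI.
by apply: complexP; rewrite ?ReD ?ImD /= ?e1 ?e2; ring.
Qed.

Lemma cexp_primitive X k : 0 <= X ->
  primitive X (fun t => k * cexp (k * t%:C)) (fun t => cexp (k * t%:C)).
Proof.
case: k => u v X0.
have kt t : (u +i* v) * t%:C = (u * t) +i* (v * t) by simpc.
have dl (c x : R) : is_derive x 1 (fun t => c * t) c.
  by have := is_deriveZ c (is_derive_id x (1 : R)); rewrite [_ *: _]mulr1.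
have comp (f g : R -> R) (x a b : R) : is_derive (g x) 1 f a -> is_derive x 1 g b ->
    is_derive x 1 (fun t => f (g t)) (b * a).
  by move=> df dg; rewrite mulrC; exact: is_derive1_comp.
have dE x : is_derive x 1 (fun t => expR (u * t)) (u * expR (u * x)) by exact: comp.
have dC x : is_derive x 1 (fun t => cos (v * t)) (v * - sin (v * x)) by exact: comp.
have dS x : is_derive x 1 (fun t => sin (v * t)) (v * cos (v * x)) by exact: comp.
have ct (f : R -> R) (c : R) : continuous f -> continuous (fun t => f (c * t)).
  move=> cf x; apply: (@continuous_comp _ _ _ (fun t => c * t) f); last exact: cf.
  by apply: cvgM; [exact: cvg_cst|exact: cvg_id].
have cE c : continuous (fun t : R => expR (c * t)) by apply: ct; exact: continuous_expR.
have cC c : continuous (fun t : R => cos (c * t)) by apply: ct; exact: continuous_cos.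
have cS c : continuous (fun t : R => sin (c * t)) by apply: ct; exact: continuous_sin.
apply: primitive_of_derive => //.
- move=> x; have := is_deriveM (dE x) (dC x).
  have -> : (fun t => expR (u * t)) * (fun t => cos (v * t)) =
      (fun t => complex.Re (cexp ((u +i* v) * t%:C))).
    by apply/funext => t; rewrite kt Re_cexp.
  move/is_derive_eq; apply.
  by rewrite kt ReM Re_cexp Im_cexp /= /GRing.scale/=; ring.
- move=> x; have := is_deriveM (dE x) (dS x).
  have -> : (fun t => expR (u * t)) * (fun t => sin (v * t)) =
      (fun t => complex.Im (cexp ((u +i* v) * t%:C))).
    by apply/funext => t; rewrite kt Im_cexp.
  move/is_derive_eq; apply.
  by rewrite kt ImM Re_cexp Im_cexp /= /GRing.scale/=; ring.
- move=> x; under eq_fun do rewrite kt ReM Re_cexp Im_cexp /=.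
  by apply: cvgB; apply: cvgM; try exact: cvg_cst; apply: cvgM; [exact: cE|exact: cC|exact: cE|exact: cS].
- move=> x; under eq_fun do rewrite kt ImM Re_cexp Im_cexp /=.
  by apply: cvgD; apply: cvgM; try exact: cvg_cst; apply: cvgM; [exact: cE|exact: cS|exact: cE|exact: cC].
Qed.

(** Source of the Taylor bounds below: a bound on the integrand gives the first order, and the first
    order bound inserted in the integrand gives the second. *)
Lemma cexp_incr k : cexp k - 1 = cintegral (I 0 1) (fun t => k * cexp (k * t%:C)) /\
  cintegrable (I 0 1) (fun t => k * cexp (k * t%:C)).
Proof.
have [ki h] := cexp_primitive k (@ler01 R); split=> //.
have := h 1; rewrite ler01 lexx mulr1 mulr0 cexp0 => /(_ isT) ->.
by rewrite addrC addKr.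
Qed.

Lemma cmod_cexp_scaled k t : 0 <= t <= 1 -> cmod (cexp (k * t%:C)) <= expR (cmod k).
Proof.
move=> /andP[t0 t1]; rewrite cmod_cexp ler_expR; apply: le_trans (ler_norm _) _.
apply: le_trans (Re_le_cmod _) _; rewrite cmodM cmod_real ger0_norm//.
by rewrite ler_piMr ?cmod_ge0.
Qed.

Lemma cmod_cexpB1 k : cmod (cexp k - 1) <= cmod k * expR (cmod k).
Proof.
have [-> ki] := cexp_incr k.
rewrite -[leRHS]mulr1 -[X in _ * X]subr0 -Rintegral_itv_cst//.
apply: cmod_cintegral_le => //; first exact: integrable_itv_cst.
move=> t; rewrite /= in_itv/= => /andP[t0 t1].
by rewrite cmodM ler_wpM2l ?cmod_ge0// cmod_cexp_scaled// !ltW.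
Qed.

Lemma cmod_cexpB1B k : cmod (cexp k - 1 - k) <= cmod k ^+ 2 * expR (cmod k).
Proof.
have [-> ki] := cexp_incr k.
have kc : cintegrable (I 0 1) (fun=> k).
  by split; exact: integrable_itv_cst.
have kE : cintegral (I 0 1) (fun=> k) = k.
  by apply: complexP => /=; rewrite Rintegral_itv_cst// subr0 mulr1.
rewrite -[X in cmod (_ - X)]kE -cintegralB//.
rewrite -[leRHS]mulr1 -[X in _ * X]subr0 -Rintegral_itv_cst//.
apply: cmod_cintegral_le => //; [exact: cintegrableB|exact: integrable_itv_cst|].
move=> t; rewrite /= in_itv/= => /andP[t0 t1].
have -> : k * cexp (k * t%:C) - k = k * (cexp (k * t%:C) - 1) by ring.
rewrite cmodM expr2 -mulrA ler_wpM2l ?cmod_ge0//.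
apply: le_trans (cmod_cexpB1 _) _.
have h : cmod (k * t%:C) <= cmod k.
  by rewrite cmodM cmod_real (ger0_norm (ltW t0)) ler_piMr ?cmod_ge0 ?(ltW t1).
by rewrite ler_pM ?cmod_ge0 ?expR_ge0 ?ler_expR.
Qed.

End ComplexExp.

(** * Volterra estimates *)

Section Reflection.
Variable R : realType.
Local Notation mu := (@lebesgue_measure R).
Local Notation I a b := (`]a%R, b%R[%classic : set R).
Implicit Types (t x : R).

Let flip t : measurableTypeR R -> measurableTypeR R := fun s : R => t - s.

Lemma flip_measurable t (A : set R) : measurable_fun A (flip t).
Proof. by apply: measurable_funB => //; exact: measurable_cst. Qed.

Lemma flip_preimage t : flip t @^-1` (I 0 t) = I 0 t.
Proof.
apply/seteqP; split => s; rewrite /= !in_itv/= /flip => /andP[s0 st];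
  by apply/andP; split; lra.
Qed.

Lemma lebesgue_measure_flip t (A : set R) : measurable A ->
  pushforward mu (flip t) A = mu A.
Proof.
have mf := @flip_measurable t setT.
move=> mA; apply/esym/lebesgue_measure_unique => //= _ [[a b]] _ <-.
rewrite /pushforward (_ : flip t @^-1` _ = `[t - b, t - a[%classic); last first.
  apply/seteqP; split => s; rewrite /= !in_itv/= /flip => /andP[s0 st];
  by apply/andP; split; lra.
rewrite !lebesgue_measure_itv/= !lte_fin ltrD2l ltrN2.
by case: ifP => // _; rewrite -!EFinD; congr EFin; ring.
Qed.

Lemma integral_flip t (f : R -> R) : measurable_fun (I 0 t) f -> (forall s, 0 <= f s) ->
  (\int[mu]_(s in I 0 t) (f (t - s))%:E = \int[mu]_(s in I 0 t) (f s)%:E)%E.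
Proof.
move=> mf f0.
have := @ge0_integral_pushforward _ _ _ _ R (flip t) (@flip_measurable t setT)
  (@lebesgue_measure R) (I 0 t) (EFin \o f).
rewrite flip_preimage => <- //.
- apply: eq_measure_integral => [|mf' A mA AS]; first exact: flip_measurable.
  exact: lebesgue_measure_flip.
- exact/measurable_EFinP.
- by move=> s _; rewrite /= lee_fin.
Qed.

Lemma measurable_flip t (f : R -> R) : measurable_fun (I 0 t) f ->
  measurable_fun (I 0 t) (fun s => f (t - s)).
Proof.
move=> mf; apply: (@measurable_comp _ _ _ _ _ _ (I 0 t) f (I 0 t) (flip t)) => //.
  by move=> _ [s hs <-]; rewrite -flip_preimage in hs.
exact: flip_measurable.
Qed.

Lemma integrable_flip t (f : R -> R) : mu.-integrable (I 0 t) (EFin \o f) ->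
  (forall s, 0 <= f s) ->
  mu.-integrable (I 0 t) (EFin \o (fun s => f (t - s))) /\
  \int[mu]_(s in I 0 t) f (t - s) = \int[mu]_(s in I 0 t) f s.
Proof.
move=> fi f0; have mf : measurable_fun (I 0 t) f.
  by apply/measurable_EFinP; exact: measurable_int fi.
split; last by rewrite /Rintegral integral_flip.
apply/integrableP; split; first by apply/measurable_EFinP; exact: measurable_flip.
under eq_integral => s _ do rewrite /= ger0_norm//.
rewrite integral_flip//; case/integrableP : fi => _.
by under eq_integral => s _ do rewrite /= ger0_norm//.
Qed.

End Reflection.

(** * Integrability of the coefficients q and M *)

Section KernelBounds.
Variable R : realType.
Local Notation C := R[i].
Local Notation mu := (@lebesgue_measure R).
Local Notation I a b := (`]a%R, b%R[%classic : set R).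
Implicit Types (f q : R -> C) (t x X K : R).

Lemma L2_cmeas f : L2 f -> cmeas (I 0 pi) f.
Proof. by case. Qed.

(** Cauchy-Schwarz, from integrating (|f| - c)^2 >= 0 with c the mean value of |f|. This is where
    sqrt(pi) enters the estimate. *)
Lemma L2_L1 f : L2 f -> mu.-integrable (I 0 pi) (EFin \o (fun x => cmod (f x))) /\
  \int[mu]_(x in I 0 pi) cmod (f x) <= Num.sqrt pi * L2norm f.
Proof.
move=> L2f; have mf := cmeas_cmod (L2_cmeas L2f); case: L2f => _ _ i2.
have p0 : 0 < pi :> R := pi_gt0 R.
have i1 : mu.-integrable (I 0 pi) (EFin \o (fun x => cmod (f x))).
  apply: (@le_integrable_real _ _ _ (fun x => 1 + cmod (f x) ^+ 2)) => //.
    move=> x _; rewrite ger0_norm ?cmod_ge0//; have := cmod_ge0 (f x); nra.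
  by apply: integrableD_real => //; exact: integrable_itv_cst.
split => //; set A := \int[mu]_(x in _) _; set B := \int[mu]_(x in I 0 pi) cmod (f x) ^+ 2.
have A0 : 0 <= A by apply: Rintegral_ge0 => x _; exact: cmod_ge0.
have B0 : 0 <= B by apply: Rintegral_ge0 => x _; rewrite exprn_ge0// cmod_ge0.
suff h : A ^+ 2 <= pi * B.
  by rewrite /L2norm -/B -sqrtrM ?(ltW p0)//; have := ler_wsqrtr h; rewrite sqrtr_sqr ger0_norm.
pose c := A / pi.
have : 0 <= \int[mu]_(x in I 0 pi) (cmod (f x) ^+ 2 + (- 2 * c) * cmod (f x) + c ^+ 2).
  apply: Rintegral_ge0 => x _; have := sqr_ge0 (cmod (f x) - c); lra.
have i3 : mu.-integrable (I 0 pi) (EFin \o (fun x => (- 2 * c) * cmod (f x))).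
  exact: integrableZ_real.
have i4 : mu.-integrable (I 0 pi) (EFin \o (fun x => cmod (f x) ^+ 2 + (- 2 * c) * cmod (f x))).
  exact: integrableD_real.
rewrite RintegralD//; last exact: integrable_itv_cst.
rewrite RintegralD// RintegralZl// Rintegral_itv_cst ?(ltW p0)// -/A -/B subr0.
have cA : c * pi = A by rewrite /c divfK// gt_eqF.
nra.
Qed.

(** Monotone convergence along x n increasing to X. It is needed because M is known to be integrable
    on (0, x) only for x < pi. *)
Lemma ge0_integrable_exhaust X (f : R -> R) K : 0 < X -> (forall s, 0 <= f s) ->
  (forall x, 0 < x < X -> mu.-integrable (I 0 x) (EFin \o f) /\
    \int[mu]_(s in I 0 x) f s <= K) ->
  mu.-integrable (I 0 X) (EFin \o f) /\ \int[mu]_(s in I 0 X) f s <= K.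
Proof.
move=> X0 f0 h.
(* The shift by two gives 0 < x n < X already for n = 0. *)
pose x n := X - X / n.+2%:R.
have xX n : 0 < x n < X.
  have n2 : 1 < n.+2%:R :> R by rewrite ltr1n.
  have d0 : 0 < X / n.+2%:R by rewrite divr_gt0// (lt_trans ltr01).
  have d1 : X / n.+2%:R < X by rewrite ltr_pdivrMr ?ltr_pMr// (lt_trans ltr01).
  by rewrite /x; move: d0 d1; set d := X / _ => d0 d1; apply/andP; split; lra.
pose F n := I 0 (x n).
have nd : {homo F : n m / (n <= m)%N >-> (n <= m)%O}.
  move=> n m nm; apply/subsetPset; apply: itv_oo_sub => //.
  by rewrite /x lerD2l lerN2 ler_pM2l// lef_pV2 ?posrE ?ltr0n// ler_nat.
have mF n : measurable (F n) by exact: measurable_itv.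
have mfF n : measurable_fun (F n) (EFin \o f).
  by have [/measurable_int] := h _ (xX n).
have UF : \bigcup_n F n = I 0 X.
  apply/seteqP; split => s.
    move=> [n _]; apply: itv_oo_sub => //; by case/andP: (xX n) => _ /ltW.
  rewrite /= in_itv/= => /andP[s0 sX].
  have Xs : 0 < X - s by rewrite subr_gt0.
  exists (Num.truncn (X / (X - s))) => //; rewrite /F/= in_itv/= s0 /x.
  have := truncnS_gt (X / (X - s)); set n := Num.truncn _ => hn.
  have : X / (X - s) < n.+2%:R by apply: lt_trans hn _; rewrite ltr_nat.
  rewrite ltr_pdivrMr// => hn'.
  rewrite ltrBrDr -ltrBrDl ltr_pdivrMr ?ltr0n//; lra.
have mfX : measurable_fun (I 0 X) (EFin \o f) by rewrite -UF; apply/measurable_fun_bigcup.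
have K0 : 0 <= K.
  by have [_] := h _ (xX 0%N); apply: le_trans; exact: Rintegral_ge0.
have le : (\int[mu]_(s in I 0 X) (f s)%:E <= K%:E)%E.
  rewrite -UF.
  have /cvg_lim cv : (\int[mu]_(s in F n) (f s)%:E)%E @[n --> \oo] -->
      (\int[mu]_(s in \bigcup_n F n) (f s)%:E)%E.
    by apply: ge0_nondecreasing_set_cvg_integral => // i s _; rewrite lee_fin.
  rewrite -[leLHS]cv//; apply: lime_le.
    apply: ereal_nondecreasing_is_cvgn => n m nm.
    apply: ge0_subset_integral; [exact: mF|exact: mF|exact: mfF| |].
      by move=> s _; rewrite lee_fin.
    by apply/subsetPset; exact: nd.
  near=> n; have [i1 i2] := h _ (xX n).
  have fn : (\int[mu]_(s in F n) (f s)%:E)%E \is a fin_num.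
    by apply: (integrable_fin_num _ i1) => //; exact: measurable_itv.
  by move: i2; rewrite -lee_fin /Rintegral fineK.
have fX : mu.-integrable (I 0 X) (EFin \o f).
  apply/integrableP; split => //.
  under eq_integral => s _ do rewrite /= ger0_norm//.
  exact: le_lt_trans le (ltry _).
split => //; rewrite -lee_fin; apply: le_trans le.
by rewrite /Rintegral fineK//; exact: (integrable_fin_num _ fX).
Unshelve. all: by end_near. Qed.

(* M itself need not be integrable up to pi, but its primitive is: integrating
   by parts against x - t turns (x - t) / (pi - t) into a bounded factor. *)
Definition head_integral (M : R -> C) t := \int[mu]_(s in I 0 t) cmod (M s).

Lemma M_of_integrable M0 x : mu.-integrable (I 0 pi) (EFin \o (fun s => cmod (M0 s))) ->
  cmeas (I 0 pi) M0 -> x < pi -> cintegrable (I 0 x) (M_of M0).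
Proof.
move=> iM mM xpi; have [x0|x0] := leP x 0.
  rewrite set_itv_ge ?bnd_simp -?leNgt//; split; exact: integrable_set0.
have sub : I 0 x `<=` I 0 pi by apply: itv_oo_sub => //; exact: ltW.
have p0 : 0 < pi - x by lra.
apply: (@cintegrable_le _ _ _ (fun s => (pi - x)^-1 * cmod (M0 s))) => //.
- apply: cmeasM; last exact: cmeasS mM.
  apply: cmeas_real.
  (* Truncating at x makes the factor nondecreasing on the whole line, hence measurable. *)
  apply: (eq_measurable_fun (fun s : R => (pi - Num.min s x)^-1)).
    by move=> s; rewrite inE/= in_itv/= => /andP[_ sx]; rewrite min_l// ltW.
  apply: nondecreasing_measurable => // s t st.
  have mx (r : R) : 0 < pi - Num.min r x.
    by rewrite subr_gt0 gt_min xpi orbT.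
  by rewrite lef_pV2 ?posrE// lerD2l lerN2 le_min !ge_min st lexx orbT.
- move=> s; rewrite /= in_itv/= => /andP[s0 sx].
  have ps : 0 < pi - s by lra.
  rewrite /M_of cmodM cmod_real normfV (gtr0_norm ps) ler_wpM2r ?cmod_ge0//.
  by rewrite lef_pV2 ?posrE//; lra.
- by apply: integrableZ_real => //; exact: integrableS iM.
Qed.

Lemma head_integral_bound M0 : mu.-integrable (I 0 pi) (EFin \o (fun s => cmod (M0 s))) ->
  cmeas (I 0 pi) M0 ->
  mu.-integrable (I 0 pi) (EFin \o head_integral (M_of M0)) /\
  \int[mu]_(s in I 0 pi) head_integral (M_of M0) s <= \int[mu]_(s in I 0 pi) cmod (M0 s).
Proof.
move=> iM mM; apply: ge0_integrable_exhaust; first exact: pi_gt0.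
  by move=> s; apply: Rintegral_ge0 => ? _; exact: cmod_ge0.
move=> x /andP[x0 xpi].
have Mx := M_of_integrable iM mM xpi.
pose u s : C := (cmod (M_of M0 s))%:C.
pose U s : C := (head_integral (M_of M0) s)%:C.
have ci := cintegrable_cmod (measurable_itv _) Mx.
have z : mu.-integrable (I 0 x) (EFin \o (fun=> 0 : R)) by exact: integrable_itv_cst.
have hu : primitive x u U.
  split; first by split.
  move=> s /andP[s0 _]; apply: complexP; rewrite ?ReD ?ImD /=.
    by rewrite /head_integral [in X in _ = X + _]set_itvoo0 Rintegral_set0 add0r.
  by rewrite Rintegral_itv_cst// mul0r addr0.
pose p (s : R) : C := - 1; pose P s : C := (x - s)%:C.
have hp : primitive x p P.
  split; first by split; exact: integrable_itv_cst.
  move=> s /andP[s0 _]; apply: complexP; rewrite ?ReD ?ImD /= Rintegral_itv_cst//; ring.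
have pB s : I 0 x s -> cmod (p s) <= 1 by rewrite cmodN cmod1.
have [i1] := primitive_mul (ltW x0) hu hp pB.
move=> /(_ x); rewrite lexx ltW// => /(_ isT).
(* Both boundary terms vanish: P is zero at x and U is zero at 0. *)
rewrite /P subrr rmorph0 mulr0 /U {1}/head_integral set_itvoo0 Rintegral_set0 rmorph0 mul0r add0r.
have i2 : cintegrable (I 0 x) U.
  split => /=; last exact: z.
  have mU := primitive_cmeas hu.
  apply: (@le_integrable_real _ _ _ (fun=> head_integral (M_of M0) x)) => //.
  - by case: mU.
  - move=> s; rewrite /= in_itv/= => /andP[s0 sx].
    rewrite ger0_norm; last by apply: Rintegral_ge0 => ? _; exact: cmod_ge0.
    apply: le_Rintegral_itv => //; first exact: ltW.
    by move=> ? _; exact: cmod_ge0.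
  - exact: integrable_itv_cst.
have i3 : cintegrable (I 0 x) (fun s => u s * (x - s)%:C).
  have := cintegrableD (measurable_itv _) i1 i2; apply: eq_cintegrable => // s _.
  by rewrite /p /P; ring.
have -> : cintegral (I 0 x) (fun s => u s * (x - s)%:C + (head_integral (M_of M0) s)%:C * p s) =
   cintegral (I 0 x) (fun s => u s * (x - s)%:C) - cintegral (I 0 x) U.
  by rewrite -cintegralB//; apply: eq_cintegral => s _; rewrite /p /U; ring.
move=> /(congr1 (@complex.Re R)); rewrite ReD ReN /= => /esym/eqP.
rewrite subr_eq0 => /eqP E; split; first by case: i2.
rewrite -E.
have sub : I 0 x `<=` I 0 pi by apply: itv_oo_sub => //; exact: ltW.
apply: (@le_trans _ _ (\int[mu]_(s in I 0 x) cmod (M0 s))); last first.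
  by apply: le_Rintegral_itv => //; [exact: ltW|move=> ? _; exact: cmod_ge0].
apply: le_Rintegral => //; [by case: i3|exact: integrableS iM|].
move=> s; rewrite /= in_itv/= => /andP[s0 sx]; rewrite mulr0 subr0.
have ps : 0 < pi - s by lra.
rewrite cmodM cmod_real normfV (gtr0_norm ps) mulrC mulrA ler_piMl ?cmod_ge0//.
by rewrite ler_pdivrMr// mul1r; lra.
Qed.

End KernelBounds.

(** * Volterra equations in a weighted sup norm *)

Section Volterra.
Variable R : realType.
Local Notation C := R[i].
Local Notation mu := (@lebesgue_measure R).
Local Notation I a b := (`]a%R, b%R[%classic : set R).
Variables q M0 : R -> C.
Hypotheses (L2q : L2 q) (L2M : L2 M0).
Implicit Types (y u b F K : R -> C) (t x V A B : R) (lam al : C).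

(* If |y| <= V exp(k t) then |q y + M * y| <= V exp(k t) [weight] almost
   everywhere. *)
Definition weight t := cmod (q t) + head_integral (M_of M0) t.
Definition total_weight := \int[mu]_(t in I 0 pi) weight t.
Definition memory y t := cintegral (I 0 t) (fun s => M_of M0 (t - s) * y s).
(** The term q y + M * y is carried as an integrable F that agrees with it almost everywhere,
    matching the sense in which the equation holds. *)
Definition forcing y F := cintegrable (I 0 pi) F /\
  {ae mu, forall t, I 0 pi t -> F t = q t * y t + memory y t}.

Lemma head_integral_ge0 (M : R -> C) t : 0 <= head_integral M t.
Proof. by apply: Rintegral_ge0 => s _; exact: cmod_ge0. Qed.

Lemma weight_ge0 t : 0 <= weight t.
Proof. by rewrite addr_ge0 ?cmod_ge0 ?head_integral_ge0. Qed.

Lemma weight_integrable : mu.-integrable (I 0 pi) (EFin \o weight).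
Proof.
have [i1 _] := L2_L1 L2q; have [i2 _] := L2_L1 L2M.
have [i3 _] := head_integral_bound i2 (L2_cmeas L2M).
exact: integrableD_real.
Qed.

Lemma total_weight_ge0 : 0 <= total_weight.
Proof. by apply: Rintegral_ge0 => t _; exact: weight_ge0. Qed.

Lemma total_weight_le : total_weight <= Num.sqrt pi * pair_norm q M0.
Proof.
have [i1 h1] := L2_L1 L2q; have [i2 h2] := L2_L1 L2M.
have [i3 h3] := head_integral_bound i2 (L2_cmeas L2M).
rewrite /total_weight RintegralD// /pair_norm.
have : 0 <= Num.sqrt pi * L2norm M0 by rewrite mulr_ge0 ?sqrtr_ge0.
lra.
Qed.

Lemma memory_integrable y t B : t < pi -> cmeas (I 0 pi) y ->
  (forall s, I 0 t s -> cmod (y s) <= B) ->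
  cintegrable (I 0 t) (fun s => M_of M0 (t - s) * y s) /\
  cmod (memory y t) <= B * head_integral (M_of M0) t.
Proof.
move=> tpi my yB; have [i2 _] := L2_L1 L2M.
have Mt := M_of_integrable i2 (L2_cmeas L2M) tpi.
have [t0|t0] := leP t 0.
  have E : I 0 t = set0 by rewrite set_itv_ge// bnd_simp -leNgt.
  split; first by split; rewrite E; exact: integrable_set0.
  by rewrite /memory /cintegral /head_integral E !Rintegral_set0 mulr0 cmod0.
have ci := cintegrable_cmod (measurable_itv _) Mt.
have [i3 e3] := integrable_flip ci (fun s => cmod_ge0 _).
have mM : cmeas (I 0 t) (fun s => M_of M0 (t - s)).
  by have [m1 m2] := cintegrable_meas Mt; split; [exact: (measurable_flip m1)|exact: (measurable_flip m2)].
have sub : I 0 t `<=` I 0 pi by apply: itv_oo_sub => //; exact: ltW.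
have my' : cmeas (I 0 t) y by exact: cmeasS my.
have iB : mu.-integrable (I 0 t) (EFin \o (fun s => B * cmod (M_of M0 (t - s)))).
  exact: integrableZ_real.
have bd s : I 0 t s -> cmod (M_of M0 (t - s) * y s) <= B * cmod (M_of M0 (t - s)).
  by move=> ts; rewrite cmodM mulrC ler_wpM2r ?cmod_ge0// yB.
have ii : cintegrable (I 0 t) (fun s => M_of M0 (t - s) * y s).
  by apply: cintegrable_le iB => //; exact: cmeasM.
split => //; apply: le_trans (cmod_cintegral_le _ ii iB bd) _ => //.
by rewrite RintegralZl// e3.
Qed.

Lemma forcing_bound y F (k V : R) : forcing y F -> cmeas (I 0 pi) y -> 0 <= k -> 0 <= V ->
  (forall t, I 0 pi t -> cmod (y t) <= V * expR (k * t)) ->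
  {ae mu, forall t, I 0 pi t -> cmod (F t) <= V * expR (k * t) * weight t}.
Proof.
move=> [_ aeF] my k0 V0 hy; apply: ae_imp aeF => t h tpi; rewrite (h tpi).
have yt := hy t tpi; have := tpi; rewrite /= in_itv/= => /andP[t0 t1].
have [|_ hm] := @memory_integrable y t (V * expR (k * t)) t1 my.
  move=> s; rewrite /= in_itv/= => /andP[s0 st].
  apply: le_trans (hy s _) _; first by rewrite /= in_itv/= s0/= (lt_trans st).
  by rewrite ler_wpM2l// ler_expR ler_wpM2l// ltW.
apply: le_trans (cmodD _ _) _; rewrite cmodM mulrDr lerD// mulrC.
by rewrite ler_wpM2r ?cmod_ge0.
Qed.

(** Since exp(k (x - t)) exp(k t) = exp(k x), convolution with a kernel of growth exp(k v) preserves
    bounds of the form V exp(k x) and costs only a factor A times the integral of g. It is used with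
    g = [weight] and with g = 1. *)
Lemma convolution_bound F (g : R -> R) K (k A V x : R) : 0 <= x <= pi -> 0 <= V -> 0 <= A ->
  cintegrable (I 0 pi) F ->
  mu.-integrable (I 0 pi) (EFin \o g) -> (forall t, 0 <= g t) ->
  {ae mu, forall t, I 0 pi t -> cmod (F t) <= V * expR (k * t) * g t} ->
  cmeas (I 0 x) (fun t => K (x - t)) ->
  (forall v, 0 <= v <= pi -> cmod (K v) <= A * expR (k * v)) ->
  cintegrable (I 0 x) (fun t => K (x - t) * F t) /\
  cmod (cintegral (I 0 x) (fun t => K (x - t) * F t)) <=
    A * V * expR (k * x) * \int[mu]_(t in I 0 pi) g t.
Proof.
move=> /andP[x0 xpi] V0 A0 iF ig g0 aeF mK bK.
have sub : I 0 x `<=` I 0 pi by exact: itv_oo_sub.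
have iFx := cintegrable_sub (lexx 0) xpi iF.
have igx : mu.-integrable (I 0 x) (EFin \o g) by exact: integrableS ig.
have Kx t : I 0 x t -> cmod (K (x - t)) <= A * expR (k * (x - t)).
  by rewrite /= in_itv/= => /andP[t0 tx]; apply: bK; apply/andP; split; lra.
have ii : cintegrable (I 0 x) (fun t => K (x - t) * F t).
  apply: (@cintegrableMb _ _ _ _ (A * expR (`|k| * pi))) => // t tx.
  apply: le_trans (Kx t tx) _; rewrite ler_wpM2l// ler_expR.
  move: tx; rewrite /= in_itv/= => /andP[t0 tx].
  have := ler_norm k; have := normr_ge0 k; nra.
split => //.
have iG : mu.-integrable (I 0 x) (EFin \o (fun t => A * V * expR (k * x) * g t)).
  exact: integrableZ_real.
have c0 : 0 <= A * V * expR (k * x) by rewrite mulr_ge0 ?expR_ge0// mulr_ge0.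
apply: (@le_trans _ _ (\int[mu]_(t in I 0 x) (A * V * expR (k * x) * g t))); last first.
  by rewrite RintegralZl// ler_wpM2l// le_Rintegral_itv.
apply: cmod_cintegral_ae => //; first by move=> t _; rewrite mulr_ge0.
apply: ae_imp aeF => t h tx; have {}h := h (sub t tx).
have -> : expR (k * x) = expR (k * (x - t)) * expR (k * t).
  by rewrite -expRD; congr expR; ring.
rewrite cmodM.
have -> : A * V * (expR (k * (x - t)) * expR (k * t)) * g t =
  (A * expR (k * (x - t))) * (V * expR (k * t) * g t) by ring.
by rewrite ler_pM ?cmod_ge0 ?Kx.
Qed.

(* The equation integrated twice, with source b. *)
Definition vsol lam b y := (exists u, primitive pi u y) /\
  exists2 F, forcing y F & forall x, 0 <= x <= pi ->
    y x = b x + cintegral (I 0 x) (fun t => (x - t)%:C * (F t - lam * y t)).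

(** Take V to be the supremum of f; its finiteness is what permits solving sup f <= B + th sup f.
    Applied to |y x| exp(- k x). *)
Lemma sup_contraction (f : R -> R) (B th : R) : th < 1 ->
  (exists V, forall x, 0 <= x <= pi -> f x <= V) -> (forall x, 0 <= f x) ->
  (forall V, 0 <= V -> (forall x, 0 <= x <= pi -> f x <= V) ->
    forall x, 0 <= x <= pi -> f x <= B + th * V) ->
  forall x, 0 <= x <= pi -> (1 - th) * f x <= B.
Proof.
move=> th1 [V0 hV0] f0 h.
pose E := [set f x | x in [set x | 0 <= x <= pi]].
have E0 : E (f 0) by exists 0 => //=; rewrite lexx pi_ge0.
have hE : has_sup E.
  by split; [exists (f 0)|exists V0 => _ [x hx <-]; exact: hV0].
have ubE x : 0 <= x <= pi -> f x <= sup E.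
  by move=> hx; apply: sup_upper_bound => //; exists x.
have s0 : 0 <= sup E by apply: le_trans (f0 0) (ubE 0 _); rewrite lexx pi_ge0.
have hs := h _ s0 ubE.
have : sup E <= B + th * sup E.
  by apply: ge_sup; [exists (f 0)|move=> _ [x hx <-]; exact: hs].
move=> g x hx; have := ubE x hx; nra.
Qed.

(** The factor 1 / k is what makes the operator contract once k is large. *)
Lemma lag_kernel_bound (k v : R) : 0 < k -> 0 <= v -> cmod (v%:C : C) <= k^-1 * expR (k * v).
Proof.
move=> k0 v0; rewrite cmod_real ger0_norm// mulrC ler_pdivlMr// mulrC.
by apply: le_trans (expR_ge1Dx _); lra.
Qed.

Lemma cmeas_lag x (A : set R) : cmeas A (fun t => (x - t)%:C : C).
Proof.
by apply: cmeas_real; apply: measurable_funB => //; exact: measurable_cst.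
Qed.

Lemma lag_integral_bound u (k V x : R) : 0 < k -> 0 <= V -> 0 <= x <= pi -> cmeas (I 0 pi) u ->
  (forall t, I 0 pi t -> cmod (u t) <= V * expR (k * t)) ->
  cintegrable (I 0 x) (fun t => (x - t)%:C * u t) /\
  cmod (cintegral (I 0 x) (fun t => (x - t)%:C * u t)) <= k^-1 * V * expR (k * x) * pi.
Proof.
move=> k0 V0 hx mu' hu.
have iu : cintegrable (I 0 pi) u.
  apply: (@cintegrable_le _ _ _ (fun=> V * expR (k * pi))) => //; last exact: integrable_itv_cst.
  move=> t tpi; apply: le_trans (hu t tpi) _; rewrite ler_wpM2l// ler_expR.
  by rewrite ler_wpM2l ?(ltW k0)//; move: tpi; rewrite /= in_itv/= => /andP[_ /ltW].
have p0 : 0 <= pi :> R := pi_ge0 R.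
rewrite -[X in _ * X]mul1r -[X in _ * (_ * X)]subr0 -Rintegral_itv_cst//.
apply: (@convolution_bound u (fun=> 1) (fun v => v%:C)) => //.
- by rewrite invr_ge0 ltW.
- exact: integrable_itv_cst.
- by apply: aeW => t tpi; rewrite mulr1; exact: hu.
- exact: cmeas_lag.
- by move=> v /andP[v0 _]; exact: lag_kernel_bound.
Qed.

Lemma vsol_cmeas lam b y : vsol lam b y -> cmeas (I 0 pi) y.
Proof. by move=> [[u hu] _]; exact: primitive_cmeas hu. Qed.

Lemma vsol_bounded lam b y : vsol lam b y ->
  exists2 V, 0 <= V & forall x, 0 <= x <= pi -> cmod (y x) <= V.
Proof.
move=> [[u hu] _]; exists (cmod (y 0) + \int[mu]_(t in I 0 pi) cmod (u t)).
  by rewrite addr_ge0 ?cmod_ge0// Rintegral_ge0// => t _; exact: cmod_ge0.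
by move=> x; exact: primitive_bounded.
Qed.

(** In the norm with weight exp(- k x) the integral operator has norm at most (W + L pi) / k <= 1/2,
    with W the total weight, so a solution is at most twice its source. The bound is uniform over
    |lam| <= L. *)
Lemma vsol_bound lam b y (L k B : R) : vsol lam b y -> cmod lam <= L -> 0 < k ->
  2 * (total_weight + L * pi) <= k -> (forall x, 0 <= x <= pi -> cmod (b x) <= B * expR (k * x)) ->
  forall x, 0 <= x <= pi -> cmod (y x) <= 2 * B * expR (k * x).
Proof.
move=> hy lL k0 hk hb.
have [V1 V10 hV1] := vsol_bounded hy.
have my := vsol_cmeas hy.
pose f x := cmod (y x) * expR (- (k * x)).
have fE x : cmod (y x) = f x * expR (k * x).
  by rewrite /f -mulrA -expRD addNr expR0 mulr1.
have f0 x : 0 <= f x by rewrite mulr_ge0 ?cmod_ge0 ?expR_ge0.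
suff h x : 0 <= x <= pi -> (1 - 2^-1) * f x <= B.
  by move=> x /h hx; rewrite fE ler_wpM2r ?expR_ge0//; lra.
move: x; apply: sup_contraction => //; first by rewrite invf_lt1 ?ltr1n.
  exists V1 => x hx; apply: le_trans (hV1 x hx).
  rewrite /f ler_piMr ?cmod_ge0// -expR0 ler_expR oppr_le0 mulr_ge0 ?(ltW k0)//.
  by case/andP: hx.
move=> V V0 hV x hx.
have yV t : I 0 pi t -> cmod (y t) <= V * expR (k * t).
  rewrite /= in_itv/= => /andP[t0 tpi]; rewrite fE ler_wpM2r ?expR_ge0//.
  by apply: hV; rewrite !ltW.
have [_ [F fF hF]] := hy.
have kV0 : 0 <= k^-1 by rewrite invr_ge0 ltW.
have [|i1 b1] := @convolution_bound F weight (fun v => v%:C) k k^-1 V x hx V0 kV0 fF.1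
  weight_integrable weight_ge0 (forcing_bound fF my (ltW k0) V0 yV) (cmeas_lag _ _).
  by move=> v /andP[v0 _]; exact: lag_kernel_bound.
have [i2 b2] := lag_integral_bound k0 V0 hx my yV.
have L0 : 0 <= L by apply: le_trans lL; exact: cmod_ge0.
have E : y x = b x + (cintegral (I 0 x) (fun t => (x - t)%:C * F t) -
    lam * cintegral (I 0 x) (fun t => (x - t)%:C * y t)).
  rewrite hF// -cintegralZ// -cintegralB//; last exact: cintegrableZ.
  by congr (_ + _); apply: eq_cintegral => t _; ring.
have h1 : cmod (y x) <= B * expR (k * x) + (k^-1 * V * expR (k * x) * total_weight +
   L * (k^-1 * V * expR (k * x) * pi)).
  rewrite [in X in X <= _]E; apply: le_trans (cmodD _ _) _; rewrite lerD ?hb//.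
  apply: le_trans (cmodB _ _) _; rewrite lerD// cmodM.
  by rewrite ler_pM ?cmod_ge0.
have e0 : 0 < expR (k * x) by exact: expR_gt0.
rewrite -(ler_pM2r e0) -fE; apply: le_trans h1 _.
have kV : k^-1 * (total_weight + L * pi) <= 2^-1.
  by rewrite mulrC ler_pdivrMr//; lra.
have eV : 0 <= expR (k * x) * V by rewrite mulr_ge0// ltW.
have := ler_wpM2l eV kV; lra.
Qed.

End Volterra.

(** * Integral equations for solutions and their asymptotics *)

Section Solutions.
Variable R : realType.
Local Notation C := R[i].
Local Notation mu := (@lebesgue_measure R).
Local Notation I a b := (`]a%R, b%R[%classic : set R).
Variables q M0 : R -> C.
Hypotheses (L2q : L2 q) (L2M : L2 M0).
Implicit Types (y u b F K : R -> C) (t x V A B : R) (lam al rho : C).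

Lemma ac_deriv_primitive y u : ac_deriv y u -> primitive pi u y.
Proof.
by move=> [ui h]; split => // x hx; apply: h; rewrite in_itv.
Qed.

Lemma solution_forcing lam y u : is_solution q M0 lam y u ->
  exists2 F, forcing q M0 y F & primitive pi (fun t => F t - lam * y t) u.
Proof.
move=> [hy [v hv aev]].
have py := ac_deriv_primitive hy; have pu := ac_deriv_primitive hv.
have [vi hu] := pu.
have my := primitive_cmeas py.
have by' x : I 0 pi x -> cmod (y x) <= cmod (y 0) + \int[mu]_(t in I 0 pi) cmod (u t).
  rewrite /= in_itv/= => /andP[x0 xpi].
  by apply: (primitive_bounded py); rewrite !ltW.
have iy : cintegrable (I 0 pi) y.
  by apply: (cintegrable_le _ my by') => //; exact: integrable_itv_cst.
(* F is y'' + lam y, whose integrability comes from that of y'' and y. *)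
exists (fun t => v t + lam * y t); last first.
  by rewrite (_ : (fun t => _) = v)//; apply/funext => t; rewrite addrK.
split; first by apply: cintegrableD => //; exact: cintegrableZ.
apply: ae_imp aev => t h tpi; have := h tpi; rewrite /memory => <-.
by ring.
Qed.

Lemma primitive_lag X x : 0 <= X -> primitive X (fun=> -1 : C) (fun t => (x - t)%:C).
Proof.
move=> X0; split; first by split; exact: integrable_itv_cst.
move=> s /andP[s0 _]; apply: complexP; rewrite ?ReD ?ImD /= Rintegral_itv_cst//; ring.
Qed.

(** Integration by parts of u = y' against x - t. *)
Lemma solution_vsol lam y u : is_solution q M0 lam y u -> y 0 = 0 ->
  vsol q M0 lam (fun x => u 0 * x%:C) y.
Proof.
move=> sol y0; have [F fF pu] := solution_forcing sol.
have py : primitive pi u y by case: sol => /ac_deriv_primitive.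
split; first by exists u.
exists F => // x /andP[x0 xpi].
have p1 (s : R) : I 0 pi s -> cmod (-1 : C) <= 1 by rewrite cmodN cmod1.
have [ii] := primitive_mul (pi_ge0 R) pu (@primitive_lag pi x (pi_ge0 R)) p1.
move=> /(_ x); rewrite x0 xpi subrr rmorph0 mulr0 subr0 => /(_ isT).
have iu : cintegrable (I 0 x) u by case: py => h _; exact: cintegrable_sub h.
have ix := cintegrable_sub (lexx 0) xpi ii.
have -> : y x = cintegral (I 0 x) u by case: py => _ -> //; rewrite ?x0// y0 add0r.
have -> : cintegral (I 0 x) (fun t => (x - t)%:C * (F t - lam * y t)) =
    cintegral (I 0 x) (fun t => (F t - lam * y t) * (x - t)%:C + u t * -1) +
    cintegral (I 0 x) u.
  by rewrite -cintegralD//; apply: eq_cintegral => t _; ring.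
by rewrite addrA => <-; rewrite add0r.
Qed.

(** As al^2 = - lam, the function U = u + al y satisfies U' = al U + F, and exp(- al t) is an
    integrating factor. Subtracting the formulas for al and - al isolates 2 al y. *)
Lemma solution_exp lam al y u F : is_solution q M0 lam y u ->
  cintegrable (I 0 pi) F ->
  primitive pi (fun t => F t - lam * y t) u -> al ^+ 2 = - lam ->
  forall x, 0 <= x <= pi ->
    cintegrable (I 0 x) (fun t => cexp (al * (x - t)%:C) * F t) /\
    u x + al * y x = cexp (al * x%:C) * (u 0 + al * y 0) +
      cintegral (I 0 x) (fun t => cexp (al * (x - t)%:C) * F t).
Proof.
move=> sol iF pu al2 x /andP[x0 xpi].
have py : primitive pi u y by case: sol => /ac_deriv_primitive.
have iu : cintegrable (I 0 pi) u by case: py.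
have pU : primitive pi (fun t => F t - lam * y t + al * u t) (fun t => u t + al * y t).
  split; first by apply: cintegrableD; [|case: pu|exact: cintegrableZ].
  move=> s hs; have sub : s <= pi by case/andP: hs.
  rewrite cintegralD//; last 2 first.
  - by apply: cintegrable_sub (lexx 0) sub _; case: pu.
  - by apply: cintegrableZ => //; exact: cintegrable_sub (lexx 0) sub _.
  rewrite cintegralZ//; last exact: cintegrable_sub (lexx 0) sub _.
  case: pu => _ /(_ s hs) ->; case: py => _ /(_ s hs) ->; ring.
have pE := cexp_primitive (- al) (pi_ge0 R).
have bE (s : R) : I 0 pi s -> cmod (- al * cexp (- al * s%:C)) <=
    cmod al * expR (cmod al * pi).
  rewrite /= in_itv/= => /andP[s0 spi]; rewrite cmodM cmodN ler_wpM2l ?cmod_ge0//.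
  rewrite cmod_cexp ler_expR; apply: le_trans (ler_norm _) _.
  apply: le_trans (Re_le_cmod _) _; rewrite cmodM cmodN cmod_real ger0_norm ?(ltW s0)//.
  by rewrite ler_wpM2l ?cmod_ge0// ltW.
have [ii] := primitive_mul (pi_ge0 R) pU pE bE.
move=> /(_ x); rewrite x0 xpi mulr0 cexp0 mulr1 => /(_ isT).
have eqF t : (F t - lam * y t + al * u t) * cexp (- al * t%:C) +
   (u t + al * y t) * (- al * cexp (- al * t%:C)) = cexp (- al * t%:C) * F t.
  have -> : lam = - al ^+ 2 by rewrite al2 opprK.
  by ring.
have -> : cintegral (I 0 x) (fun t => (F t - lam * y t + al * u t) * cexp (- al * t%:C) +
   (u t + al * y t) * (- al * cexp (- al * t%:C))) =
   cintegral (I 0 x) (fun t => cexp (- al * t%:C) * F t).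
  by apply: eq_cintegral => t _; exact: eqF.
have ie : cintegrable (I 0 x) (fun t => cexp (- al * t%:C) * F t).
  apply: (eq_cintegrable _ (fun t _ => eqF t)) => //.
  exact: cintegrable_sub (lexx 0) xpi ii.
have ee t : cexp (al * (x - t)%:C) = cexp (al * x%:C) * cexp (- al * t%:C).
  by rewrite -cexpD rmorphB; congr cexp; ring.
have E : cintegral (I 0 x) (fun t => cexp (al * (x - t)%:C) * F t) =
    cexp (al * x%:C) * cintegral (I 0 x) (fun t => cexp (- al * t%:C) * F t).
  by rewrite -cintegralZ//; apply: eq_cintegral => t _; rewrite ee mulrA.
move=> h; split.
  have := cintegrableZ (cexp (al * x%:C)) (measurable_itv _) ie.
  by apply: eq_cintegrable => // t _; rewrite ee mulrA.
rewrite E -mulrDr -h mulrCA.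
by rewrite [cexp _ * cexp _]mulrC mulNr cexpN_mul mulr1.
Qed.

(* exp_sine rho x = 2i sin(rho x) *)
Definition exp_sine rho x : C := cexp ('i * rho * x%:C) - cexp (- ('i * rho) * x%:C).

Lemma cmod_exp_le rho x : 0 <= x ->
  cmod (cexp ('i * rho * x%:C)) <= expR (`|complex.Im rho| * x) /\
  cmod (cexp (- ('i * rho) * x%:C)) <= expR (`|complex.Im rho| * x).
Proof.
move=> x0; rewrite !cmod_cexp !ler_expR; case: rho => a b /=.
have := ler_norm b; have := ler_norm (- b); rewrite normrN => h1 h2.
by split; rewrite !(mul0r, mul1r, mulr0, subr0, add0r, addr0, mulrN, mulNr, opprK, sub0r); nra.
Qed.

Lemma cmod_exp_sine_le rho x : 0 <= x ->
  cmod (exp_sine rho x) <= 2 * expR (`|complex.Im rho| * x).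
Proof.
move=> x0; have [h1 h2] := cmod_exp_le rho x0.
by apply: le_trans (cmodB _ _) _; lra.
Qed.

(** With k = |Im rho| the kernel is at most 2 exp(k v), and division by 2 |rho| turns the total
    weight into the contraction factor th. So |y x| exp(- k x) <= 1 / (|rho| (1 - th)), and one more
    use of the representation [rep] at pi bounds the error. *)
Lemma solution_asymptotics y u rho (th : R) : is_solution q M0 (rho ^+ 2) y u ->
  y 0 = 0 -> u 0 = 1 -> rho != 0 -> total_weight q M0 / cmod rho <= th -> th < 1 ->
  cmod (2 * 'i * rho * y pi - exp_sine rho pi) <=
    2 * expR (`|complex.Im rho| * pi) * (th / (1 - th)).
Proof.
move=> sol y0 u0 rho0 hth th1.
have [F fF pu] := solution_forcing sol; have [iF _] := fF.
have py : primitive pi u y by case: sol => /ac_deriv_primitive.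
have my := primitive_cmeas py.
pose al := 'i * rho; pose k := `|complex.Im rho|.
have k0 : 0 <= k by exact: normr_ge0.
have al2 : al ^+ 2 = - rho ^+ 2 by rewrite /al exprMn sqr_i mulN1r.
have al2' : (- al) ^+ 2 = - rho ^+ 2 by rewrite sqrrN.
have r0 : 0 < cmod rho by rewrite cmod_gt0.
have W0 := total_weight_ge0 q M0.
have th0 : 0 <= th by apply: le_trans hth; rewrite divr_ge0// ltW.
have rep x : 0 <= x <= pi -> cintegrable (I 0 x) (fun t => exp_sine rho (x - t) * F t) ->
  2 * 'i * rho * y x = exp_sine rho x + cintegral (I 0 x) (fun t => exp_sine rho (x - t) * F t).
  move=> hx ii.
  have [i1 e1] := solution_exp sol iF pu al2 hx; have [i2 e2] := solution_exp sol iF pu al2' hx.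
  have -> : cintegral (I 0 x) (fun t => exp_sine rho (x - t) * F t) =
      cintegral (I 0 x) (fun t => cexp (al * (x - t)%:C) * F t) -
      cintegral (I 0 x) (fun t => cexp (- al * (x - t)%:C) * F t).
    by rewrite -cintegralB//; apply: eq_cintegral => t _; rewrite /exp_sine; ring.
  have -> : 2 * 'i * rho * y x = (u x + al * y x) - (u x + - al * y x) by rewrite /al; ring.
  rewrite e1 e2 y0 u0 /exp_sine -/al; ring.
have mE x : cmeas (I 0 x) (fun t => exp_sine rho (x - t)).
  have [x0|x0] := leP 0 x; last first.
    have E : I 0 x = set0 by rewrite set_itv_ge// bnd_simp -leNgt ltW.
    by rewrite E; split; exact: measurable_fun_set0.
  have m1 (be : C) : cmeas (I 0 x) (fun t => cexp (be * (x - t)%:C)).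
    have := cmeasM (@cmeas_cst _ (I 0 x) (cexp (be * x%:C)))
       (primitive_cmeas (cexp_primitive (- be) x0)).
    move=> [a1 a2]; split.
      by apply: eq_measurable_fun a1 => t _; rewrite -cexpD rmorphB; congr (complex.Re (cexp _)); ring.
    by apply: eq_measurable_fun a2 => t _; rewrite -cexpD rmorphB; congr (complex.Im (cexp _)); ring.
  have := cmeasD (m1 al) (cmeasM (@cmeas_cst _ (I 0 x) (-1)) (m1 (- al))).
  move=> [a1 a2]; split.
    by apply: eq_measurable_fun a1 => t _; rewrite mulN1r.
  by apply: eq_measurable_fun a2 => t _; rewrite mulN1r.
have conv V x : 0 <= V -> 0 <= x <= pi ->
    (forall t, I 0 pi t -> cmod (y t) <= V * expR (k * t)) ->
    cintegrable (I 0 x) (fun t => exp_sine rho (x - t) * F t) /\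
    cmod (cintegral (I 0 x) (fun t => exp_sine rho (x - t) * F t)) <=
      2 * V * expR (k * x) * total_weight q M0.
  move=> V0 hx hV.
  apply: (@convolution_bound _ F (weight q M0) (exp_sine rho) k) => //.
  - exact: weight_integrable.
  - exact: weight_ge0.
  - exact: (forcing_bound L2M fF my k0 V0 hV).
  - by move=> v /andP[v0 _]; exact: cmod_exp_sine_le.
pose f x := cmod (y x) * expR (- (k * x)).
have fE x : cmod (y x) = f x * expR (k * x).
  by rewrite /f -mulrA -expRD addNr expR0 mulr1.
have f0 x : 0 <= f x by rewrite mulr_ge0 ?cmod_ge0 ?expR_ge0.
have fV V : (forall x, 0 <= x <= pi -> f x <= V) -> forall t, I 0 pi t -> cmod (y t) <= V * expR (k * t).
  move=> hV t; rewrite /= in_itv/= => /andP[t0 tpi].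
  by rewrite fE ler_wpM2r ?expR_ge0// hV// !ltW.
have c2 : cmod (2 * 'i * rho) = 2 * cmod rho.
  rewrite !cmodM cmod_nat [cmod 'i]/= expr0n expr1n add0r sqrtr1 mulr1//.
have fb : exists V, forall x, 0 <= x <= pi -> f x <= V.
  exists (cmod (y 0) + \int[mu]_(t in I 0 pi) cmod (u t)) => x hx.
  apply: le_trans (primitive_bounded py hx).
  rewrite /f ler_piMr ?cmod_ge0// -expR0 ler_expR oppr_le0 mulr_ge0//.
  by case/andP: hx.
have hW : total_weight q M0 <= th * cmod rho by rewrite -ler_pdivrMr.
have key x : 0 <= x <= pi -> (1 - th) * f x <= (cmod rho)^-1.
  move: x; apply: sup_contraction => // V V0 hV x hx.
  have [i1 b1] := conv V x V0 hx (fV V hV).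
  have := rep x hx i1 => /(congr1 (fun z => cmod z)); rewrite cmodM c2 => h.
  have e0 : 0 < expR (k * x) by exact: expR_gt0.
  have x0 : 0 <= x by case/andP: hx.
  have := cmodD (exp_sine rho x) (cintegral (I 0 x) (fun t => exp_sine rho (x - t) * F t)).
  rewrite -h fE => h2; have h3 := cmod_exp_sine_le rho x0; rewrite -/k in h3.
  have h4 : 2 * cmod rho * (f x * expR (k * x)) <=
     2 * expR (k * x) + 2 * V * expR (k * x) * (th * cmod rho).
    apply: le_trans h2 _; apply: lerD => //; apply: le_trans b1 _.
    by rewrite ler_wpM2l// mulr_ge0 ?(ltW e0)// mulr_ge0.
  have h5 : cmod rho * f x <= 1 + cmod rho * (th * V) by rewrite -(ler_pM2r e0); lra.
  by rewrite -(ler_pM2l r0) mulrDr divff// gt_eqF.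
have d1 : 0 < 1 - th by lra.
pose V := (cmod rho)^-1 / (1 - th).
have V0 : 0 <= V by rewrite divr_ge0 ?invr_ge0 ?ltW.
have hV x : 0 <= x <= pi -> f x <= V.
  by move=> /key h; rewrite ler_pdivlMr// mulrC.
have hpi : 0 <= (pi : R) <= pi by rewrite pi_ge0 lexx.
have [i1 b1] := conv V pi V0 hpi (fV V hV).
rewrite (rep pi hpi i1) addrC addKr; apply: le_trans b1 _.
have Vr : V * (th * cmod rho) = th / (1 - th).
  by rewrite /V; field; rewrite !gt_eqF.
rewrite -Vr.
have e0 : 0 <= 2 * expR (k * pi) * V by rewrite mulr_ge0// mulr_ge0// expR_ge0.
have := ler_wpM2l e0 hW; lra.
Qed.

End Solutions.

(** * Polynomial approximation by Newton interpolation *)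

Section Newton.
Variable R : realType.
Local Notation C := R[i].
Local Notation mu := (@lebesgue_measure R).
Local Notation I a b := (`]a%R, b%R[%classic : set R).
Variables q M0 : R -> C.
Hypotheses (L2q : L2 q) (L2M : L2 M0).
Implicit Types (y u b F K : R -> C) (t x V A B : R) (lam k : C).

Lemma primitive_linear X k1 k2 u1 u2 y1 y2 : primitive X u1 y1 -> primitive X u2 y2 ->
  primitive X (fun x => k1 * u1 x + k2 * u2 x) (fun x => k1 * y1 x + k2 * y2 x).
Proof.
move=> [i1 h1] [i2 h2]; split; first by apply: cintegrableD => //; exact: cintegrableZ.
move=> x hx; have xX : x <= X by case/andP: hx.
have j1 := cintegrable_sub (lexx 0) xX i1; have j2 := cintegrable_sub (lexx 0) xX i2.
by rewrite cintegralD ?cintegralZ ?(h1 x) ?(h2 x)//; [ring|exact: cintegrableZ|exact: cintegrableZ].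
Qed.

Lemma primitive_memory u y t : primitive pi u y -> t < pi ->
  cintegrable (I 0 t) (fun s => M_of M0 (t - s) * y s).
Proof.
move=> hy tpi; have my := primitive_cmeas hy.
apply: (memory_integrable L2M tpi my _).1 => s.
rewrite /= in_itv/= => /andP[s0 st]; apply: (primitive_bounded hy).
by apply/andP; split; lra.
Qed.

Lemma forcing_linear k1 k2 u1 u2 y1 y2 F1 F2 : primitive pi u1 y1 -> primitive pi u2 y2 ->
  forcing q M0 y1 F1 -> forcing q M0 y2 F2 ->
  forcing q M0 (fun x => k1 * y1 x + k2 * y2 x) (fun x => k1 * F1 x + k2 * F2 x).
Proof.
move=> p1 p2 [i1 h1] [i2 h2]; split.
  by apply: cintegrableD => //; exact: cintegrableZ.
apply: ae_imp2 h1 h2 => t g1 g2 tpi; rewrite g1// g2//.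
have tp : t < pi by move: tpi; rewrite /= in_itv/= => /andP[].
have m1 := primitive_memory p1 tp; have m2 := primitive_memory p2 tp.
have -> : memory M0 (fun x => k1 * y1 x + k2 * y2 x) t = k1 * memory M0 y1 t + k2 * memory M0 y2 t.
  rewrite /memory -!cintegralZ// -cintegralD//; [|exact: cintegrableZ|exact: cintegrableZ].
  by apply: eq_cintegral => s _; ring.
ring.
Qed.

Lemma vsol_lag_integrable lam b y x : vsol q M0 lam b y -> 0 <= x <= pi ->
  cintegrable (I 0 x) (fun t => (x - t)%:C * y t).
Proof.
move=> hy hx; have [V V0 hV] := vsol_bounded hy.
apply: (lag_integral_bound (k := 1) (V := V) _ _ hx (vsol_cmeas hy) _).1 => // t.
rewrite /= in_itv/= => /andP[t0 tpi]; apply: le_trans (hV t _) _; first by rewrite !ltW.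
by rewrite mul1r ler_peMr//; apply: le_trans (expR_ge1Dx t); lra.
Qed.

Lemma lag_forcing_integrable F x : cintegrable (I 0 pi) F -> 0 <= x <= pi ->
  cintegrable (I 0 x) (fun t => (x - t)%:C * F t).
Proof.
move=> iF /andP[x0 xpi]; apply: (@cintegrableMb _ _ _ _ pi) => //.
- exact: cmeas_lag.
- move=> t; rewrite cmod_real /= in_itv/= => /andP[t0 tx]; rewrite ger0_norm; lra.
- exact: cintegrable_sub iF.
Qed.

(** The additional source accounts for y2 solving the equation with lam2 in place of lam1. *)
Lemma vsol_linear lam1 lam2 k1 k2 b1 b2 y1 y2 :
  vsol q M0 lam1 b1 y1 -> vsol q M0 lam2 b2 y2 ->
  vsol q M0 lam1
    (fun x => k1 * b1 x + k2 * b2 x +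
       k2 * (lam1 - lam2) * cintegral (I 0 x) (fun t => (x - t)%:C * y2 t))
    (fun x => k1 * y1 x + k2 * y2 x).
Proof.
move=> s1 s2.
have [[u1 p1] [F1 f1 e1]] := s1; have [[u2 p2] [F2 f2 e2]] := s2.
split; first by exists (fun x => k1 * u1 x + k2 * u2 x); exact: primitive_linear.
exists (fun x => k1 * F1 x + k2 * F2 x); first exact: (forcing_linear _ _ p1 p2).
move=> x hx; rewrite e1// e2//.
have a1 := lag_forcing_integrable f1.1 hx; have a2 := lag_forcing_integrable f2.1 hx.
have c1 := vsol_lag_integrable s1 hx; have c2 := vsol_lag_integrable s2 hx.
have E l (F y : R -> C) : cintegrable (I 0 x) (fun t => (x - t)%:C * F t) ->
    cintegrable (I 0 x) (fun t => (x - t)%:C * y t) ->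
    cintegral (I 0 x) (fun t => (x - t)%:C * (F t - l * y t)) =
    cintegral (I 0 x) (fun t => (x - t)%:C * F t) -
    l * cintegral (I 0 x) (fun t => (x - t)%:C * y t).
  move=> iF iy; rewrite -cintegralZ// -cintegralB//; last exact: cintegrableZ.
  by apply: eq_cintegral => t _; ring.
have D (F G : R -> C) : cintegrable (I 0 x) (fun t => (x - t)%:C * F t) ->
    cintegrable (I 0 x) (fun t => (x - t)%:C * G t) ->
    cintegrable (I 0 x) (fun t => (x - t)%:C * (k1 * F t + k2 * G t)) /\
    cintegral (I 0 x) (fun t => (x - t)%:C * (k1 * F t + k2 * G t)) =
    k1 * cintegral (I 0 x) (fun t => (x - t)%:C * F t) +
      k2 * cintegral (I 0 x) (fun t => (x - t)%:C * G t).
  move=> iF iG; have jF := cintegrableZ k1 (measurable_itv _) iF.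
  have jG := cintegrableZ k2 (measurable_itv _) iG; split.
    have := cintegrableD (measurable_itv _) jF jG.
    by apply: eq_cintegrable => // t _; ring.
  rewrite -!cintegralZ// -cintegralD//.
  by apply: eq_cintegral => t _; ring.
have [d1 g1] := D _ _ a1 a2; have [d2 g2] := D _ _ c1 c2.
rewrite (E lam1 _ _ a1 c1) (E lam2 _ _ a2 c2) (E lam1 _ _ d1 d2) g1 g2.
ring.
Qed.

Lemma vsol_ext lam b b' y y' : b =1 b' -> y =1 y' -> vsol q M0 lam b y -> vsol q M0 lam b' y'.
Proof. by move=> /funext -> /funext ->. Qed.

(** The common source b cancels, and so does the factor lam - mu'. The new source involves y2 but
    not lam, so it is again common to all lam and the step can be iterated. *)
Lemma vsol_divided_difference lam mu' b y1 y2 : vsol q M0 lam b y1 -> vsol q M0 mu' b y2 ->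
  lam != mu' ->
  vsol q M0 lam (fun x => - cintegral (I 0 x) (fun t => (x - t)%:C * y2 t))
    (fun x => (lam - mu')^-1 * (y1 x - y2 x)).
Proof.
move=> s1 s2 lm; have lm0 : lam - mu' != 0 by rewrite subr_eq0.
have := vsol_linear (lam - mu')^-1 (- (lam - mu')^-1) s1 s2.
by apply: vsol_ext => x; field.
Qed.

(* Divided differences in the spectral parameter solve Volterra equations with
   explicit sources, hence decay geometrically, and Newton interpolation gives
   polynomial approximations of y(., pi) without proving it holomorphic. *)
Section Interpolation.
Variable y : C -> R -> C.
Let b0 : R -> C := fun x => 1 * x%:C.
Hypothesis ysol : forall lam, vsol q M0 lam b0 (y lam).
Variables (L : R) (l : nat -> C).
Hypotheses (L0 : 0 < L) (l_inj : injective l) (lL : forall n, cmod (l n) <= L).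

(** Newton's divided difference of y at l 0, ..., l (n - 1), lam for fixed x. It has this meaning
    only for lam off these nodes: the inverse of zero is zero. *)
Fixpoint divided_difference n lam : R -> C :=
  if n is m.+1 then fun x =>
    (lam - l m)^-1 * (divided_difference m lam x - divided_difference m (l m) x)
  else y lam.

Definition dd_source n : R -> C :=
  if n is m.+1 then fun x =>
    - cintegral (I 0 x) (fun t => (x - t)%:C * divided_difference m (l m) t)
  else b0.

Lemma divided_difference_vsol n lam : (forall i, (i < n)%N -> lam != l i) ->
  vsol q M0 lam (dd_source n) (divided_difference n lam).
Proof.
elim: n lam => [|n IH] lam h; first exact: ysol.
apply: vsol_divided_difference; last exact: h.
  by apply: IH => i ilt; apply: h; exact: ltnW.
apply: IH => i ilt; apply/negP => /eqP/l_inj E.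
by move: ilt; rewrite E ltnn.
Qed.

(** The source b0 costs 1 / k by [lag_kernel_bound]. Each further step gains 2 pi / k: a factor 2
    from [vsol_bound] and pi / k from [lag_integral_bound]. *)
Lemma divided_difference_bound (k : R) n lam : 0 < k -> 2 * (total_weight q M0 + L * pi) <= k ->
  cmod lam <= L -> (forall i, (i < n)%N -> lam != l i) ->
  forall x, 0 <= x <= pi ->
    cmod (divided_difference n lam x) <= 2 * (k^-1 * (2 * pi / k) ^+ n) * expR (k * x).
Proof.
move=> k0 hk.
have node n' : forall i, (i < n')%N -> l n' != l i.
  move=> i ilt; apply/negP => /eqP/l_inj E.
  by move: ilt; rewrite E ltnn.
have p0 : 0 <= pi :> R := pi_ge0 R.
have c0 m : 0 <= k^-1 * (2 * pi / k) ^+ m.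
  by rewrite mulr_ge0 ?exprn_ge0 ?divr_ge0 ?invr_ge0 ?(ltW k0)// mulr_ge0.
suff S m : forall x, 0 <= x <= pi -> cmod (dd_source m x) <= (k^-1 * (2 * pi / k) ^+ m) * expR (k * x).
  move=> lamL h x hx.
  exact: (vsol_bound L2q L2M (divided_difference_vsol h) lamL k0 hk (S n)).
elim: m => [|m IH] x hx.
  have -> : dd_source 0 x = x%:C by rewrite /dd_source /b0 mul1r.
  by rewrite expr0 mulr1; apply: lag_kernel_bound => //; case/andP: hx.
rewrite [dd_source _]/= cmodN.
have hs := divided_difference_vsol (node m).
have B2 : 0 <= 2 * (k^-1 * (2 * pi / k) ^+ m) by rewrite mulr_ge0.
have [|_ bd] := lag_integral_bound k0 B2 hx (vsol_cmeas hs).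
  move=> t; rewrite /= in_itv/= => /andP[t0 tpi].
  apply: (vsol_bound L2q L2M hs (lL m) k0 hk IH).
  by rewrite !ltW.
apply: le_trans bd _; rewrite exprS.
set E := expR _; set P := (2 * pi / k) ^+ m.
by rewrite le_eqVlt; apply/orP; left; apply/eqP; ring.
Qed.

Definition newton_poly n : {poly C} :=
  \sum_(j < n) divided_difference j (l j) pi *: \prod_(i < j) ('X - (l i)%:P).

Lemma newton_polyS n lam : (newton_poly n.+1).[lam] = (newton_poly n).[lam] +
  divided_difference n (l n) pi * \prod_(i < n) (lam - l i).
Proof.
rewrite /newton_poly big_ord_recr /= hornerD hornerZ horner_prod.
by congr (_ + _ * _); apply: eq_bigr => i _; rewrite hornerXsubC.
Qed.

Lemma newton_remainder n lam : (forall i, (i < n)%N -> lam != l i) ->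
  y lam pi = (newton_poly n).[lam] +
    divided_difference n lam pi * \prod_(i < n) (lam - l i).
Proof.
elim: n => [|n IH] h; first by rewrite /newton_poly !big_ord0 horner0 add0r mulr1.
rewrite IH; last by move=> i ilt; apply: h; exact: ltnW.
rewrite newton_polyS big_ord_recr /= -addrA; congr (_ + _).
have : lam - l n != 0 by rewrite subr_eq0 h.
by move=> h0; field.
Qed.

Lemma newton_node i n : (i < n)%N -> y (l i) pi = (newton_poly n).[l i].
Proof.
elim: n => // n IH; rewrite ltnS leq_eqVlt => /predU1P[->|ilt].
  rewrite newton_polyS; apply: newton_remainder => j jlt.
  by apply/negP => /eqP/l_inj E; move: jlt; rewrite E ltnn.
rewrite newton_polyS -IH// (bigD1 (Ordinal ilt))//= subrr mul0r mulr0 addr0//.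
Qed.

End Interpolation.

Lemma vsol_poly_approx (y : C -> R -> C) (L : R) : 0 < L ->
  (forall lam, vsol q M0 lam (fun x => 1 * x%:C) (y lam)) ->
  poly_approx (fun lam => y lam pi) L.
Proof.
move=> L0 ysol e e0.
pose l n : C := (L / n.+1%:R)%:C.
have l_inj : injective l.
  move=> m n /complexI /(mulfI (lt0r_neq0 L0))/invr_inj/eqP.
  by rewrite eqr_nat eqSS => /eqP.
have lL n : cmod (l n) <= L.
  rewrite cmod_real ger0_norm ?divr_ge0 ?(ltW L0)//.
  by rewrite ler_pdivrMr ?ltr0n// ler_peMr ?(ltW L0)// ler1n.
have p0 : 0 < pi :> R := pi_gt0 R.
have W0 := total_weight_ge0 q M0.
(* The first summand is what [vsol_bound] asks for; the second makes the ratio (2 pi / k) (2 L) of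
   the remainder at most 1/2, as each factor lam - l i is at most 2 L. *)
pose k := 2 * (total_weight q M0 + L * pi) + 8 * pi * L.
have Lp : 0 < L * pi by rewrite mulr_gt0.
have k0 : 0 < k by rewrite /k; lra.
have hk : 2 * (total_weight q M0 + L * pi) <= k by rewrite /k; lra.
pose M := 2 * k^-1 * expR (k * pi).
have M0' : 0 < M by rewrite mulr_gt0 ?expR_gt0// mulr_gt0 ?invr_gt0.
have h2 : 0 <= (2^-1 : R) < 1 by rewrite invr_ge0 ler0n invf_lt1 ?ltr1n.
have [|n n0 hn] := @exprn_small R _ (e / M) h2; first by rewrite divr_gt0.
exists (newton_poly y l n) => lam lamL.
have [[i ilt ->]|ne] := pselect (exists2 i, (i < n)%N & lam = l i).
  by rewrite -(newton_node y l_inj ilt) subrr cmod0 ltW.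
have {}ne i : (i < n)%N -> lam != l i.
  by move=> ilt; apply/negP => /eqP E; apply: ne; exists i.
rewrite (newton_remainder y ne) opprD addNKr cmodN cmodM.
have hpi : 0 <= (pi : R) <= pi by rewrite pi_ge0 lexx.
have h3 := divided_difference_bound ysol l_inj lL k0 hk lamL ne hpi.
have h4 : cmod (\prod_(i < n) (lam - l i)) <= (2 * L) ^+ n.
  rewrite -[n in leRHS]card_ord -prodr_const.
  elim/big_ind2 : _ => [|a b c d h1 h3'|i _].
  - by rewrite cmod1.
  - by rewrite cmodM ler_pM ?cmod_ge0.
  - by apply: le_trans (cmodB _ _) _; have := lL i; lra.
apply: (@le_trans _ _ (2 * (k^-1 * (2 * pi / k) ^+ n) * expR (k * pi) * (2 * L) ^+ n)).
  by rewrite ler_pM ?cmod_ge0.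
have -> : 2 * (k^-1 * (2 * pi / k) ^+ n) * expR (k * pi) * (2 * L) ^+ n =
   M * (2 * pi / k * (2 * L)) ^+ n by rewrite [in RHS]exprMn /M; ring.
have h5 : 2 * pi / k * (2 * L) <= 2^-1.
  rewrite mulrAC ler_pdivrMr// /k; lra.
have h6 : 0 <= 2 * pi / k * (2 * L) by rewrite !mulr_ge0 ?invr_ge0 ?(ltW k0) ?(ltW p0) ?(ltW L0).
apply: (@le_trans _ _ (M * (2^-1) ^+ n)).
  by apply: ler_wpM2l; [exact: ltW|apply: lerXn2r => //; rewrite nnegrE ?invr_ge0].
by rewrite mulrC -ler_pdivlMr.
Qed.

End Newton.

(** * The unperturbed problem *)

Section SineBounds.
Variable R : realType.
Local Notation C := R[i].
Implicit Types (x t : R) (z w rho : C).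

Lemma pi_lt4 : pi < 4 :> R.
Proof. by have := @pihalf_lt2 R; rewrite ltr_pdivrMr//; lra. Qed.

Lemma sin_MVT x : 0 <= x -> exists2 t, 0 <= t <= x & sin x = cos t * x.
Proof.
move=> x0; have [|c hc] := @MVT_segment R (@sin R) (@cos R) 0 x x0.
- by apply: continuous_subspaceT; exact: continuous_sin.
- by rewrite sin0 !subr0 => ->; exists c => //; move: hc; rewrite in_itv.
Qed.

Lemma normr_sin_le x : `|sin x| <= `|x|.
Proof.
wlog x0 : x / 0 <= x.
  move=> h; have [/h//|x0] := leP 0 x.
  by rewrite -normrN -sinN -[leRHS]normrN; apply: h; lra.
have [t _ ->] := sin_MVT x0.
by rewrite normrM ler_piMl// cos_max.
Qed.

Lemma cos_ge x : 1 - x ^+ 2 / 2 <= cos x.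
Proof.
have -> : cos x = 1 - 2 * sin (x / 2) ^+ 2.
  have h := cos2Dsin2 (x / 2).
  have -> : cos x = cos (x / 2 + x / 2) by rewrite -splitr.
  by rewrite cosD; lra.
have := normr_sin_le (x / 2).
rewrite -ler_sqr ?nnegrE// !real_normK ?num_real// => h.
have -> : x ^+ 2 / 2 = 2 * (x / 2) ^+ 2 by field.
by lra.
Qed.

Lemma sin_ge x : 0 <= x -> (1 - x ^+ 2 / 2) * x <= sin x.
Proof.
move=> x0; have [t /andP[t0 tx] ->] := sin_MVT x0.
by rewrite ler_wpM2r//; apply: le_trans (cos_ge t); nra.
Qed.

(** The argument is halved because the polynomial bounds for sine and cosine are effective up to 1,
    and x / 2 < 1 follows from pi / 2 < 2. *)
Lemma normr_sin_ge x : `|x| <= pi / 2 -> `|x| / 4 <= `|sin x|.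
Proof.
wlog x0 : x / 0 <= x.
  move=> h; have [/h//|x0] := leP 0 x.
  by rewrite -normrN -(normrN (sin _)) -sinN; apply: h; lra.
rewrite ger0_norm// => xpi; have p2 := @pihalf_lt2 R.
apply: le_trans (ler_norm _).
have -> : sin x = 2 * (sin (x / 2) * cos (x / 2)).
  have -> : sin x = sin (x / 2 + x / 2) by rewrite -splitr.
  by rewrite sinD; ring.
have y0 : 0 <= x / 2 by lra.
have := sin_ge y0; have := cos_ge (x / 2).
have y1 : x / 2 <= 1 by lra.
set y := x / 2 in y0 y1 *; move=> h1 h2.
have -> : x / 4 = y / 2 by rewrite /y; lra.
have h3 : 2^-1 <= 1 - y ^+ 2 / 2 by nra.
have h4 : 2^-1 * y <= sin y by nra.
nra.
Qed.

Lemma sqr_cmod_exp_sine rho x :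
  cmod (exp_sine rho x) ^+ 2 =
  (expR (complex.Im rho * x) - expR (- (complex.Im rho * x))) ^+ 2 +
  4 * sin (complex.Re rho * x) ^+ 2.
Proof.
have e1 : 'i * rho * x%:C = (- (complex.Im rho * x)) +i* (complex.Re rho * x).
  by case: rho => u v; simpc.
move: e1; set a := complex.Re rho; set b := complex.Im rho => e1.
have e2 : - ('i * rho) * x%:C = (b * x) +i* (- (a * x)).
  by rewrite mulNr e1; simpc.
rewrite sqr_cmod /exp_sine e1 e2 ReD ImD ReN ImN !Re_cexp !Im_cexp /= cosN sinN.
have h1 : expR (- (b * x)) * expR (b * x) = 1 by rewrite -expRD addNr expR0.
have h2 := cos2Dsin2 (a * x).
have -> : 4 * sin (a * x) ^+ 2 = 4 * (expR (- (b * x)) * expR (b * x)) * sin (a * x) ^+ 2.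
  by rewrite h1 mulr1.
set s := sin _ in h2 *; set c := cos _ in h2 *; set E := expR _; set E' := expR _.
have -> : (E * c - E' * c) ^+ 2 = (E - E') ^+ 2 * (1 - s ^+ 2) by rewrite -h2; ring.
ring.
Qed.

Lemma nearest_int x : exists j : int, `|x - j%:~R| <= 2^-1.
Proof.
exists (Num.floor (x + 2^-1)); have := real_floor_itv (num_real (x + 2^-1)).
rewrite intrD => /andP[h1 h2]; rewrite ler_norml; apply/andP; split; lra.
Qed.

Lemma sin_shift_int x (j : int) : `|sin (x + pi * j%:~R)| = `|sin x|.
Proof.
have nat n y : `|sin (y + pi * n%:R)| = `|sin y| :> R.
  elim: n => [|n IH]; first by rewrite mulr0 addr0.
  by rewrite -natr1 mulrDr mulr1 addrA sinDpi normrN IH.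
case: j => n; first exact: nat.
rewrite NegzE intrN mulrN -[in RHS](subrK (pi * n.+1%:R) x) nat//.
Qed.

(** Take j nearest to Re rho and T = |Im rho|. By [sqr_cmod_exp_sine] the squared modulus splits
    into a hyperbolic and a trigonometric part: for T >= 1 the first suffices, for T < 1 the two
    together dominate |rho - j|^2. *)
Lemma exp_sine_lower : exists2 c : R, 0 < c <= 1 & forall rho : C, exists j : int,
  c * expR (pi * `|complex.Im rho|) * Num.min 1 (cmod (rho - j%:~R)) <= cmod (exp_sine rho pi).
Proof.
have p0 : 0 < pi :> R := pi_gt0 R.
(* Because pi < 4, this constant cancels exp(pi T) for T <= 1; it is also at most 1/2, which serves
   T >= 1. *)
exists (expR (-4)).
  by rewrite expR_gt0 -[leRHS]expR0 ler_expR; lra.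
move=> rho; have [j hj] := nearest_int (complex.Re rho); exists j.
set s := complex.Re rho - j%:~R in hj; set T := `|complex.Im rho|.
have T0 : 0 <= T by exact: normr_ge0.
have E1 := expR_ge1Dx (pi * T).
set E := expR (pi * T) in E1 *.
have E0 : 0 < E by exact: expR_gt0.
have EV : expR (- (pi * T)) = E^-1 by rewrite expRN.
have sq : (E - E^-1) ^+ 2 + 4 * sin (pi * s) ^+ 2 = cmod (exp_sine rho pi) ^+ 2.
  rewrite sqr_cmod_exp_sine; congr (_ + _); last first.
    have e : `|sin (pi * s)| = `|sin (complex.Re rho * pi)|.
      by rewrite -(sin_shift_int (pi * s) j) -mulrDr /s subrK mulrC.
    congr (_ * _).
    by rewrite -[LHS]real_normK ?num_real// -[RHS]real_normK ?num_real// e.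
  rewrite -EV /E /T; have [h|h] := ger0P (complex.Im rho); first by rewrite ![_ * pi]mulrC.
  by rewrite -sqrrN opprB ![_ * pi]mulrC mulrN opprK.
have ps : `|pi * s| <= pi / 2 by rewrite normrM gtr0_norm// ler_wpM2l ?(ltW p0).
have sn := normr_sin_ge ps; rewrite normrM gtr0_norm// in sn.
have cd : cmod (rho - j%:~R) ^+ 2 = `|s| ^+ 2 + T ^+ 2.
  rewrite sqr_cmod ReD ImD ReN ImN real_normK ?num_real// real_normK ?num_real//.
  have -> : complex.Re (j%:~R : C) = j%:~R.
    by rewrite -(rmorph_int (real_complex R)).
  have -> : complex.Im (j%:~R : C) = 0.
    by rewrite -(rmorph_int (real_complex R)).
  by rewrite subr0.
set d := cmod (rho - j%:~R) in cd *.
have d0 : 0 <= d by exact: cmod_ge0.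
rewrite -(@ler_pXn2r _ 2)// ?nnegrE ?cmod_ge0//; last first.
  by rewrite mulr_ge0// ?mulr_ge0 ?expR_ge0// ?(ltW E0)// le_min ler01.
rewrite -sq.
have p2 : 2 <= (pi : R) by exact: pi_ge2.
have p4 : (pi : R) < 4 by exact: pi_lt4.
have EVle : E^-1 <= 1 by rewrite invf_le1//; nra.
have EV0 : 0 < E^-1 by rewrite invr_gt0.
have [T1|T1] := leP 1 T.
  have e3 : 3 <= E by nra.
  have h1 : E / 2 <= E - E^-1 by lra.
  have c1 : expR (-4) <= 2^-1 :> R.
    rewrite expRN lef_pV2 ?posrE ?expR_gt0//; apply: le_trans (expR_ge1Dx _); lra.
  have m1 : Num.min 1 d <= 1 by rewrite ge_min lexx.
  have m0 : 0 <= Num.min 1 d by rewrite le_min ler01.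
  have h2 : expR (-4) * E * Num.min 1 d <= E / 2.
    have : expR (-4) * E <= 2^-1 * E by rewrite ler_wpM2r// ltW.
    have e4 : 0 <= expR (-4) * E by rewrite mulr_ge0 ?expR_ge0// ltW.
    nra.
  have h3 : 0 <= expR (-4) * E * Num.min 1 d by rewrite !mulr_ge0 ?expR_ge0 ?(ltW E0).
  have := sqr_ge0 (sin (pi * s)); nra.
have cE : expR (-4) * E <= 1.
  by rewrite -expRD -[leRHS]expR0 ler_expR; nra.
have cE0 : 0 <= expR (-4) * E by rewrite mulr_ge0 ?expR_ge0// ltW.
have m1 : Num.min 1 d <= d by rewrite ge_min lexx orbT.
have m0 : 0 <= Num.min 1 d by rewrite le_min ler01.
have h1 : (expR (-4) * E * Num.min 1 d) ^+ 2 <= d ^+ 2.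
  have g0 : 0 <= expR (-4) * E * Num.min 1 d by exact: mulr_ge0.
  rewrite ler_sqr ?nnegrE//.
  by apply: le_trans m1; rewrite ler_piMl.
apply: (le_trans h1); rewrite cd.
have h2 : pi * T <= E - E^-1 by lra.
have h3 : (pi * T) ^+ 2 <= (E - E^-1) ^+ 2.
  have h0 : 0 <= pi * T by rewrite mulr_ge0// ltW.
  by rewrite ler_sqr ?nnegrE//; lra.
have h4 : (pi * `|s| / 4) ^+ 2 <= sin (pi * s) ^+ 2.
  rewrite -(real_normK (num_real (sin _))) ler_sqr ?nnegrE//.
  by rewrite divr_ge0// mulr_ge0// ltW.
have h5 : 4 <= (pi : R) ^+ 2 by nra.
have h6 := sqr_ge0 `|s|; have h7 := sqr_ge0 T.
have h8 := ler_wpM2r h6 h5; have h9 := ler_wpM2r h7 h5.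
have h10 : (pi * `|s| / 4) ^+ 2 = pi ^+ 2 * `|s| ^+ 2 / 16 by field.
move: h3 h4; rewrite h10 exprMn; lra.
Qed.

End SineBounds.

(** * The sine as solution for zero coefficients *)

Section FreeProblem.
Variable R : realType.
Local Notation C := R[i].
Local Notation mu := (@lebesgue_measure R).
Local Notation I a b := (`]a%R, b%R[%classic : set R).
Implicit Types (x t X : R) (z w rho lam k : C) (u y : R -> C).

Lemma cexp_ipi : cexp ('i * (pi : R)%:C) = -1.
Proof.
have -> : 'i * (pi : R)%:C = 0 +i* pi by simpc.
rewrite /cexp [complex.Re _]/= [complex.Im _]/= expR0 cospi sinpi.
by apply: complexP; rewrite /= !(mul0r, mul1r, mulr0, subr0, addr0, oppr0).
Qed.

Lemma exp_sineD1 z : exp_sine (z + 1) pi = - exp_sine z pi.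
Proof.
rewrite /exp_sine.
have -> : 'i * (z + 1) * (pi : R)%:C = 'i * z * pi%:C + 'i * pi%:C by ring.
have -> : - ('i * (z + 1)) * (pi : R)%:C = - ('i * z) * pi%:C - 'i * pi%:C by ring.
rewrite !cexpD cexp_ipi.
have -> : cexp (- ('i * (pi : R)%:C)) = -1.
  by have := cexpN_mul ('i * (pi : R)%:C); rewrite cexp_ipi mulrN1 => /eqP; rewrite eqr_oppLR => /eqP.
ring.
Qed.

Lemma exp_sineDn z n : exp_sine (z + n%:R) pi = (-1) ^+ n * exp_sine z pi.
Proof.
elim: n => [|n IH]; first by rewrite addr0 expr0 mul1r.
by rewrite -natr1 addrA exp_sineD1 IH exprS mulN1r mulNr.
Qed.

Lemma exp_sine_near0 z : cmod (exp_sine z pi - 2 * 'i * pi%:C * z) <=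
  2 * (pi * cmod z) ^+ 2 * expR (pi * cmod z).
Proof.
pose w : C := 'i * z * pi%:C.
have cw : cmod w = pi * cmod z.
  rewrite !cmodM cmod_real [cmod 'i]/= expr0n expr1n add0r sqrtr1 mul1r mulrC.
  by rewrite ger0_norm// pi_ge0.
have -> : exp_sine z pi - 2 * 'i * pi%:C * z = (cexp w - 1 - w) - (cexp (- w) - 1 - - w).
  by rewrite /exp_sine /w mulNr; ring.
apply: le_trans (cmodB _ _) _.
have := cmod_cexpB1B w; have := cmod_cexpB1B (- w); rewrite cmodN cw; lra.
Qed.

Lemma exp_sineN rho x : exp_sine (- rho) x = - exp_sine rho x.
Proof. by rewrite /exp_sine mulrN opprK opprB. Qed.

(* sin(rho x) / rho, extended by its limit x at rho = 0. *)
Definition sine_kernel rho x : C :=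
  if rho == 0 then x%:C else exp_sine rho x / (2 * 'i * rho).

Lemma two_i_neq0 : 2 * 'i != 0 :> C.
Proof. by rewrite -cmod_gt0 cmodM cmod_nat [cmod 'i]/= expr0n expr1n add0r sqrtr1 mulr1. Qed.

Lemma primitive_ac y u : primitive pi u y -> ac_deriv y u.
Proof. by move=> [ui h]; split => // x; rewrite in_itv/=; exact: h. Qed.

(** Makes the Newton approximation available for the unperturbed determinant as well. *)
Lemma sine_kernel_vsol rho : vsol (fun=> 0) (fun=> 0) (rho ^+ 2) (fun x => 1 * x%:C) (sine_kernel rho).
Proof.
(* c is cos(rho x), the derivative of the kernel, and d is the derivative of c. *)
pose c (x : R) : C := if rho == 0 then 1 else (cexp ('i * rho * x%:C) + cexp (- ('i * rho) * x%:C)) / 2.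
pose d (x : R) : C := - rho ^+ 2 * sine_kernel rho x.
have c0 : c 0 = 1.
  by rewrite /c; case: ifP => // _; rewrite !mulr0 cexp0; field.
have s0 : sine_kernel rho 0 = 0.
  by rewrite /sine_kernel /exp_sine !mulr0 subrr mul0r; case: ifP.
have p0 : 0 <= pi :> R := pi_ge0 R.
have i2 : 'i * 'i = -1 :> C by have := @sqr_i R; rewrite expr2.
have [P1 P2] : primitive pi c (sine_kernel rho) /\ primitive pi d c.
  rewrite /c /d /sine_kernel; have [r0|r0] := eqVneq rho 0.
    have E0 : (fun x : R => - rho ^+ 2 * x%:C) = (fun=> 0 : C).
      by apply/funext => x; rewrite r0 expr0n oppr0 mul0r.
    rewrite E0; split; (split; first by split; exact: integrable_itv_cst).
      move=> x /andP[x0 _]; apply: complexP; rewrite ?ReD ?ImD /= Rintegral_itv_cst//; ring.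
    move=> x /andP[x0 _]; apply: complexP; rewrite ?ReD ?ImD /= Rintegral_itv_cst//; ring.
  pose al : C := 'i * rho.
  have q1 := cexp_primitive al p0; have q2 := cexp_primitive (- al) p0.
  have r2 : 2 != 0 :> C by rewrite -cmod_gt0 cmod_nat.
  have ineq : 'i != 0 :> C by have := two_i_neq0; rewrite mulf_eq0 negb_or => /andP[].
  have al2 : al * al = - rho ^+ 2 by rewrite /al -expr2 exprMn sqr_i mulN1r.
  split.
    have := primitive_linear (2 * 'i * rho)^-1 (- (2 * 'i * rho)^-1) q1 q2.
    set u := (X in primitive _ X _); set y := (X in primitive _ _ X).
    have -> : u = (fun x : R => (cexp ('i * rho * x%:C) + cexp (- ('i * rho) * x%:C)) / 2).
      by apply/funext => x; rewrite /u /al; field; rewrite ?ineq ?r0.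
    have -> // : y = (fun x : R => exp_sine rho x / (2 * 'i * rho)).
    by apply/funext => x; rewrite /y /exp_sine /al; ring.
  have := primitive_linear 2^-1 2^-1 q1 q2.
  set u := (X in primitive _ X _); set y := (X in primitive _ _ X).
  have -> : u = (fun x : R => - rho ^+ 2 * (exp_sine rho x / (2 * 'i * rho))).
    by apply/funext => x; rewrite /u /exp_sine -al2 /al; field; rewrite ?ineq ?r0.
  have -> // : y = (fun x : R => (cexp ('i * rho * x%:C) + cexp (- ('i * rho) * x%:C)) / 2).
  by apply/funext => x; rewrite /y /al; ring.
have sol : is_solution (fun=> 0) (fun=> 0) (rho ^+ 2) (sine_kernel rho) c.
  split; first exact: primitive_ac.
  exists d; first exact: primitive_ac.
  apply: aeW => x _; rewrite mul0r addr0 /d mulNr opprK.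
  have -> : cintegral `]0, x[ (fun t : R => M_of (fun=> 0) (x - t) * sine_kernel rho t) = 0.
    rewrite (@eq_cintegral _ _ _ (fun=> 0)); last by move=> t _; rewrite /M_of mulr0 mul0r.
    by apply: complexP => /=; rewrite /Rintegral integral0.
  by rewrite addr0.
by have := solution_vsol sol s0; rewrite c0.
Qed.

End FreeProblem.

(** * Zeros of the unperturbed determinant *)

Section FreeEigenvalues.
Variable R : realType.
Local Notation C := R[i].
Implicit Types (x t : R) (z w rho lam : C).

Lemma L2_zero : L2 (fun=> 0 : C).
Proof.
split; [exact: measurable_cst|exact: measurable_cst|].
by rewrite /= !expr0n addr0 sqrtr0 expr0n; exact: integrable_itv_cst.
Qed.

Lemma sine_kernelN rho x : sine_kernel (- rho) x = sine_kernel rho x.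
Proof.
rewrite /sine_kernel oppr_eq0; case: eqVneq => // r0.
by rewrite exp_sineN mulrN invrN mulrNN.
Qed.

Definition free_det w : C := sine_kernel (sqrtC w) pi.

Lemma free_detE rho : free_det (rho ^+ 2) = sine_kernel rho pi.
Proof.
rewrite /free_det; have /eqP := sqrtCK (rho ^+ 2); rewrite eqf_sqr.
by case/orP => /eqP ->; rewrite ?sine_kernelN.
Qed.

Lemma free_det_poly_approx (L : R) : 0 < L -> poly_approx free_det L.
Proof.
move=> L0; apply: (vsol_poly_approx L2_zero L2_zero (y := fun lam => sine_kernel (sqrtC lam)) L0).
by move=> lam; have := sine_kernel_vsol (sqrtC lam); rewrite sqrtCK.
Qed.

Lemma sqrt_right_half w : exists2 rho, rho ^+ 2 = w & 0 <= complex.Re rho.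
Proof.
have [h|h] := leP 0 (complex.Re (sqrtC w)); first by exists (sqrtC w); rewrite ?sqrtCK.
by exists (- sqrtC w); rewrite ?sqrrN ?sqrtCK// ReN; lra.
Qed.

Lemma cmod_ge_Re z x : x <= complex.Re z -> x <= cmod z.
Proof. by move=> h; apply: le_trans h (le_trans (ler_norm _) (Re_le_cmod _)). Qed.

Lemma cmod_i : cmod ('i : C) = 1.
Proof. by rewrite /= expr0n expr1n add0r sqrtr1. Qed.

Lemma Re_nat n : complex.Re (n%:R : C) = n%:R.
Proof. by rewrite -(rmorph_nat (real_complex R)). Qed.

(** Write w = rho^2 with Re rho >= 0 and z = rho - k. Then w - k^2 = z (rho + k) and the determinant
    is (-1)^k sin(pi z) / rho, so everything expands in z, with |z| <= |w - k^2|. *)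
Lemma free_det_order k : (0 < k)%N -> order_at free_det (k%:R ^+ 2) 1.
Proof.
move=> k0; have k1 : 1 <= k%:R :> R by rewrite ler1n.
have kC : k%:R != 0 :> C by rewrite pnatr_eq0 -lt0n.
have p0 : 0 < pi :> R := pi_gt0 R; have p4 : pi < 4 :> R := pi_lt4 R.
have pC : (pi : R)%:C != 0 by rewrite -cmod_gt0 cmod_real gtr0_norm.
(* The derivative of sin(pi sqrt w) / sqrt w at w = k^2. *)
exists ((-1) ^+ k * (pi%:C / (2 * k%:R ^+ 2))).
  by rewrite mulf_neq0 ?signr_eq0// mulf_neq0// invr_neq0// mulf_neq0 ?expf_neq0// -cmod_gt0 cmod_nat.
(* Coefficient of |z|^2: 32 exp(2) from the Taylor remainder of the sine, 10 from replacing 1 / rho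
   by (rho + k) / (2 k^2). *)
move=> e e0; pose A : R := 32 * expR 2 + 10.
have A0 : 0 < A by have := expR_gt0 (2 : R); rewrite /A; lra.
exists (Num.min 2^-1 (e / A)); first by rewrite lt_min divr_gt0 ?invr_gt0 ?ltr0n.
move=> w; rewrite lt_min => /andP[w1 w2].
have [rho rw rR] := sqrt_right_half w.
pose z := rho - k%:R.
have rk : k%:R <= cmod (rho + k%:R).
  by apply: cmod_ge_Re; rewrite ReD Re_nat; lra.
have wz : w - k%:R ^+ 2 = z * (rho + k%:R) by rewrite -rw /z; ring.
have zw : cmod z <= cmod (w - k%:R ^+ 2).
  rewrite wz cmodM ler_peMr ?cmod_ge0//; lra.
have z2 : cmod z <= 2^-1 by lra.
have rE : rho = z + k%:R by rewrite /z subrK.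
have r1 : k%:R - 2^-1 <= cmod rho.
  have := cmod_lerB (k%:R : C) (- z); rewrite cmodN cmod_nat.
  have -> : k%:R - - z = rho by rewrite /z; ring.
  lra.
have r0 : 0 < cmod rho by lra.
have rn : rho != 0 by rewrite -cmod_gt0.
set r := exp_sine z pi - 2 * 'i * pi%:C * z.
have hr : cmod r <= 32 * expR 2 * cmod z ^+ 2.
  apply: le_trans (exp_sine_near0 z) _.
  have c0 := cmod_ge0 z.
  have pz : pi * cmod z <= 2 by nra.
  have h1 : expR (pi * cmod z) <= expR 2 by rewrite ler_expR.
  have h2 : (pi * cmod z) ^+ 2 <= 16 * cmod z ^+ 2.
    rewrite exprMn ler_wpM2r ?sqr_ge0//; nra.
  have h3 : 0 <= (pi * cmod z) ^+ 2 by exact: sqr_ge0.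
  have h4 := expR_ge0 (pi * cmod z).
  apply: (@le_trans _ _ (2 * (16 * cmod z ^+ 2) * expR 2)); last by lra.
  by apply: ler_pM => //; [rewrite mulr_ge0|rewrite ler_wpM2l].
have i0 : 'i != 0 :> C by rewrite -cmod_gt0 cmod_i.
have -> : free_det w - (-1) ^+ k * (pi%:C / (2 * k%:R ^+ 2)) * (w - k%:R ^+ 2) ^+ 1 =
   (-1) ^+ k * (r / (2 * 'i * rho) - pi%:C * z ^+ 2 * (rho + 2 * k%:R) / (2 * k%:R ^+ 2 * rho)).
  rewrite -rw free_detE /sine_kernel (negbTE rn) [in exp_sine _ _]rE exp_sineDn.
  have -> : exp_sine z pi = r + 2 * 'i * pi%:C * z by rewrite /r subrK.
  rewrite /z; field.
  by rewrite ?kC ?i0 ?rn.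
rewrite cmodM cmodX cmodN cmod1 expr1n mul1r expr1.
have b1 : cmod (r / (2 * 'i * rho)) <= 32 * expR 2 * cmod z ^+ 2.
  rewrite cmodM cmodV !cmodM cmod_i cmod_nat mulr1; apply: le_trans hr.
  rewrite ler_pdivrMr; last by lra.
  by rewrite ler_peMr ?cmod_ge0//; lra.
have b2 : cmod (pi%:C * z ^+ 2 * (rho + 2 * k%:R) / (2 * k%:R ^+ 2 * rho)) <= 10 * cmod z ^+ 2.
  rewrite cmodM cmodV !cmodM cmod_real !cmod_nat (gtr0_norm p0) -!expr2.
  have d0 : 0 < 2 * k%:R ^+ 2 * cmod rho by rewrite mulr_gt0// mulr_gt0// exprn_gt0//; lra.
  rewrite ler_pdivrMr//.
  have h1 : cmod (rho + 2 * k%:R) <= 5 * cmod rho.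
    by apply: le_trans (cmodD _ _) _; rewrite cmodM !cmod_nat; lra.
  have h2 := sqr_ge0 (cmod z).
  have h3 : pi * cmod z ^+ 2 <= 4 * cmod z ^+ 2 by rewrite ler_wpM2r// ltW.
  have h4 : 1 <= k%:R ^+ 2 :> R by rewrite exprn_ege1.
  apply: (@le_trans _ _ (4 * cmod z ^+ 2 * (5 * cmod rho))).
    by rewrite ler_pM ?cmod_ge0// mulr_ge0// ltW.
  have h5 : cmod z ^+ 2 * cmod rho * 1 <= cmod z ^+ 2 * cmod rho * k%:R ^+ 2.
    by rewrite ler_wpM2l// mulr_ge0// ltW.
  lra.
apply: le_trans (cmodB _ _) _; apply: (@le_trans _ _ (A * cmod z ^+ 2)).
  by rewrite /A; lra.
have h6 : cmod z ^+ 2 <= cmod (w - k%:R ^+ 2) ^+ 2 by rewrite ler_sqr ?nnegrE ?cmod_ge0.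
apply: (@le_trans _ _ (A * cmod (w - k%:R ^+ 2) ^+ 2)); first by rewrite ler_wpM2l// ltW.
rewrite expr2 mulrA ler_wpM2r ?cmod_ge0//.
by move: w2; rewrite ltr_pdivlMr// mulrC => /ltW.
Qed.

(** At a zero, [exp_sine_lower] leaves no choice but rho = j for an integer j; j = 0 is excluded
    since the value there is pi. *)
Lemma free_det_zero n w : free_det w = 0 -> cmod w <= (n%:R + 2^-1) ^+ 2 ->
  exists2 k, (0 < k <= n)%N & w = k%:R ^+ 2.
Proof.
set rho := sqrtC w; have rw : rho ^+ 2 = w by rewrite sqrtCK.
rewrite -rw free_detE /sine_kernel.
have p0 : 0 < pi :> R := pi_gt0 R.
have [r0|r0] := eqVneq rho 0.
  by move=> /complexI h; move: p0; rewrite h ltxx.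
move=> /eqP; rewrite mulf_eq0 invr_eq0 mulf_eq0 (negbTE r0) (negbTE (two_i_neq0 R)) !orbF => /eqP E.
have [c /andP[c0 _] hc] := exp_sine_lower R; have [j] := hc rho.
rewrite E cmod0 => hj.
have m0 : cmod (rho - j%:~R) = 0.
  have cE : 0 < c * expR (pi * `|complex.Im rho|) by rewrite mulr_gt0// expR_gt0.
  move: hj; rewrite pmulr_rle0// ge_min => /orP[|]; first by rewrite leNgt ltr01.
  by move=> h; apply/eqP; rewrite eq_le h cmod_ge0.
have {m0} rj : rho = j%:~R by apply/eqP; rewrite -subr_eq0 -cmod_eq0 m0.
rewrite cmodX ler_sqr ?nnegrE ?cmod_ge0 ?addr_ge0 ?invr_ge0 ?ler0n//.
have jE : rho ^+ 2 = `|j|%N%:R ^+ 2 /\ cmod rho = `|j|%N%:R.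
  rewrite rj; case: j {hj rj} => m; first by rewrite -pmulrn cmod_nat.
  by rewrite NegzE intrN sqrrN cmodN -pmulrn cmod_nat.
case: jE => jE cE; rewrite cE => le.
exists `|j|%N => //.
have j0 : (0 < `|j|)%N by rewrite absz_gt0; apply: contra r0 => /eqP j0; rewrite rj j0.
rewrite j0/= -ltnS -(ltr_nat R) -natr1; lra.
Qed.

End FreeEigenvalues.

(** * Eigenvalues *)

Section Determinant.
Variable R : realType.
Local Notation C := R[i].
Local Notation mu := (@lebesgue_measure R).
Local Notation I a b := (`]a%R, b%R[%classic : set R).
Implicit Types (x t : R) (z w rho lam : C).

(** Radii in the topology of [R[i]^o] are positive elements of [R[i]], hence real; the real part
    recovers the radius. *)
Lemma near_complex (P : C -> Prop) z : (\forall w \near (z : R[i]^o), P w) ->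
  exists2 d : R, 0 < d & forall w, cmod (w - z) < d -> P w.
Proof.
move=> /nbhs_ballP[e /= e0 he]; exists (complex.Re e).
  by move: e0; rewrite ltcE => /andP[].
move=> w wz; apply: he; rewrite /ball/= cmod_norm cmodC ltcE /=.
by move: e0; rewrite ltcE => /andP[-> _].
Qed.

Lemma zero_order_order_at (D : C -> C) z m : zero_order D z m -> order_at D z m.
Proof.
move=> [g [dg gz Dg]]; exists (g z) => // e e0.
have cg : {for z, continuous g}.
  apply: differentiable_continuous; apply/derivable1_diffP.
  exact: (nbhs_singleton dg).
have eC : 0 < e%:C :> C by rewrite ltcE /= eqxx.
have [d1 d10 h1] := near_complex (@cvgr_dist_lt _ _ _ _ _ g (g z) cg _ eC).
have [d2 d20 h2] := near_complex Dg.
exists (Num.min d1 d2); first by rewrite lt_min d10.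
move=> w; rewrite lt_min => /andP[w1 w2]; rewrite h2//.
have -> : (w - z) ^+ m * g w - g z * (w - z) ^+ m = (g w - g z) * (w - z) ^+ m by ring.
rewrite cmodM cmodX ler_wpM2r ?exprn_ge0 ?cmod_ge0//.
have := h1 w w1; rewrite cmod_norm ltcE /= => /andP[_ /ltW].
by rewrite -[X in X <= _ -> _]/(cmod (g z - g w)) cmodC.
Qed.

Lemma order_at_zero_pos (D : C -> C) z m : order_at D z m -> D z = 0 -> (0 < m)%N.
Proof.
move=> [g g0 h] Dz; case: m h => // h.
have [|d d0 /(_ z)] := h (cmod g / 2); first by rewrite divr_gt0// cmod_gt0.
rewrite subrr cmod0 => /(_ d0); rewrite Dz !expr0 mulr1 sub0r cmodN.
have := g0; rewrite -cmod_gt0; lra.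
Qed.

Variables q M0 : R -> C.
Hypotheses (L2q : L2 q) (L2M : L2 M0).
Variable S : R -> C -> C.
Hypothesis isS : is_S q M0 S.

Definition det w := S pi (sqrtC w).

Lemma S_solution rho : exists u, [/\ is_solution q M0 (rho ^+ 2) (S ^~ rho) u, S 0 rho = 0,
  u 0 = 1 & vsol q M0 (rho ^+ 2) (fun x => 1 * x%:C) (S ^~ rho)].
Proof.
have [u [sol s0 u0]] := isS rho; exists u; split => //.
by have := solution_vsol sol s0; rewrite u0.
Qed.

(** Uniqueness: [vsol_bound] with source bound 0. *)
Lemma vsol_null lam y : vsol q M0 lam (fun=> 0) y -> forall x, 0 <= x <= pi -> y x = 0.
Proof.
move=> hy x hx; apply/eqP; rewrite -cmod_eq0.
have p0 : 0 < pi :> R := pi_gt0 R.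
have W0 := total_weight_ge0 q M0; have l0 := cmod_ge0 lam.
pose k := 2 * (total_weight q M0 + cmod lam * pi) + 1.
have lp : 0 <= cmod lam * pi by rewrite mulr_ge0// ltW.
have k0 : 0 < k by rewrite /k; lra.
have hk : 2 * (total_weight q M0 + cmod lam * pi) <= k by rewrite /k; lra.
have := @vsol_bound R q M0 L2q L2M lam (fun=> 0) y (cmod lam) k 0 hy (lexx _) k0 hk.
rewrite eq_le cmod_ge0 andbT.
move=> /(_ _ x hx); rewrite mulr0 mul0r; apply => t _.
by rewrite cmod0 mul0r.
Qed.

(** Only non-triviality is at stake. If S vanished on [0, pi], the forcing would vanish almost
    everywhere and the integral equation at pi would read 0 = pi. *)
Lemma det_eq0_eigenvalue z : det z = 0 -> dirichlet_eigenvalue q M0 z.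
Proof.
move=> Dz; have [u [sol s0 u0 vs]] := S_solution (sqrtC z).
rewrite sqrtCK in sol vs.
exists (S ^~ (sqrtC z)), u; split => //.
have [[x hx nz]|nz] := pselect (exists2 x : R, x \in `[0, pi] & S x (sqrtC z) != 0); first by exists x.
have y0 x : 0 <= x <= pi -> S x (sqrtC z) = 0.
  move=> hx; apply/eqP/negPn/negP => h; by apply: nz; exists x.
have p0 : 0 < pi :> R := pi_gt0 R.
have hpi : 0 <= (pi : R) <= pi by rewrite pi_ge0 lexx.
have my := vsol_cmeas vs; have [_ [F fF e]] := vs.
have yV t : I 0 pi t -> cmod (S t (sqrtC z)) <= 0 * expR (0 * t).
  by rewrite /= in_itv/= => /andP[t0 t1]; rewrite y0 ?cmod0 ?mul0r// !ltW.
have := forcing_bound L2M fF my (lexx 0) (lexx 0) yV => aeF.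
have [|i1] := @convolution_bound R F (weight q M0) (fun v => v%:C) 0 pi 0 pi hpi (lexx 0)
  (pi_ge0 R) fF.1 (weight_integrable L2q L2M) (weight_ge0 q M0) aeF (cmeas_lag _ _).
  by move=> v /andP[v0 v1]; rewrite mul0r expR0 mulr1 cmod_real ger0_norm.
rewrite mulr0 !mul0r => b0.
have I0 : cintegral (I 0 pi) (fun t => (pi - t)%:C * F t) = 0.
  by apply/eqP; rewrite -cmod_eq0 eq_le b0 cmod_ge0.
have := e pi hpi; rewrite y0// mul1r.
rewrite (@eq_cintegral _ _ _ (fun t => (pi - t)%:C * F t)); last first.
  by move=> t; rewrite /= in_itv/= => /andP[t0 t1]; rewrite y0 ?mulr0 ?subr0// !ltW.
by rewrite I0 addr0 => /complexI h; move: p0; rewrite -h ltxx.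
Qed.

(** y - y'(0) S solves the Volterra equation with zero source, so y = y'(0) S on [0, pi], with y'(0)
    nonzero because y is not zero there. *)
Lemma eigenvalue_det_eq0 z : dirichlet_eigenvalue q M0 z -> det z = 0.
Proof.
move=> [y [u [sol y0 ypi [x0 hx0 nz]]]].
have [v [_ s0 v0 vs]] := S_solution (sqrtC z); rewrite sqrtCK in vs.
have vy := solution_vsol sol y0.
have := vsol_linear L2M 1 (- u 0) vy vs => vd.
have vn : vsol q M0 z (fun=> 0) (fun x => 1 * y x + - u 0 * S x (sqrtC z)).
  by apply: vsol_ext vd => // x; ring.
have null := vsol_null vn.
have hpi : 0 <= (pi : R) <= pi by rewrite pi_ge0 lexx.
have := null pi hpi; rewrite ypi mulr0 add0r mulNr => /eqP; rewrite oppr_eq0 mulf_eq0.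
case/orP => /eqP // u0; exfalso; move: nz; rewrite in_itv/= in hx0.
by have := null x0 hx0; rewrite u0 oppr0 mul0r addr0 mul1r => ->; rewrite eqxx.
Qed.

Lemma det_poly_approx (L : R) : 0 < L -> poly_approx det L.
Proof.
move=> L0; apply: (vsol_poly_approx L2q L2M (y := fun w => S ^~ (sqrtC w)) L0) => w.
by have [u [_ _ _]] := S_solution (sqrtC w); rewrite sqrtCK.
Qed.

End Determinant.

(** * Counting eigenvalues in discs *)

Section Counting.
Variable R : realType.
Local Notation C := R[i].
Implicit Types (x t c : R) (z w rho lam : C) (n k : nat).

Definition sine_bound c := 0 < c <= 1 /\ forall rho, exists j : int,
  c * expR (pi * `|complex.Im rho|) * Num.min 1 (cmod (rho - j%:~R)) <= cmod (exp_sine rho pi).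

Lemma cmod_int (j : int) : cmod (j%:~R : C) = `|j|%N%:R.
Proof.
by case: j => m; [rewrite -pmulrn cmod_nat|rewrite NegzE intrN cmodN -pmulrn cmod_nat].
Qed.

Lemma half_integer_dist n rho (j : int) : cmod rho = n%:R + 2^-1 -> 2^-1 <= cmod (rho - j%:~R).
Proof.
move=> rn; apply: le_trans (cmod_dist _ _); rewrite rn cmod_int.
have [h|h] := leqP `|j|%N n.
  have h' : (`|j|%N)%:R <= n%:R :> R by rewrite ler_nat.
  by apply: le_trans (ler_norm _); lra.
have : (n.+1)%:R <= (`|j|%N)%:R :> R by rewrite ler_nat.
by rewrite -natr1 -normrN => h'; apply: le_trans (ler_norm _); lra.
Qed.

(* With [threshold c * N <= |rho|] the perturbation is at most a fixed fraction
   of the lower bound [sine_bound c] for 2i sin(pi rho). *)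
Definition threshold c : R := 16 * Num.sqrt pi / c.

Lemma threshold_gt0 c : 0 < c -> 0 < threshold c.
Proof. by move=> c0; rewrite /threshold divr_gt0// mulr_gt0// sqrtr_gt0 pi_gt0. Qed.

Variables q M0 : R -> C.
Hypotheses (L2q : L2 q) (L2M : L2 M0).
Variable S : R -> C -> C.
Hypothesis isS : is_S q M0 S.

Lemma weight_threshold c s : 0 < c -> 0 < s -> threshold c * pair_norm q M0 <= s ->
  total_weight q M0 / s <= c / 16.
Proof.
move=> c0 s0; rewrite /threshold mulrAC ler_pdivrMr// => h.
rewrite ler_pdivrMr//; have := total_weight_le L2q L2M; lra.
Qed.

(** After multiplication by 2 s and with E = exp(pi |Im rho|) >= 1, the perturbation is at most 2 E
    c / 15 and the sine at least c E / 2; the difference exceeds c / 4. *)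
Lemma det_circle c n w : sine_bound c -> threshold c * pair_norm q M0 <= n%:R + 2^-1 ->
  cmod w = (n%:R + 2^-1) ^+ 2 ->
  cmod (det S w - free_det w) + c / (8 * (n%:R + 2^-1)) <= cmod (free_det w).
Proof.
move=> [/andP[c0 c1] hc] hN wn; set s := n%:R + 2^-1 in hN wn *.
have s0 : 0 < s by rewrite /s ltr_wpDl ?ler0n ?invr_gt0.
pose rho := sqrtC w; have rw : rho ^+ 2 = w by rewrite sqrtCK.
have rs : cmod rho = s.
  apply/eqP; rewrite -(@eqrXn2 _ 2)// ?cmod_ge0 ?(ltW s0)//.
  by rewrite -cmodX rw wn.
have r0 : rho != 0 by rewrite -cmod_gt0 rs.
have [j hj] := hc rho; have dj := half_integer_dist j rs.
have [u [sol y0 u0 _]] := S_solution isS rho.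
have hW := weight_threshold c0 s0 hN.
have := solution_asymptotics L2q L2M sol y0 u0 r0.
move=> /(_ (c / 16)); rewrite rs => /(_ hW).
have c16 : c / 16 < 1 by lra.
move=> /(_ c16).
set E := expR _ in hj *; rewrite [_ * pi]mulrC -/E => asym.
have E1 : 1 <= E.
  apply: le_trans (expR_ge1Dx _); rewrite lerDl mulr_ge0//; exact: pi_ge0.
have th : c / 16 / (1 - c / 16) <= c / 15 by rewrite ler_pdivrMr; [nra|lra].
have {th}asym : cmod (2 * 'i * rho * S pi rho - exp_sine rho pi) <= 2 * E * (c / 15).
  by apply: le_trans asym _; rewrite ler_wpM2l//; lra.
have low : c * E / 2 <= cmod (exp_sine rho pi).
  apply: le_trans hj; rewrite ler_wpM2l//; first by rewrite mulr_ge0//; lra.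
  by rewrite le_min; apply/andP; split; lra.
have c2 : cmod (2 * 'i * rho) = 2 * s.
  by rewrite !cmodM cmod_nat cmod_i mulr1 rs.
have e1 : exp_sine rho pi = 2 * 'i * rho * free_det w.
  rewrite -rw free_detE /sine_kernel (negbTE r0) mulrC divfK//.
  by rewrite mulf_neq0// two_i_neq0.
have e2 : det S w = S pi rho by [].
have c3 v : cmod (2 * 'i * rho * v) = 2 * s * cmod v by rewrite cmodM c2.
move: asym low; rewrite e1 -mulrBr -e2 !c3 => a1 a2.
have s2 : 0 < 2 * s by lra.
rewrite -(ler_pM2l s2) mulrDr.
have -> : 2 * s * (c / (8 * s)) = c / 4 by field; rewrite gt_eqF.
have := ler_wpM2l (ltW c0) E1; lra.
Qed.

Lemma free_det_orders n : exists A0 : seq C, [/\ uniq A0,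
   forall a, a \in A0 -> cmod a < (n%:R + 2^-1) ^+ 2 /\ order_at (@free_det R) a 1,
   forall w, cmod w <= (n%:R + 2^-1) ^+ 2 -> free_det w = 0 -> w \in A0 &
   (\sum_(a <- A0) 1 = n)%N].
Proof.
exists [seq k%:R ^+ 2 | k <- iota 1 n]; split.
- rewrite map_inj_in_uniq ?iota_uniq// => i j _ _ /(congr1 (fun z => cmod z)).
  rewrite !cmodX !cmod_nat => /eqP; rewrite eqrXn2 ?ler0n// eqr_nat => /eqP//.
- move=> a /mapP[k]; rewrite mem_iota => /andP[k0 kn] ->; split; last exact: free_det_order.
  rewrite cmodX cmod_nat ltrXn2r// ?nnegrE ?addr_ge0 ?invr_ge0 ?ler0n//.
  have : k%:R <= n%:R :> R by rewrite ler_nat -ltnS -add1n.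
  lra.
- move=> w wn /free_det_zero/(_ wn)[k /andP[k0 kn] ->]; apply/mapP; exists k => //.
  by rewrite mem_iota k0 add1n ltnS.
- by rewrite big_map sum1_size size_iota.
Qed.

(** Completeness of A is asked for in the open disc only: [det_circle] excludes zeros of the
    determinant on the circle itself. *)
Lemma det_orders c n (A : seq C) (m : C -> nat) : sine_bound c ->
  threshold c * pair_norm q M0 <= n%:R + 2^-1 -> uniq A ->
  (forall a, a \in A -> cmod a < (n%:R + 2^-1) ^+ 2 /\ order_at (det S) a (m a)) ->
  (\sum_(a <- A) m a <= n)%N /\
  ((forall w, cmod w < (n%:R + 2^-1) ^+ 2 -> det S w = 0 -> w \in A) ->
    (\sum_(a <- A) m a = n)%N).
Proof.
move=> hc hN uA hA; have [/andP[c0 c1] _] := hc.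
have s0 : 0 < n%:R + 2^-1 :> R by rewrite ltr_wpDl ?ler0n ?invr_gt0.
have L0 : 0 < (n%:R + 2^-1) ^+ 2 :> R by rewrite exprn_gt0.
have [A0 [uA0 hA0 full0 sum0]] := free_det_orders n.
have d0 : 0 < c / (8 * (n%:R + 2^-1)) by rewrite divr_gt0// mulr_gt0.
have circ w := @det_circle c n w hc hN.
have [h1 h2] := orders_rouche (ltW L0) d0 (det_poly_approx L2q L2M isS L0)
  (free_det_poly_approx L0) circ uA hA uA0 hA0 full0.
rewrite sum0 in h1 h2; split => // full; apply: h2 => w.
rewrite le_eqVlt => /predU1P[wn|]; last exact: full.
move=> dw; have := circ w wn; rewrite dw sub0r cmodN; lra.
Qed.

Variable lam : nat -> C.
Hypothesis eig : forall k, (0 < k)%N -> dirichlet_eigenvalue q M0 (lam k).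
Hypothesis mult : forall z, dirichlet_eigenvalue q M0 z ->
  exists2 m, zero_order (fun w => S pi (sqrtC w)) z m &
    ([set k | (0 < k)%N /\ lam k = z] #= `I_m)%card.
Hypothesis mono : forall j k, (0 < j <= k)%N -> cmod (lam j) <= cmod (lam k).

Lemma card_eq_seq (A : set nat) m : (A #= `I_m)%card ->
  exists s : seq nat, [/\ uniq s, size s = m & forall k, k \in s <-> A k].
Proof.
rewrite card_eq_sym => /card_set_bijP[f0 [fA0 finj0 fsurj0]].
pose f : nat -> nat := f0.
have fA i : (i < m)%N -> A (f i) by exact: fA0.
have fsurj k : A k -> exists2 i, (i < m)%N & f i = k by move=> /fsurj0[i im <-]; exists i.
have finj i j : (i < m)%N -> (j < m)%N -> f i = f j -> i = j.
  by move=> im jm; apply: finj0; rewrite inE.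
exists [seq f i | i <- iota 0 m]; split.
- rewrite map_inj_in_uniq ?iota_uniq// => i j; rewrite !mem_iota /= add0n => im jm.
  exact: finj.
- by rewrite size_map size_iota.
- move=> k; split.
    by move=> /mapP[j]; rewrite mem_iota /= add0n => jm ->; exact: fA.
  by move=> /fsurj[j jm <-]; apply/mapP; exists j => //; rewrite mem_iota.
Qed.

Lemma multiplicities : exists m : C -> nat, forall z, dirichlet_eigenvalue q M0 z ->
  order_at (det S) z (m z) /\
  exists s : seq nat, [/\ uniq s, size s = m z & forall k, k \in s <-> (0 < k)%N /\ lam k = z].
Proof.
have h z : exists m, dirichlet_eigenvalue q M0 z -> order_at (det S) z m /\
  exists s : seq nat, [/\ uniq s, size s = m & forall k, k \in s <-> (0 < k)%N /\ lam k = z].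
  have [e|ne] := pselect (dirichlet_eigenvalue q M0 z); last by exists 0%N.
  have [m hm cm] := mult e; exists m => _; split; first exact: zero_order_order_at.
  exact: card_eq_seq.
by have [m hm] := choice h; exists m.
Qed.

Lemma sum_count_undup (r : seq nat) :
  (\sum_(a <- undup (map lam r)) count (fun k => lam k == a) r = size r)%N.
Proof.
transitivity (\sum_(a <- undup (map lam r)) \sum_(k <- r) (lam k == a)%R)%N.
  by apply: eq_bigr => a _; rewrite -sum1_count big_mkcond; apply: eq_bigr => k _; case: eqP.
rewrite exchange_big -sum1_size; apply: eq_big_seq => k kr.
rewrite (eq_bigr (fun a => if pred1 (lam k) a then 1 else 0)%N).
  by rewrite -big_mkcond sum1_count count_uniq_mem ?undup_uniq// mem_undup map_f.
by move=> a _; rewrite /= eq_sym; case: eqP.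
Qed.

(** Two pigeonhole arguments on indices. If lam n were outside the disc, at most n - 1 indices would
    account for total multiplicity n inside; if lam n.+1 were inside, n + 1 indices would share a
    total multiplicity of at most n. The case n = 0 of the second half serves the first
    eigenvalue. *)
Lemma eigenvalue_bracket c n : sine_bound c -> threshold c * pair_norm q M0 <= n%:R + 2^-1 ->
  ((0 < n)%N -> cmod (lam n) < (n%:R + 2^-1) ^+ 2) /\
  (n%:R + 2^-1) ^+ 2 <= cmod (lam n.+1).
Proof.
move=> hc hN; have [m hm] := multiplicities; split.
  move=> n0; rewrite ltNge; apply/negP => big.
  pose r := [seq k <- iota 1 n.-1 | cmod (lam k) < (n%:R + 2^-1) ^+ 2].
  have rP k : k \in r = (0 < k)%N && (cmod (lam k) < (n%:R + 2^-1) ^+ 2).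
    rewrite mem_filter mem_iota add1n prednK// andbCA; congr andb.
    apply: andb_idr => kn; rewrite ltnNge; apply/negP => nk.
    have := @mono n k; rewrite n0 nk => /(_ isT); lra.
  have memA a : a \in undup (map lam r) -> dirichlet_eigenvalue q M0 a /\
      cmod a < (n%:R + 2^-1) ^+ 2.
    by rewrite mem_undup => /mapP[k]; rewrite rP => /andP[k0 ks] ->; split; first exact: eig.
  have [|_ fullE] := @det_orders c n (undup (map lam r)) m hc hN (undup_uniq _).
    by move=> a /memA[ea as_]; split=> //; case: (hm a ea).
  (* A zero of the determinant has positive order, so some index carries it, and [rP] puts that
     index in r. *)
  have full : forall w, cmod w < (n%:R + 2^-1) ^+ 2 -> det S w = 0 -> w \in undup (map lam r).
    move=> w ws dw; have ew := det_eq0_eigenvalue L2q L2M isS dw.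
    have [ow [s [us ss hs]]] := hm w ew.
    have := order_at_zero_pos ow dw; rewrite -ss.
    case: s us ss hs => // k s _ _ /(_ k); rewrite mem_head => -[/(_ isT)[k0 kw] _] _.
    by rewrite mem_undup; apply/mapP; exists k => //; rewrite rP k0 kw.
  have := fullE full; suff : (\sum_(a <- undup (map lam r)) m a < n)%N by move=> + E; rewrite E ltnn.
  apply: (@leq_ltn_trans (size r)); last first.
    by rewrite size_filter (leq_ltn_trans (count_size _ _))// size_iota prednK.
  rewrite -sum_count_undup; rewrite big_seq [leqRHS]big_seq; apply: leq_sum => a aA.
  have [ea as_] := memA a aA; have [_ [s [us <- hs]]] := hm a ea.
  rewrite -size_filter; apply: uniq_leq_size => // k /hs[k0 kz].
  by rewrite mem_filter kz eqxx rP k0 kz.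
rewrite leNgt; apply/negP => small.
pose r := iota 1 n.+1.
have rP k : k \in r -> (0 < k)%N /\ cmod (lam k) < (n%:R + 2^-1) ^+ 2.
  rewrite mem_iota add1n ltnS => /andP[k0 kn]; split => //.
  by apply: le_lt_trans (mono _) small; rewrite k0.
have memA a : a \in undup (map lam r) -> dirichlet_eigenvalue q M0 a /\
    cmod a < (n%:R + 2^-1) ^+ 2.
  by rewrite mem_undup => /mapP[k /rP[k0 ks] ->]; split; first exact: eig.
have [|le _] := @det_orders c n (undup (map lam r)) m hc hN (undup_uniq _).
  by move=> a /memA[ea as_]; split=> //; case: (hm a ea).
have : (size r <= n)%N; last by rewrite size_iota ltnn.
apply: leq_trans le; rewrite -sum_count_undup.
rewrite big_seq [leqRHS]big_seq; apply: leq_sum => a aA.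
have [ea as_] := memA a aA; have [_ [s [us <- hs]]] := hm a ea.
rewrite -size_filter; apply: uniq_leq_size; first by rewrite filter_uniq// iota_uniq.
move=> k; rewrite mem_filter => /andP[/eqP kz /rP[k0 _]].
by apply/hs.
Qed.

End Counting.

(** * From location in an annulus to the asymptotic estimate *)

Section Estimate.
Variable R : realType.
Local Notation C := R[i].
Implicit Types (x t c r N : R) (z w rho : C) (n k : nat).

(* A first crude bound |z| <= (3/c) t for z = rho - k and t = sqrt(pi) N / |rho|
   is fed back into sin(pi z) = pi z + O(z^2); this constant collects the second
   order terms. *)
Definition quadratic_const c : R :=
  4 * (3 / c + (2 + 5 * expR 1 * (3 / c) + 16 * expR 1 * (3 / c) ^+ 2)).

Lemma quadratic_const_ge0 c : 0 < c -> 0 <= quadratic_const c.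
Proof.
move=> c0; have e0 := expR_gt0 (1 : R); have c3 : 0 < 3 / c by rewrite divr_gt0.
have := mulr_gt0 e0 c3; have := mulr_gt0 e0 (exprn_gt0 2 c3); rewrite /quadratic_const; lra.
Qed.

(** Here x = |rho - k|, r = |rho| and t = sqrt(pi) N / r. The inequality [main] gives pi x <= t + K
    t^2; then k - x <= r replaces t by sqrt(pi) N / k up to another t^2, and r >= k / 2 turns t^2
    terms into N^2 terms. Division by pi leaves the leading coefficient 1 / sqrt(pi). *)
Lemma refine_estimate c x t r N k : 0 < c -> (0 < k)%N -> 0 <= N -> 0 <= x -> 0 <= t <= 16^-1 ->
  0 < r -> t * r = Num.sqrt pi * N -> k%:R / 2 <= r -> k%:R - x <= r ->
  x <= 3 / c * t -> x <= 3 / 16 ->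
  2 * pi * x - 2 * (pi * x) ^+ 2 * expR (pi * x) <= 2 * expR (pi * x) * (t / (1 - t)) ->
  x <= ((Num.sqrt pi)^-1 + quadratic_const c * N) * N * k%:R^-1.
Proof.
move=> c0 k0 N0 x0 /andP[t0 t1] r0 tr kr kxr xt x1 main.
have p0 : 0 < (pi : R) by exact: pi_gt0.
have p4 : (pi : R) < 4 by exact: pi_lt4.
have sp0 : 0 < Num.sqrt (pi : R) by rewrite sqrtr_gt0.
have sp2 : Num.sqrt (pi : R) ^+ 2 = pi by rewrite sqr_sqrtr ?(ltW p0).
have K1 : 1 <= k%:R :> R by rewrite ler1n.
set C1 := 3 / c in xt *; have C10 : 0 < C1 by rewrite /C1 divr_gt0.
pose e1 : R := expR 1; have e10 : 0 < e1 by exact: expR_gt0.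
have px : 0 <= pi * x by rewrite mulr_ge0// ltW.
have px1 : pi * x <= 1 by nra.
have E1 : expR (pi * x) <= e1 by rewrite ler_expR.
have E0 : 0 < expR (pi * x) by exact: expR_gt0.
have E2 : expR (pi * x) <= 1 + 4 * e1 * x.
  have := expR_ge1Dx (- (pi * x)); rewrite expRN => h.
  have := ler_wpM2l (ltW E0) h; rewrite divff ?gt_eqF// => h'.
  have : expR (pi * x) * (pi * x) <= e1 * (4 * x).
    have h4 : pi * x <= 4 * x by rewrite ler_wpM2r// ltW.
    exact: (ler_pM (ltW E0) px E1 h4).
  lra.
have tt : t / (1 - t) <= t * (1 + 2 * t).
  by rewrite ler_pdivrMr; [nra|lra].
have tt0 : 0 <= t / (1 - t) by rewrite divr_ge0//; lra.
have x2 : x ^+ 2 <= C1 ^+ 2 * t ^+ 2.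
  by rewrite -exprMn ler_sqr ?nnegrE// mulr_ge0// ltW.
have h1 : expR (pi * x) * (t / (1 - t)) <= (1 + 4 * e1 * x) * (t * (1 + 2 * t)).
  by apply: ler_pM => //; exact: ltW.
have h2 : (pi * x) ^+ 2 * expR (pi * x) <= 16 * x ^+ 2 * e1.
  apply: ler_pM; [exact: sqr_ge0|exact: ltW| |by []].
  have -> : 16 * x ^+ 2 = (4 * x) ^+ 2 by ring.
  by rewrite ler_sqr ?nnegrE//; nra.
have h3 : 16 * x ^+ 2 * e1 <= 16 * e1 * C1 ^+ 2 * t ^+ 2.
  have := ler_wpM2r (ltW e10) x2; lra.
have h4 : (1 + 4 * e1 * x) * (t * (1 + 2 * t)) <= t + (2 + 5 * e1 * C1) * t ^+ 2.
  have ex : e1 * x <= e1 * (C1 * t) by rewrite ler_wpM2l// ltW.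
  have u0 : 0 <= t * (1 + 2 * t) by rewrite mulr_ge0//; lra.
  have a1 := ler_wpM2r u0 ex.
  have a2 : 0 <= e1 * C1 * t ^+ 2.
    by apply: mulr_ge0; [apply: mulr_ge0; exact: ltW|exact: sqr_ge0].
  have a3 : e1 * C1 * t ^+ 2 * t <= e1 * C1 * t ^+ 2 * 16^-1 by rewrite ler_wpM2l.
  lra.
pose K := 2 + 5 * e1 * C1 + 16 * e1 * C1 ^+ 2.
have K0 : 0 <= K.
  have := mulr_ge0 (ltW e10) (ltW C10); have := mulr_ge0 (ltW e10) (sqr_ge0 C1).
  by rewrite /K; lra.
have pxt : pi * x <= t + K * t ^+ 2 by rewrite /K; lra.
have kt : k%:R * t <= Num.sqrt pi * N + C1 * t ^+ 2.
  have a1 : t * (k%:R - r) <= t * x by rewrite ler_wpM2l//; lra.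
  have a2 : t * x <= t * (C1 * t) by rewrite ler_wpM2l.
  lra.
have kt2 : (k%:R * t) ^+ 2 <= 4 * pi * N ^+ 2.
  have -> : 4 * pi * N ^+ 2 = (2 * (Num.sqrt pi * N)) ^+ 2 by rewrite !exprMn sp2; ring.
  have k00 : 0 <= k%:R * t by rewrite mulr_ge0// ler0n.
  have b1 : k%:R * t <= 2 * (Num.sqrt pi * N) by rewrite -tr; nra.
  by rewrite ler_sqr ?nnegrE//; lra.
have t20 := sqr_ge0 t.
have kt2' : k%:R * t ^+ 2 <= 4 * pi * N ^+ 2.
  apply: le_trans kt2; rewrite exprMn ler_wpM2r//.
  by rewrite expr2 ler_peMr// ler0n.
have t2' : t ^+ 2 <= 4 * pi * N ^+ 2.
  by apply: le_trans kt2'; rewrite ler_peMl.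
have kp : 0 < k%:R :> R by lra.
rewrite ler_pdivlMr// -(ler_pM2l p0).
have -> : pi * (((Num.sqrt pi)^-1 + quadratic_const c * N) * N) =
   Num.sqrt pi * N + 4 * pi * N ^+ 2 * (C1 + K).
  have -> : pi * (((Num.sqrt pi)^-1 + quadratic_const c * N) * N) =
     (pi / Num.sqrt pi) * N + pi * quadratic_const c * N ^+ 2 by ring.
  have -> : pi / Num.sqrt pi = Num.sqrt pi :> R.
    by rewrite -[X in X / _]sp2 expr2 mulfK// gt_eqF.
  by rewrite /quadratic_const /K /C1 /e1; ring.
have b1 := ler_wpM2l (ltW C10) t2'.
have b2 := ler_wpM2l K0 kt2'.
have b3 := ler_wpM2r (ltW kp) pxt.
lra.
Qed.

Variables q M0 : R -> C.
Hypotheses (L2q : L2 q) (L2M : L2 M0).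
Variable S : R -> C -> C.
Hypothesis isS : is_S q M0 S.

Local Notation N := (pair_norm q M0).

Lemma pair_norm_ge0 : 0 <= N.
Proof. by rewrite addr_ge0 ?mulr_ge0 ?sqrtr_ge0. Qed.

Lemma root_estimate c k rho : sine_bound c -> (0 < k)%N ->
  threshold c * N <= k%:R - 2^-1 -> det S (rho ^+ 2) = 0 -> 0 <= complex.Re rho ->
  k%:R - 2^-1 <= cmod rho < k%:R + 2^-1 ->
  cmod (rho - k%:R) <= ((Num.sqrt pi)^-1 + quadratic_const c * N) * N * k%:R^-1.
Proof.
move=> [/andP[c0 c1] hc] k0 hN Dr Rr /andP[r1 r2].
have K1 : 1 <= k%:R :> R by rewrite ler1n.
have N0 := pair_norm_ge0.
have r0 : 0 < cmod rho by lra.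
have rn : rho != 0 by rewrite -cmod_gt0.
have sp0 : 0 <= Num.sqrt (pi : R) by exact: sqrtr_ge0.
pose t := Num.sqrt pi * N / cmod rho.
have tr : t * cmod rho = Num.sqrt pi * N by rewrite divfK// gt_eqF.
have t0 : 0 <= t by rewrite divr_ge0 ?mulr_ge0// ltW.
have tc : t <= c / 16.
  rewrite ler_pdivrMr//; move: hN; rewrite /threshold mulrAC ler_pdivrMr// => h.
  have := ler_wpM2l (ltW c0) r1; lra.
have t1 : t <= 16^-1 by lra.
have Wt : total_weight q M0 / cmod rho <= t.
  by rewrite ler_pdivrMr// tr; exact: total_weight_le.
have [u [sol y0 u0 _]] := S_solution isS (sqrtC (rho ^+ 2)).
rewrite sqrtCK in sol.
have t11 : t < 1 by lra.
have := solution_asymptotics L2q L2M sol y0 u0 rn Wt t11.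
rewrite [S pi _]Dr mulr0 sub0r cmodN [_ * pi]mulrC => up.
have [j hj] := hc rho.
set E := expR _ in hj up.
have E0 : 0 < E by exact: expR_gt0.
have tt : t / (1 - t) <= 16 / 15 * t by rewrite ler_pdivrMr; [nra|lra].
(* At a zero the lower bound for the sine meets the perturbation bound, which yields the crude
   estimate; the minimum cannot be 1 because 3 t / c <= 3/16. *)
have jmin : Num.min 1 (cmod (rho - j%:~R)) <= 3 / c * t.
  have := le_trans hj up => h.
  have h1 : c * E * Num.min 1 (cmod (rho - j%:~R)) <= 2 * E * (16 / 15 * t).
    by apply: le_trans h _; rewrite ler_wpM2l//; lra.
  rewrite mulrAC ler_pdivlMr// -(ler_pM2l E0).
  have := mulr_ge0 (ltW E0) t0; lra.
have t3 : 3 / c * t <= 3 / 16.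
  by rewrite mulrAC ler_pdivrMr//; lra.
have jd : cmod (rho - j%:~R) <= 3 / c * t.
  by move: jmin; rewrite ge_min => /orP[|//]; lra.
(* rho is within 3/16 of j while |rho| lies in [k - 1/2, k + 1/2[, so |j| = k; Re rho >= 0 then
   excludes j = - k. *)
have jabs : `|j|%N = k.
  have := cmod_dist rho j%:~R; rewrite cmod_int ler_norml => /andP[a1 a2].
  case: (ltngtP `|j|%N k) => // hjk; exfalso.
    have : (`|j|.+1)%:R <= k%:R :> R by rewrite ler_nat.
    rewrite -natr1; lra.
  have : (k.+1)%:R <= (`|j|%N)%:R :> R by rewrite ler_nat.
  rewrite -natr1; lra.
have jk : j%:~R = k%:R :> C.
  case: j jabs jd {hj jmin} => [m <-|m mk]; first by rewrite pmulrn.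
  move=> jd; exfalso; have := le_trans (Re_le_cmod _) jd.
  rewrite NegzE intrN opprK -pmulrn ReD Re_nat => h.
  have := ler_norm (complex.Re rho + m.+1%:R); have : 0 <= m%:R :> R by exact: ler0n.
  by rewrite -natr1 in h *; lra.
rewrite jk in jd.
set z := rho - k%:R in jd *.
have zE : rho = z + k%:R by rewrite subrK.
have x0 := cmod_ge0 z.
apply: (@refine_estimate c (cmod z) t (cmod rho)) => //.
- by rewrite t0.
- by lra.
- have := cmod_lerB (k%:R : C) (- z); rewrite cmodN cmod_nat.
  by have -> : k%:R - - z = rho; [rewrite /z; ring|lra].
- by lra.
have nz := exp_sine_near0 z.
have lz : 2 * pi * cmod z - cmod (exp_sine z pi) <= 2 * (pi * cmod z) ^+ 2 * expR (pi * cmod z).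
  have e2 : cmod (2 * 'i * pi%:C * z) = 2 * pi * cmod z.
    by rewrite !cmodM cmod_nat cmod_i cmod_real mulr1 gtr0_norm// pi_gt0.
  have := cmod_lerB (2 * 'i * pi%:C * z) (exp_sine z pi).
  by rewrite [X in _ <= X]cmodC e2; lra.
have ez : cmod (exp_sine z pi) = cmod (exp_sine rho pi).
  by rewrite zE exp_sineDn cmodM cmodX cmodN cmod1 expr1n mul1r.
have EE : E <= expR (pi * cmod z).
  rewrite ler_expR ler_wpM2l ?pi_ge0//.
  have -> : complex.Im rho = complex.Im z.
    rewrite zE ImD -(rmorph_nat (real_complex R)) /= addr0//.
  exact: Im_le_cmod.
have tt0 : 0 <= t / (1 - t) by rewrite divr_ge0//; lra.
have := ler_wpM2r tt0 EE; rewrite ez in lz; lra.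
Qed.

End Estimate.

(** * The estimate for all eigenvalues *)

Section Eigenvalues.
Variable R : realType.
Local Notation C := R[i].

Lemma principal_root_right (lam rho : C) : principal_root lam rho ->
  rho ^+ 2 = lam /\ 0 <= complex.Re rho.
Proof.
move=> [rl [t /andP[t1 t2] rE]]; split => //.
rewrite rE ReM /= mul0r subr0 mulr_ge0 ?cmod_ge0//.
by apply: cos_ge0_pihalf; rewrite t2 ltW.
Qed.

Lemma eigenvalue_estimate : exists2 B : R, 0 < B &
  forall (q M0 : R -> C) (lam rho : nat -> C), L2 q -> L2 M0 ->
    numbered_eigenvalues q M0 lam ->
    (forall k, (0 < k)%N -> principal_root (lam k) (rho k)) ->
    forall k, (0 < k)%N -> cmod (rho k - k%:R) <=
      ((Num.sqrt pi)^-1 + B * pair_norm q M0) * pair_norm q M0 * k%:R^-1.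
Proof.
have [c c01 hc] := exp_sine_lower R; have hsb : sine_bound c by [].
have /andP[c0 _] := c01.
set A := threshold c; have A0 : 0 < A by exact: threshold_gt0.
have Q0 := quadratic_const_ge0 c0.
(* The term 12 A^2 covers the k with k - 1/2 > A N: there k <= 2 A N and |rho_k - k| <= 6 A N. *)
exists (quadratic_const c + 12 * A ^+ 2); first by have := exprn_gt0 2 A0; lra.
move=> q M0 lam rho L2q L2M [S isS [eig mult mono]] roots k k0.
set N := pair_norm q M0; have N0 : 0 <= N by exact: pair_norm_ge0.
have K1 : 1 <= k%:R :> R by rewrite ler1n.
have sp0 : 0 < (Num.sqrt (pi : R))^-1 by rewrite invr_gt0 sqrtr_gt0 pi_gt0.
have bracket n := @eigenvalue_bracket R q M0 L2q L2M S isS lam eig mult mono c n hsb.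
have AN0 : 0 <= A * N by rewrite mulr_ge0// ltW.
have [rl rR] := principal_root_right (roots k k0).
have upper n : (0 < n)%N -> (k <= n)%N -> A * N <= n%:R + 2^-1 -> cmod (rho k) < n%:R + 2^-1.
  move=> n0 kn /bracket[/(_ n0) h _].
  have s0 : 0 <= n%:R + 2^-1 :> R by rewrite addr_ge0 ?ler0n// invr_ge0.
  rewrite -ltr_sqr ?nnegrE ?cmod_ge0// -cmodX rl.
  by apply: le_lt_trans h; apply: mono; rewrite k0.
have [small|large] := leP (A * N) (k%:R - 2^-1).
  have r2 : cmod (rho k) < k%:R + 2^-1 by apply: upper => //; lra.
  have r1 : k%:R - 2^-1 <= cmod (rho k).
    (* The lower bound for |rho_k| comes from the disc with index k - 1, of radius (k - 1/2)^2. *)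
    case: k k0 K1 rl small {rR upper r2} => // n _ K1 rl small.
    have nE : n%:R + 2^-1 = n.+1%:R - 2^-1 :> R by rewrite -natr1; field.
    have [|_] := bracket n; rewrite nE// => h.
    have s1 : 0 <= n.+1%:R - 2^-1 :> R by lra.
    by rewrite -ler_sqr ?nnegrE ?cmod_ge0// -cmodX rl.
  apply: (@le_trans _ _ (((Num.sqrt pi)^-1 + quadratic_const c * N) * N * k%:R^-1)).
    apply: (root_estimate L2q L2M isS hsb k0) => //; last by rewrite r1.
    by rewrite rl; exact: (eigenvalue_det_eq0 L2q L2M isS (eig k k0)).
  rewrite ler_wpM2r ?invr_ge0 ?ler0n// ler_wpM2r// lerD2l ler_wpM2r// lerDl.
  by rewrite mulr_ge0// sqr_ge0.
(* The first integer above A N: a disc large enough for the count, which contains lam n and hence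
   lam k by monotonicity. Since A N > 1/2 here, n + 1/2 is still at most 4 A N. *)
pose n := (Num.truncn (A * N)).+1.
have n1 : A * N < n%:R by exact: truncnS_gt.
have n2 : n%:R <= A * N + 1.
  by rewrite /n -natr1 lerD2r; have := truncn_itv AN0 => /andP[].
have kn : (k <= n)%N.
  rewrite -ltnS -(ltr_nat R) -natr1; lra.
have r2 : cmod (rho k) < n%:R + 2^-1 by apply: upper => //; lra.
have h1 : cmod (rho k - k%:R) <= 6 * (A * N).
  by apply: le_trans (cmodB _ _) _; rewrite cmod_nat; lra.
apply: le_trans h1 _; rewrite ler_pdivlMr; last by lra.
have h2 : 6 * (A * N) * k%:R <= 6 * (A * N) * (2 * (A * N)).
  by rewrite ler_wpM2l//; lra.
have h3 : 0 <= (Num.sqrt pi)^-1 * N by rewrite mulr_ge0// ltW.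
have h4 : 0 <= quadratic_const c * N * N by rewrite mulr_ge0// mulr_ge0.
lra.
Qed.

End Eigenvalues.

Theorem theorem3 (R : realType) :
  exists c2 : R -> R,
    (forall c c' : R, (Num.sqrt pi)^-1 < c -> c < c' -> c2 c' < c2 c) /\
    forall c1 : R, (Num.sqrt pi)^-1 < c1 ->
      [/\ 0 < c2 c1,
          forall (r : R) (q M0 : R -> R[i]) (lam rho : nat -> R[i]),
            0 < r -> L2 q -> L2 M0 -> pair_norm q M0 <= r ->
            numbered_eigenvalues q M0 lam ->
            (forall k, (0 < k)%N -> principal_root (lam k) (rho k)) ->
            forall k, (0 < k)%N ->
              cmod (rho k - k%:R)
                <= Num.max (c2 c1 * r) c1 * pair_norm q M0 * k%:R^-1 &
          forall (q M0 : R -> R[i]) (lam rho : nat -> R[i]),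
            L2 q -> L2 M0 -> pair_norm q M0 <= c1 / c2 c1 ->
            numbered_eigenvalues q M0 lam ->
            (forall k, (0 < k)%N -> principal_root (lam k) (rho k)) ->
            forall k, (0 < k)%N ->
              cmod (rho k - k%:R) <= c1 * pair_norm q M0 * k%:R^-1].
Proof.
have [B B0 hB] := eigenvalue_estimate R.
set s := (Num.sqrt pi)^-1 in hB *.
have s0 : 0 < s by rewrite /s invr_gt0 sqrtr_gt0 pi_gt0.
(* If B N <= c - s then s + B N <= c; otherwise s <= s B N / (c - s). *)
exists (fun c => B * (1 + s / (c - s))); split.
  move=> c c' sc cc'; rewrite ltr_pM2l// ltrD2l ltr_pM2l// ltf_pV2 ?posrE; lra.
move=> c1 sc1; have e0 : 0 < c1 - s by lra.
have c20 : 0 < B * (1 + s / (c1 - s)).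
  by rewrite mulr_gt0//; have := divr_gt0 s0 e0; lra.
have key (N : R) : 0 <= N -> s + B * N <= Num.max (B * (1 + s / (c1 - s)) * N) c1.
  move=> N0; rewrite le_max; have [h|h] := leP (B * N) (c1 - s).
    by apply/orP; right; lra.
  apply/orP; left; have -> : B * (1 + s / (c1 - s)) * N = B * N + s * (B * N / (c1 - s)).
    by field; rewrite gt_eqF.
  rewrite addrC lerD2l ler_peMr ?(ltW s0)//.
  by rewrite ler_pdivlMr// mul1r ltW.
split => //.
  move=> r q M0 lam rho r0 L2q L2M Nr num roots k k0.
  have N0 : 0 <= pair_norm q M0 by exact: pair_norm_ge0.
  apply: le_trans (hB _ _ _ _ L2q L2M num roots k k0) _.
  rewrite ler_wpM2r ?invr_ge0 ?ler0n// ler_wpM2r//; apply: le_trans (key _ N0) _.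
  rewrite ge_max !le_max lexx orbT andbT.
  by apply/orP; left; rewrite ler_wpM2l// ltW.
move=> q M0 lam rho L2q L2M Nr num roots k k0.
have N0 : 0 <= pair_norm q M0 by exact: pair_norm_ge0.
apply: le_trans (hB _ _ _ _ L2q L2M num roots k k0) _.
rewrite ler_wpM2r ?invr_ge0 ?ler0n// ler_wpM2r//; apply: le_trans (key _ N0) _.
rewrite ge_max lexx andbT mulrC.
by rewrite -ler_pdivlMr.
Qed.
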